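(* On $M_9=\mathrm{SU}(18)^4/\Delta\mathrm{Sp}(9)$ there is a normalized Einstein metric in the $2+2$ (balanced) fixed family, $$g_{\mathrm{bal}}=(p,p,q,q;A,B,1),$$ with $$p=1.2372527948223150\ldots,\quad q=1.2845474708446486\ldots,\quad A=1.0396839360703710\ldots,\quad B=0.9632340955343939\ldots.$$ It is asymmetric, positive, and locally unique up to interchange of the two blocks. More precisely, after ordering $p<q$, it is the unique zero of the balanced Einstein map in the rational cube $$\mathcal B_9=\bigl\{(p,q,A,B):\|(p,q,A,B)-c_9\|_\infty\le10^{-8}\bigr\},$$ $$c_9=\Bigl(\tfrac{1237252794822}{10^{12}},\tfrac{1284547470845}{10^{12}},\tfrac{1039683936070}{10^{12}},\tfrac{963234095534}{10^{12}}\Bigr).$$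
   Context: $H=\mathrm{SU}(18)$, $K=\mathrm{Sp}(9)$, $\mathfrak h=\mathfrak k\oplus\mathfrak q$ the Cartan decomposition, $Q=-B_{\mathfrak h}$ on each factor of $\mathfrak h^4$. The tangent space of $H^4/\Delta K$ at the origin is the $Q$-orthogonal complement of $\Delta\mathfrak k$: $\bigoplus_{i=1}^4\mathfrak q_i\oplus(V_4\otimes\mathfrak k)$, $V_4=\{t\in\mathbb R^4:\sum t_i=0\}$, $t\otimes X=(t_1X,\dots,t_4X)$. The metric $(p,p,q,q;A,B,1)$ is the $H^4$-invariant metric with mutually orthogonal summands having scales $p,p,q,q$ (times $Q$) on $\mathfrak q_1,\dots,\mathfrak q_4$ and $A,B,1$ on $u_1\otimes\mathfrak k,u_2\otimes\mathfrak k,u_3\otimes\mathfrak k$, where $u_1=\frac1{\sqrt2}(1,-1,0,0)$, $u_2=\frac1{\sqrt2}(0,0,1,-1)$, $u_3=\frac12(1,1,-1,-1)$. Asymmetric means not ($p=q$ and $A=B=1$); interchange of blocks is $(p,q,A,B)\mapsto(q,p,B,A)$. With $\rho=\dim\mathfrak k/\dim\mathfrak q=9/8$, the Ricci eigenvalues are (up to a common normalization of the Einstein problem) $$r_p=\frac{8p-2A-1}{16p^2},\quad r_q=\frac{8q-2B-1}{16q^2},\quad r_A=\frac{2A^3+(8\rho-4)Ap^2+(1-2\rho)p^2}{16A^2p^2\rho},\quad r_B=\frac{2B^3+(8\rho-4)Bq^2+(1-2\rho)q^2}{16B^2q^2\rho},$$ $$r_C=\frac{2\rho-1}{8\rho}+\frac1{16\rho}\Bigl(\frac1{p^2}+\frac1{q^2}\Bigr)+\frac{2\rho-1}{32\rho}\Bigl(\frac1{A^2}+\frac1{B^2}\Bigr).$$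 The balanced Einstein map has as components (the numerators of) $r_p-r_q$, $r_A-r_B$, $\frac{r_p+r_q}2-r_C$, $\frac{r_A+r_B}2-r_C$; for positive arguments its zeros are exactly the Einstein metrics of this family. *)

(* Defs.v *)
From HB Require Import structures.
From mathcomp Require Import all_boot all_order all_algebra.
From mathcomp Require Import complex reals.

Set Implicit Arguments.
Unset Strict Implicit.
Unset Printing Implicit Defensive.

Import Order.TTheory GRing.Theory Num.Theory.
Local Open Scope ring_scope.

(* 'M[R[i]]_n is canonically a vector space over R[i] only; the alias [cmx R n]
   carries the real structure, which is the one needed for su(n). *)
Definition cmx (R : realType) (n : nat) : Type := 'M[R[i]]_n.

HB.instance Definition _ (R : realType) (n : nat) :=
  GRing.Zmodule.on (cmx R n).

Definition cmx_scale (R : realType) (n : nat) (a : R) (X : cmx R n) : cmx R n :=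
  a%:C%C *: (X : 'M[R[i]]_n).

Fact cmx_scaleA (R : realType) (n : nat) (a b : R) (X : cmx R n) :
  cmx_scale a (cmx_scale b X) = cmx_scale (a * b) X.
Proof. by rewrite /cmx_scale scalerA -rmorphM. Qed.

Fact cmx_scale1 (R : realType) (n : nat) : left_id 1 (@cmx_scale R n).
Proof. by move=> X; rewrite /cmx_scale rmorph1 scale1r. Qed.

Fact cmx_scaleDr (R : realType) (n : nat) :
  right_distributive (@cmx_scale R n) +%R.
Proof. by move=> a X Y; rewrite /cmx_scale scalerDr. Qed.

Fact cmx_scaleDl (R : realType) (n : nat) (X : cmx R n) :
  {morph (@cmx_scale R n)^~ X : a b / a + b}.
Proof. by move=> a b; rewrite /cmx_scale rmorphD scalerDl. Qed.

HB.instance Definition _ (R : realType) (n : nat) :=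
  GRing.Zmodule_isLmodule.Build R (cmx R n)
    (@cmx_scaleA R n) (@cmx_scale1 R n) (@cmx_scaleDr R n) (@cmx_scaleDl R n).

Fact cmx_vect_iso (R : realType) (n : nat) :
  Vector.axiom (n * n + n * n) (cmx R n).
Proof.
pose Re_mx (X : cmx R n) : 'M[R]_n := \matrix_(i, j) complex.Re (X i j).
pose Im_mx (X : cmx R n) : 'M[R]_n := \matrix_(i, j) complex.Im (X i j).
exists (fun X : cmx R n => row_mx (mxvec (Re_mx X)) (mxvec (Im_mx X))).
  move=> a X Y; rewrite scale_row_mx add_row_mx -!linearZ -!linearD /=.
  congr (row_mx (mxvec _) (mxvec _)); apply/matrixP=> i j;
    rewrite !mxE; case: (X i j) (Y i j) => [x y] [z t] /=;
    by rewrite mul0r ?subr0 ?addr0.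
exists (fun v : 'rV[R]_(n * n + n * n) =>
  \matrix_(i, j) Complex (vec_mx (lsubmx v) i j) (vec_mx (rsubmx v) i j)
    : cmx R n).
  move=> X; apply/matrixP=> i j.
  by rewrite mxE row_mxKl row_mxKr !mxvecK !mxE; case: (X i j).
move=> v; rewrite -[RHS]hsubmxK; congr (row_mx _ _);
  by rewrite -[RHS]vec_mxK; congr mxvec; apply/matrixP=> i j; rewrite !mxE.
Qed.

HB.instance Definition _ (R : realType) (n : nat) :=
  Lmodule_hasFinDim.Build R (cmx R n) (@cmx_vect_iso R n).

(* Trace of the restriction to U of an R-linear map f with f @: U <= U. *)
Definition vtrace (R : fieldType) (V : vectType R) (U : {vspace V})
    (f : V -> V) : R :=
  \sum_(i < \dim U) coord (vbasis U) i (f (vbasis U)`_i).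

Definition killing (R : fieldType) (V : vectType R) (br : V -> V -> V)
    (h : {vspace V}) (X Y : V) : R :=
  vtrace h (fun Z => br X (br Y Z)).

(* A homogeneous space G/K with K connected is represented by Lie(K) = k and
   an Ad(K)-invariant complement m, i.e., the tangent space at the origin; both
   lie in an ambient real vector space V with bracket br.  A G-invariant
   Riemannian metric is an ad(k)-invariant inner product g on m.  As everything
   is homogeneous, connection and curvature are determined at the origin. *)

Definition reductive (R : fieldType) (V : vectType R) (br : V -> V -> V)
    (k m : {vspace V}) : Prop :=
  [/\ (k :&: m)%VS = 0%VS,
      forall X Y, X \in k -> Y \in k -> br X Y \in k,
      forall X Y, X \in k -> Y \in m -> br X Y \in m &
      forall X Y, X \in m -> Y \in m -> br X Y \in (k + m)%VS].

Definition invariant_metric (R : realFieldType) (V : vectType R)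
    (br : V -> V -> V) (k m : {vspace V}) (g : V -> V -> R) : Prop :=
  [/\ forall a X Y Z, X \in m -> Y \in m -> Z \in m ->
        g (a *: X + Y) Z = a * g X Z + g Y Z,
      forall X Y, X \in m -> Y \in m -> g X Y = g Y X,
      forall X, X \in m -> X != 0 -> 0 < g X X &
      forall W X Y, W \in k -> X \in m -> Y \in m ->
        g (br W X) Y + g X (br W Y) = 0].

(* Nomizu operator of the Levi-Civita connection: the Koszul formula at the
   origin.  When g is positive definite, it determines L on m x m. *)
Definition levi_civita (R : realFieldType) (V : vectType R)
    (br : V -> V -> V) (k m : {vspace V}) (g : V -> V -> R)
    (L : V -> V -> V) : Prop :=
  let brm X Y := daddv_pi m k (br X Y) in
  forall X Y, X \in m -> Y \in m ->
    L X Y \in m /\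
    (forall Z, Z \in m ->
       2 * g (L X Y) Z = g (brm X Y) Z - g (brm Y Z) X + g (brm Z X) Y).

(* R(X,Y)Z = L_X L_Y Z - L_Y L_X Z - L_([X,Y]_m) Z - [[X,Y]_k, Z]. *)
Definition curvature (R : realFieldType) (V : vectType R)
    (br : V -> V -> V) (k m : {vspace V}) (L : V -> V -> V)
    (X Y Z : V) : V :=
  L X (L Y Z) - L Y (L X Z)
  - L (daddv_pi m k (br X Y)) Z - br (daddv_pi k m (br X Y)) Z.

Definition ricci (R : realFieldType) (V : vectType R)
    (br : V -> V -> V) (k m : {vspace V}) (L : V -> V -> V)
    (X Y : V) : R :=
  vtrace m (fun Z => curvature br k m L Z X Y).

Definition einstein (R : realFieldType) (V : vectType R)
    (br : V -> V -> V) (k m : {vspace V}) (g : V -> V -> R) : Prop :=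
  [/\ reductive br k m, invariant_metric br k m g &
      exists L, levi_civita br k m g L /\
        exists lambda : R, forall X Y, X \in m -> Y \in m ->
          ricci br k m L X Y = lambda * g X Y].

Definition lie (R : realType) (n : nat) (X Y : cmx R n) : cmx R n :=
  X *m Y - Y *m X.

Definition conjtr (R : realType) (n : nat) (X : cmx R n) : cmx R n :=
  (map_mx conjc X)^T.

(* [linfun f] is f itself when f is linear, as it is in all the uses below;
   see [mem_su], [mem_sp], [mem_sp_perp] and [tensE]. *)
Definition su (R : realType) (n : nat) : {vspace cmx R n} :=
  (lker (linfun (fun X : cmx R n => (X + conjtr X)%R)) :&:
   lker (linfun (fun X : cmx R n => (\tr X)%:M%R : cmx R 1)))%VS.

Definition Jmx (R : realType) (n : nat) : cmx R (n + n) :=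
  block_mx 0 1%:M (- 1%:M) 0.

Definition sp (R : realType) (n : nat) : {vspace cmx R (n + n)} :=
  (su R (n + n) :&:
   lker (linfun (fun X : cmx R (n + n) =>
           (X^T *m Jmx R n + Jmx R n *m X)%R : cmx R (n + n))))%VS.

(* The (-1)-eigenspace in su(2n) of the involution X |-> J (conj X) J^-1,
   whose (+1)-eigenspace is sp(n). *)
Definition sp_perp (R : realType) (n : nat) : {vspace cmx R (n + n)} :=
  (su R (n + n) :&:
   lker (linfun (fun X : cmx R (n + n) =>
           (X^T *m Jmx R n - Jmx R n *m X)%R : cmx R (n + n))))%VS.

Definition Qform (R : realType) (n : nat) (X Y : cmx R (n + n)) : R :=
  - killing (@lie R (n + n)) (su R (n + n)) X Y.

Definition pr_sp (R : realType) (n : nat) : 'End(cmx R (n + n)) :=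
  daddv_pi (sp R n) (sp_perp R n).

Definition pr_sp_perp (R : realType) (n : nat) : 'End(cmx R (n + n)) :=
  daddv_pi (sp_perp R n) (sp R n).

Definition lie4 (R : realType) (n : nat) (x y : {ffun 'I_4 -> cmx R n}) :
    {ffun 'I_4 -> cmx R n} :=
  [ffun i => lie (x i) (y i)].

(* t (x) X = (t_1 X, ..., t_4 X) *)
Definition tens (R : realType) (n : nat) (t : 'rV[R]_4) (X : cmx R n) :
    {ffun 'I_4 -> cmx R n} :=
  [ffun i => t 0 i *: X].

Definition tens_space (R : realType) (n : nat) (t : 'rV[R]_4)
    (U : {vspace cmx R n}) : {vspace {ffun 'I_4 -> cmx R n}} :=
  (linfun (tens t) @: U)%VS.

(* uvec is an orthonormal basis u_1, u_2, u_3 of V_4 = {t | sum_i t_i = 0}, so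
   that V_4 (x) k is the direct sum of the u_j (x) k. *)
Definition uvec (R : realType) (j : 'I_3) : 'rV[R]_4 :=
  let s := (Num.sqrt 2)^-1 in
  let h := 2^-1 in
  \row_i (nth [::] [:: [:: s; - s; 0; 0];
                       [:: 0; 0; s; - s];
                       [:: h; h; - h; - h]] j)`_i.

Definition diag_sp (R : realType) (n : nat) :
    {vspace {ffun 'I_4 -> cmx R (n + n)}} :=
  tens_space (const_mx 1) (sp R n).

Definition tangent (R : realType) (n : nat) :
    {vspace {ffun 'I_4 -> cmx R (n + n)}} :=
  (\sum_(i < 4) tens_space (delta_mx 0%R i) (sp_perp R n)
   + \sum_(j < 3) tens_space (uvec R j) (sp R n))%VS.

(* The X_j in the decomposition sum_j u_j (x) X_j of the V_4 (x) k component
   of x. *)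
Definition ucomp (R : realType) (n : nat) (j : 'I_3)
    (x : {ffun 'I_4 -> cmx R (n + n)}) : cmx R (n + n) :=
  \sum_i uvec R j 0 i *: pr_sp R n (x i).

(* The metric (s_1,s_2,s_3,s_4; c_1,c_2,c_3).  Since |u_j| = 1, the restriction
   of Q (+) Q (+) Q (+) Q to u_j (x) k is Q. *)
Definition metric (R : realType) (n : nat) (s c : seq R)
    (x y : {ffun 'I_4 -> cmx R (n + n)}) : R :=
  \sum_(i < 4) s`_i * Qform (pr_sp_perp R n (x i)) (pr_sp_perp R n (y i))
  + \sum_(j < 3) c`_j * Qform (ucomp j x) (ucomp j y).

Definition balanced_einstein (R : realType) (n : nat) (p q A B : R) : Prop :=
  einstein (@lie4 R (n + n)) (diag_sp R n) (tangent R n)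
    (@metric R n [:: p; p; q; q] [:: A; B; 1]).

(* The Ricci eigenvalues on q_1, q_2 and on u_1 (x) k in terms of (p, A); those
   on q_3, q_4 and on u_2 (x) k are the same functions of (q, B).  ric_C is the
   eigenvalue on u_3 (x) k, and rho is dim k / dim q for (SU(18), Sp(9)). *)
Definition rho (R : realType) : R := 9 / 8.

Definition ric_q (R : realType) (p A : R) : R :=
  (8 * p - 2 * A - 1) / (16 * p ^+ 2).

Definition ric_k (R : realType) (p A : R) : R :=
  (2 * A ^+ 3 + (8 * rho R - 4) * A * p ^+ 2 + (1 - 2 * rho R) * p ^+ 2)
  / (16 * A ^+ 2 * p ^+ 2 * rho R).

Definition ric_C (R : realType) (p q A B : R) : R :=
  (2 * rho R - 1) / (8 * rho R)
  + (p ^- 2 + q ^- 2) / (16 * rho R)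
  + (2 * rho R - 1) / (32 * rho R) * (A ^- 2 + B ^- 2).

(* Multiplying by a common denominator turns each difference into its
   numerator. *)
Definition balanced_map (R : realType) (p q A B : R) : R * R * R * R :=
  ((16 * p ^+ 2 * q ^+ 2) * (ric_q p A - ric_q q B),
   (16 * rho R * p ^+ 2 * q ^+ 2 * A ^+ 2 * B ^+ 2)
     * (ric_k p A - ric_k q B),
   (32 * rho R * p ^+ 2 * q ^+ 2 * A ^+ 2 * B ^+ 2)
     * ((ric_q p A + ric_q q B) / 2 - ric_C p q A B),
   (32 * rho R * p ^+ 2 * q ^+ 2 * A ^+ 2 * B ^+ 2)
     * ((ric_k p A + ric_k q B) / 2 - ric_C p q A B)).

(* decimal [:: d0; d1; d2; ...] is d0.d1d2... in base ten. *)
Definition decimal (R : realType) (ds : seq nat) : R :=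
  foldr (fun d x => d%:R + x / 10) 0 ds.

Definition cube9 (R : realType) (p q A B : R) : Prop :=
  [/\ `|p - decimal R [:: 1; 2;3;7; 2;5;2; 7;9;4; 8;2;2]%N| <= 10 ^- 8,
      `|q - decimal R [:: 1; 2;8;4; 5;4;7; 4;7;0; 8;4;5]%N| <= 10 ^- 8,
      `|A - decimal R [:: 1; 0;3;9; 6;8;3; 9;3;6; 0;7;0]%N| <= 10 ^- 8 &
      `|B - decimal R [:: 0; 9;6;3; 2;3;4; 0;9;5; 5;3;4]%N| <= 10 ^- 8].

Lemma linfunE (R : fieldType) (V W : vectType R) (f : V -> W) :
  linear f -> linfun f =1 f.
Proof.
move=> f_lin; pose M := GRing.isLinear.Build R V W *:%R f f_lin.
pose F : {linear V -> W} := HB.pack f M.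
by move=> x; rewrite (lfunE F).
Qed.

Lemma conjtr_linear (R : realType) (n : nat) : linear (@conjtr R n).
Proof.
move=> a X Y; apply/matrixP=> i j; rewrite !mxE rmorphD rmorphM /=.
by rewrite /conjc oppr0.
Qed.

Lemma mem_su (R : realType) (n : nat) (X : cmx R n) :
  (X \in su R n) = (conjtr X == - X) && (\tr X == 0).
Proof.
rewrite memv_cap !memv_ker !linfunE; first last.
- by move=> a Y Z; rewrite conjtr_linear scalerDr addrACA.
- move=> a Y Z; apply/matrixP=> i j; rewrite !mxE !ord1 /= !mulr1n.
  by rewrite linearD linearZ.
rewrite addrC addr_eq0; congr (_ && _).
apply/eqP/eqP=> [/matrixP/(_ 0 0)|->]; first by rewrite !mxE.
by apply/matrixP=> i j; rewrite !mxE mul0rn.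
Qed.

Lemma mem_sp (R : realType) (n : nat) (X : cmx R (n + n)) :
  (X \in sp R n) = (X \in su R (n + n)) && (X^T *m Jmx R n == - (Jmx R n *m X)).
Proof.
rewrite memv_cap memv_ker linfunE ?addr_eq0 // => a Y Z.
by rewrite linearD linearZ mulmxDl mulmxDr -scalemxAl -scalemxAr scalerDr addrACA.
Qed.

Lemma mem_sp_perp (R : realType) (n : nat) (X : cmx R (n + n)) :
  (X \in sp_perp R n) = (X \in su R (n + n)) && (X^T *m Jmx R n == Jmx R n *m X).
Proof.
rewrite memv_cap memv_ker linfunE ?subr_eq0 // => a Y Z.
rewrite linearD linearZ mulmxDl mulmxDr -scalemxAl -scalemxAr scalerBr.
by rewrite opprD addrACA.
Qed.

Lemma tensE (R : realType) (n : nat) (t : 'rV[R]_4) (X : cmx R n) :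
  linfun (tens t) X = tens t X.
Proof.
apply: linfunE => a Y Z; apply/ffunP=> i; rewrite !ffunE scalerDr !scalerA.
by rewrite mulrC.
Qed.

(* Main.v *)
Require Import Defs.
From mathcomp Require Import all_boot all_order all_algebra.
From mathcomp Require Import complex reals.
From HB Require Import structures.
From mathcomp Require Import boolp classical_sets functions topology normedtype
  sequences.
From mathcomp Require Import interval_inference matrix_normedtype.
From Stdlib Require Import ZArith.
From mathcomp Require Import ssrZ zify ring lra.
Delimit Scope nat_scope with N.

Set Implicit Arguments.
Unset Strict Implicit.
Unset Printing Implicit Defensive.

Import Order.TTheory GRing.Theory Num.Theory.
Import numFieldNormedType.Exports.
Local Open Scope ring_scope.

(** Why the theorem holds.

    Einstein metrics are zeros of a polynomial map.  The space is SU(2n)^4 over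
    the diagonal Sp(n), with n = 9; write k = sp(n) and q = sp_perp n, so that
    su(2n) = k + q.  Let Q be minus the Killing form on each factor.  An
    invariant metric is Q(Lam -, -) for a symmetric operator Lam of the tangent
    space m, and its Levi-Civita operator is
      L X Y = ([X, Y]_m + Lam^-1 ([X, Lam Y] - [Lam X, Y])_m) / 2.
    Torsion-freeness and the cyclicity of the trace turn the definition of the
    Ricci tensor into
      tr (Z |-> L Z (L X Y)) - tr (Z |-> L (L Z X) Y) - tr (Z |-> [[Z, X]_k, Y])
    ([ricci_lc]), three traces in which L enters only through the operators
    Z |-> L Z X.  On the seven summands q_1, ..., q_4, u_1 (x) k, ..., u_3 (x) k
    of m these operators have blocks that are multiples of maps ad C with C in
    k or in q ([qcomp_conn], [kcomp_conn]).  So all that is needed of the Lie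
    algebra is the traces of ad C and of ad C ad D on k and on q, and those are
    multiples of Re tr (C D): 2n + 2 on k and 2n - 2 on q if C and D are in k,
    2n on both if they are in q ([vtrace_sp_ad2], [vtrace_perp_ad2],
    [vtrace_ad2_perp_perp]).  For the scales (p,p,q,q;A,B,1) everything off the
    diagonal cancels and the eigenvalues ric_q, ric_k and ric_C remain
    ([ricci_balanced]).  As k and q are not zero, the metric is Einstein exactly
    when the five eigenvalues agree, that is, at the zeros of balanced_map
    ([einstein_zero]).

    Solving the system is a Krawczyk argument.  Four integer polynomials F have
    the zeros of balanced_map, M is an approximate inverse of their Jacobian
    matrix, and x |-> x - M F(x) is a contraction of ratio 1/2 in a box of
    radius 1/10000: the slopes of that map are bounded by exact arithmetic on
    integer balls, which the kernel evaluates ([wide_slopes]).  The box contains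
    the rational cube, hence uniqueness.  The map also sends a box of radius
    10^-18 to itself ([root_residual]), hence existence by the Banach fixed
    point theorem, with all the decimals claimed. *)

Ltac case_ord3 i := case: i => [[|[|[|i]]] ?]; last discriminate.
Ltac case_ord4 i := case: i => [[|[|[|[|i]]]] ?]; last discriminate.

(** * Traces on a subspace *)

(** The curvature of a Levi-Civita operator is linear only along the tangent
    space, so traces are taken of functions that are linear on a subspace. *)
Definition lin_on (R : fieldType) (V W : vectType R) (U : {vspace V}) (f : V ->
  W) :=
  forall a x y, x \in U -> y \in U -> f (a *: x + y) = a *: f x + f y.

Lemma scale_half (R : realFieldType) (V : lmodType R) (x : V) : 2^-1 *: (x + x)
  = x.
Proof.
by rewrite -[x + x]mulr2n -[x *+ 2]scaler_nat scalerA mulVf ?scale1r ?pnatr_eq0.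
Qed.

Section Trace.
Variable R : fieldType.

Lemma lin_on_sum (V W : vectType R) (U : {vspace V}) (f : V -> W) (I : finType)
    (a : I -> R) (x : I -> V) : lin_on U f -> (forall i, x i \in U) ->
  f (\sum_i a i *: x i) = \sum_i a i *: f (x i).
Proof.
move=> fL xU; have f0 : f 0 = 0.
  by have := fL (-1) 0 0 (mem0v U) (mem0v U);
    rewrite scaler0 addr0 scaleN1r addNr.
pose P (v : V) (w : W) := v \in U /\ f v = w.
suff [_ ->] : P (\sum_i a i *: x i) (\sum_i a i *: f (x i)) by [].
elim: (index_enum I) => [|i s [IHU IHf]]; first by rewrite !big_nil; split;
  rewrite ?mem0v.
by rewrite !big_cons; split; [rewrite memvD ?memvZ|rewrite fL ?IHf].
Qed.

Lemma lin_on_linear (V W : vectType R) (U : {vspace V}) (f : V -> W) :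
  linear f -> lin_on U f.
Proof. by move=> h a x y _ _; apply: h. Qed.

Variable V : vectType R.
Implicit Types (U : {vspace V}) (f g : V -> V).

Lemma vbasis_nth_mem U (i : 'I_(\dim U)) : (vbasis U)`_i \in U.
Proof. by apply: vbasis_mem; rewrite mem_nth // size_tuple. Qed.

Lemma eq_vtrace U f g : {in U, f =1 g} -> vtrace U f = vtrace U g.
Proof. by move=> h; apply: eq_bigr => i _; rewrite h ?vbasis_nth_mem. Qed.

Lemma vtraceD U f g : vtrace U (fun x => f x + g x) = vtrace U f + vtrace U g.
Proof. by rewrite /vtrace -big_split /=; apply: eq_bigr => i _; rewrite linearD.
  Qed.

Lemma vtraceZ U a f : vtrace U (fun x => a *: f x) = a * vtrace U f.
Proof. by rewrite /vtrace mulr_sumr; apply: eq_bigr => i _; rewrite linearZ.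
  Qed.

Lemma vtraceN U f : vtrace U (fun x => - f x) = - vtrace U f.
Proof. by rewrite /vtrace -sumrN; apply: eq_bigr => i _; rewrite linearN. Qed.

Lemma vtraceB U f g : vtrace U (fun x => f x - g x) = vtrace U f - vtrace U g.
Proof. by rewrite vtraceD vtraceN. Qed.

Lemma vtrace_sum U (I : finType) (f : I -> V -> V) :
  vtrace U (fun x => \sum_i f i x) = \sum_i vtrace U (f i).
Proof. by rewrite /vtrace exchange_big /=; apply: eq_bigr => i _;
  rewrite linear_sum. Qed.

Lemma vtrace_rank1 U (p : V -> R^o) w : lin_on U p -> w \in U ->
  vtrace U (fun x => p x *: w) = p w.
Proof.
move=> pL wU; rewrite [in RHS](coord_vbasis wU) (lin_on_sum _ pL) => [|i];
  last exact: vbasis_nth_mem.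
by apply: eq_bigr => i _; rewrite linearZ /= mulrC.
Qed.

(** Cyclicity of the trace.  It computes every trace below: a decomposition of
    the space, or a projection, is moved from one side to the other. *)
Lemma vtrace_cycle (V' : vectType R) U (W : {vspace V'}) (f : V ->
  V') (g : V' -> V) :
  lin_on U f -> lin_on W g -> {in U, forall x, f x \in W} -> {in W, forall x,
    g x \in U} ->
  vtrace U (fun x => g (f x)) = vtrace W (fun y => f (g y)).
Proof.
move=> fL gL fW gU.
have gf x : x \in U -> g (f x) = \sum_j coord (vbasis W) j (f x) *: g (vbasis
  W)`_j.
  move=> xU; rewrite [in LHS](coord_vbasis (fW _ xU)) (lin_on_sum _ gL) // => j.
  by apply: vbasis_mem; rewrite mem_nth // size_tuple.
rewrite (eq_vtrace gf) vtrace_sum; apply: eq_bigr => j _.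
have wj : (vbasis W)`_j \in W by apply: vbasis_mem;
  rewrite mem_nth // size_tuple.
rewrite vtrace_rank1 ?gU // => a x y xU yU.
by rewrite fL // linearP.
Qed.

(** The [v i] need only span: the trace of f is that of the sum of the rank-one
    maps [x |-> p i x *: f (v i)].  This allows the projections of the matrix
    units to be used in place of a basis of su or sp. *)
Lemma vtrace_frame U (I : finType) (v : I -> V) (p : I -> V -> R^o) f :
  (forall i, lin_on U (p i)) -> (forall i, v i \in U) ->
  {in U, forall x, x = \sum_i p i x *: v i} ->
  lin_on U f -> {in U, forall x, f x \in U} ->
  vtrace U f = \sum_i p i (f (v i)).
Proof.
move=> pL vU fr fL fU.
have e : {in U, f =1 fun x => \sum_i p i x *: f (v i)}.
  by move=> x xU; rewrite [in LHS](fr _ xU) (lin_on_sum _ fL).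
rewrite (eq_vtrace e) vtrace_sum; apply: eq_bigr => i _.
by rewrite vtrace_rank1 ?fU.
Qed.

End Trace.

(** Only diagonal blocks contribute to a trace; the summands [W i] may live in
    another ambient space, as do the summands of the tangent space. *)
Lemma vtrace_decomp (R : fieldType) (V V' : vectType R) (U : {vspace V}) (I :
  finType)
    (W : I -> {vspace V'}) (p : I -> V -> V') (j : I -> V' -> V) (f : V -> V) :
  (forall i, lin_on U (p i)) -> (forall i, lin_on (W i) (j i)) ->
  (forall i, {in U, forall x, p i x \in W i}) ->
  (forall i, {in W i, forall y, j i y \in U}) ->
  {in U, forall x, x = \sum_i j i (p i x)} ->
  lin_on U f -> {in U, forall x, f x \in U} ->
  vtrace U f = \sum_i vtrace (W i) (fun y => p i (f (j i y))).
Proof.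
move=> pL jL pW jU dec fL fU.
have e : {in U, f =1 fun x => \sum_i f (j i (p i x))}.
  move=> x xU; rewrite [in LHS](dec x xU).
  rewrite (eq_bigr (fun i => 1 *: j i (p i x))) => [|i _];
    last by rewrite scale1r.
  rewrite (lin_on_sum _ fL) => [|i]; last by rewrite jU ?pW.
  by apply: eq_bigr => i _; rewrite scale1r.
rewrite (eq_vtrace e) vtrace_sum; apply: eq_bigr => i _.
apply: (vtrace_cycle (f := p i) (g := fun y => f (j i y)) (W := W i)) => //.
- by move=> a x y xW yW; rewrite jL // fL // jU.
- by move=> y yW; rewrite fU ?jU.
Qed.

Lemma vtrace0 (R : fieldType) (V : vectType R) (f : V -> V) : vtrace 0%VS f = 0.
Proof.
rewrite /vtrace big1 // => i _; exfalso.
by move: (nat_of_ord i) (ltn_ord i) => k; rewrite dimv0.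
Qed.

(** * Levi-Civita operator and Ricci tensor of a metric Q(Lam -, -) *)

Section LeviCivita.
Variables (R : realFieldType) (V : vectType R) (br : V -> V -> V).
Hypothesis brl : forall Y, linear (br^~ Y).
Hypothesis brr : forall X, linear (br X).
Hypothesis brC : forall X Y, br X Y = - br Y X.
Variables (k m : {vspace V}).
Hypothesis red : reductive br k m.
Variable B : V -> V -> R.
Hypothesis Bl : forall a X Y Z, B (a *: X + Y) Z = a * B X Z + B Y Z.
Hypothesis BC : forall X Y, B X Y = B Y X.
Hypothesis Binv : forall X Y Z, B (br X Y) Z = B X (br Y Z).
Hypothesis Bkm : forall X Y, X \in k -> Y \in m -> B X Y = 0.
Variables (Lam Gam : V -> V).
Hypothesis LamL : linear Lam.
Hypothesis GamL : linear Gam.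
Hypothesis Lam_m : {in m, forall X, Lam X \in m}.
Hypothesis Gam_m : {in m, forall X, Gam X \in m}.
Hypothesis GamK : {in m, cancel Gam Lam}.
Hypothesis Lam_sym : {in m &, forall X Y, B (Lam X) Y = B X (Lam Y)}.
Variable g : V -> V -> R.
Hypothesis gE : {in m &, forall X Y, g X Y = B (Lam X) Y}.
Hypothesis g_pos : forall X, X \in m -> X != 0 -> 0 < g X X.

Let pm := daddv_pi m k.
Let pk := daddv_pi k m.

(** The Koszul formula solved for L: as B is invariant, it reads
    2 B(Lam (L X Y), Z) = B(Lam [X, Y]_m + [X, Lam Y] - [Lam X, Y], Z). *)
Definition lc_conn (X Y : V) : V :=
  2^-1 *: (pm (br X Y) + Gam (pm (br X (Lam Y) - br (Lam X) Y))).
Local Notation L := lc_conn.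

Let GamD X Y : Gam (X + Y) = Gam X + Gam Y.
Proof. by rewrite -[X]scale1r GamL !scale1r. Qed.
Let LamD X Y : Lam (X + Y) = Lam X + Lam Y.
Proof. by rewrite -[X]scale1r LamL !scale1r. Qed.
Let Lam0 : Lam 0 = 0.
Proof. by apply: (addIr (Lam 0)); rewrite -LamD !add0r. Qed.
Let LamZ a X : Lam (a *: X) = a *: Lam X.
Proof. by rewrite -[a *: X]addr0 LamL Lam0 addr0. Qed.
Let B0 Z : B 0 Z = 0.
Proof. by have := Bl (-1) 0 0 Z; rewrite scaler0 addr0 mulN1r addNr. Qed.
Let BDl X Y Z : B (X + Y) Z = B X Z + B Y Z.
Proof. by rewrite -[X]scale1r Bl mul1r scale1r. Qed.
Let BZl a X Z : B (a *: X) Z = a * B X Z.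
Proof. by rewrite -[a *: X]addr0 Bl B0 addr0. Qed.
Let BNl X Z : B (- X) Z = - B X Z.
Proof. by rewrite -scaleN1r BZl mulN1r. Qed.

Let km0 : (k :&: m = 0)%VS. Proof. by case: red. Qed.
Let tvec0 : (m :&: k = 0)%VS. Proof. by rewrite capvC. Qed.
Let br_m X Y : X \in m -> Y \in m -> br X Y \in (k + m)%VS.
Proof. by case: red => _ _ _; apply. Qed.
Let pm_m X : pm X \in m. Proof. exact: memv_pi. Qed.
Let pk_k X : pk X \in k. Proof. exact: memv_pi. Qed.
Let pkm X : X \in (k + m)%VS -> X = pk X + pm X.
Proof. by move=> h; rewrite /pk /pm (daddv_pi_add km0 h). Qed.

Let B_pm X Z : X \in (k + m)%VS -> Z \in m -> B (pm X) Z = B X Z.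
Proof. by move=> Xkm Zm; rewrite [in RHS](pkm Xkm) BDl (Bkm (pk_k X) Zm) add0r.
  Qed.

Lemma lc_conn_mem X Y : L X Y \in m.
Proof. by rewrite memvZ // memvD // Gam_m. Qed.

Lemma lc_connP : levi_civita br k m g L.
Proof.
move=> X Y Xm Ym; split=> [|Z Zm]; first exact: lc_conn_mem.
rewrite -/pm !gE // ?lc_conn_mem //.
rewrite /L LamZ LamD GamK // BZl BDl mulrA mulfV ?mul1r ?pnatr_eq0 //.
rewrite B_pm ?rpredB ?br_m ?Lam_m // BDl BNl.
have -> : B (Lam (pm (br Y Z))) X = B (br (Lam X) Y) Z.
  by rewrite Lam_sym // B_pm ?br_m ?Lam_m // BC -Binv.
have -> : B (Lam (pm (br Z X))) Y = B (br X (Lam Y)) Z.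
  by rewrite Lam_sym // B_pm ?br_m ?Lam_m // Binv BC.
ring.
Qed.

Lemma lc_conn_unique L' : levi_civita br k m g L' -> {in m &, L' =2 L}.
Proof.
move=> lc' X Y Xm Ym; apply/eqP; rewrite -subr_eq0; apply/negP=> /negP D0.
have [L'm hL'] := lc' X Y Xm Ym; have [Lm hL] := lc_connP Xm Ym.
have Dm : L' X Y - L X Y \in m by rewrite memvB.
set D := L' X Y - L X Y in D0 Dm *.
have := g_pos Dm D0; rewrite [g D D](_ : _ = g (L' X Y) D - g (L X Y) D);
  last first.
  by rewrite !gE // [in Lam D]/D LamD -scaleN1r LamZ BDl BZl mulN1r.
suff -> : g (L' X Y) D = g (L X Y) D.
  by rewrite subrr ltxx.
have := hL' _ Dm; rewrite -hL // => /mulfI; apply.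
by rewrite pnatr_eq0.
Qed.

Lemma lc_conn_linear_l Y : linear (L^~ Y).
Proof.
move=> a X Z; rewrite /L LamL !brl opprD addrACA -scalerBr !linearP /= GamL.
by rewrite addrACA -scalerDr [LHS]scalerDr !scalerA mulrC.
Qed.

Lemma lc_conn_linear_r X : linear (L X).
Proof.
move=> a Y Z; rewrite /L LamL !brr opprD addrACA -scalerBr !linearP /= GamL.
by rewrite addrACA -scalerDr [LHS]scalerDr !scalerA mulrC.
Qed.

Lemma lc_conn_torsion X Y : L X Y - L Y X = pm (br X Y).
Proof.
rewrite /L [br Y X]brC [br Y (Lam X)]brC [br (Lam Y) X]brC opprK.
rewrite [- br (Lam X) Y + _]addrC -scalerBr opprD addrACA subrr addr0 linearN
  opprK.
exact: scale_half.
Qed.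

(** In tr (Z |-> R(Z, X) Y) replace [Z, X]_m by L Z X - L X Z, since L has no
    torsion.  The term L (L X Z) Y so created has the same trace as
    L X (L Z Y), by cyclicity, and the two cancel. *)
Lemma ricci_lc L' X Y : levi_civita br k m g L' -> X \in m -> Y \in m ->
  ricci br k m L' X Y =
    vtrace m (fun Z => L Z (L X Y)) - vtrace m (fun Z => L (L Z X) Y)
    - vtrace m (fun Z => br (pk (br Z X)) Y).
Proof.
move=> /lc_conn_unique LE Xm Ym.
have e : {in m, (fun Z => curvature br k m L' Z X Y) =1 fun Z =>
    (L Z (L X Y) - L X (L Z Y)) - (L (L Z X) Y - L (L X Z) Y) - br (pk (br Z X))
      Y}.
  move=> Z Zm; rewrite /curvature -/pm -/pk !LE ?lc_conn_mem ?pm_m //.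
  congr (_ - _ - _); rewrite -lc_conn_torsion.
  by rewrite addrC -scaleN1r lc_conn_linear_l scaleN1r addrC.
rewrite /ricci (eq_vtrace e) !vtraceB.
rewrite (vtrace_cycle (f := L^~ Y) (g := L X) (W := m)); first by ring.
- exact/lin_on_linear/lc_conn_linear_l.
- exact/lin_on_linear/lc_conn_linear_r.
- by move=> *; apply: lc_conn_mem.
- by move=> *; apply: lc_conn_mem.
Qed.

End LeviCivita.

(** * Real traces on gl(n, C) and on su(n) *)

Section Lie.
Variables (R : realType) (n : nat).
Implicit Types X Y Z : cmx R n.

Lemma cmx_scaleE (a : R) X : a *: X = (a%:C%C *: (X : 'M_n)) :> 'M[R[i]]_n.
Proof. by []. Qed.

Lemma lie_linear_l Y : linear ((@lie R n)^~ Y).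
Proof.
move=> a X Z; rewrite /lie !cmx_scaleE mulmxDl mulmxDr -scalemxAl -scalemxAr.
by rewrite opprD addrACA -scalerBr.
Qed.

Lemma lie_linear_r X : linear (lie X).
Proof.
move=> a Y Z; rewrite /lie !cmx_scaleE mulmxDl mulmxDr -scalemxAl -scalemxAr.
by rewrite opprD addrACA -scalerBr.
Qed.

Lemma lieC X Y : lie X Y = - lie Y X.
Proof. by rewrite /lie opprB. Qed.

(** The trace form; every Killing form below is a multiple of it. *)
Definition retr X Y : R := complex.Re (\tr ((X : 'M[R[i]]_n) *m Y)).

Lemma Re_D (x y : R[i]) : complex.Re (x + y) = complex.Re x + complex.Re y.
Proof. by case: x y => [a b] [c d]. Qed.
Lemma Re_N (x : R[i]) : complex.Re (- x) = - complex.Re x.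
Proof. by case: x. Qed.
Lemma Re_rM (a : R) (x : R[i]) : complex.Re (a%:C%C * x) = a * complex.Re x.
Proof. by case: x => c d /=; rewrite mul0r subr0. Qed.
Lemma Im_D (x y : R[i]) : complex.Im (x + y) = complex.Im x + complex.Im y.
Proof. by case: x y => [a b] [c d]. Qed.
Lemma Im_rM (a : R) (x : R[i]) : complex.Im (a%:C%C * x) = a * complex.Im x.
Proof. by case: x => c d /=; rewrite mul0r addr0. Qed.

Lemma Re_sum (I : finType) (f : I -> R[i]) :
  complex.Re (\sum_i f i) = \sum_i complex.Re (f i).
Proof. exact: (big_morph _ Re_D). Qed.

Lemma retr_linear a X Y Z : retr (a *: X + Y) Z = a * retr X Z + retr Y Z.
Proof.
by rewrite /retr cmx_scaleE mulmxDl -scalemxAl mxtraceD mxtraceZ Re_D Re_rM.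
Qed.

Lemma retrC X Y : retr X Y = retr Y X.
Proof. by rewrite /retr mxtrace_mulC. Qed.

Lemma retr_inv X Y Z : retr (lie X Y) Z = retr X (lie Y Z).
Proof.
rewrite /retr /lie mulmxBl mulmxBr !raddfB /= -!mulmxA;
  congr (_ - complex.Re _).
by rewrite mxtrace_mulC -mulmxA.
Qed.

Lemma conjtr_lie X Y : conjtr (lie X Y) = - lie (conjtr X) (conjtr Y).
Proof.
rewrite /conjtr /lie map_mxB !map_mxM linearB /= !trmx_mul opprB //.
Qed.

Lemma lie_su X Y : X \in su R n -> Y \in su R n -> lie X Y \in su R n.
Proof.
rewrite !mem_su => /andP[/eqP hX _] /andP[/eqP hY _].
rewrite conjtr_lie hX hY /lie mulNmx mulmxN opprK mulNmx mulmxN opprK eqxx /=.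
by rewrite raddfB /= mxtrace_mulC subrr.
Qed.

(** On su(n), X = - X^* and Re tr (X X) = - sum |X i j|^2. *)
Lemma retr_su_lt0 X : X \in su R n -> X != 0 -> retr X X < 0.
Proof.
rewrite mem_su => /andP[/eqP hX _] X0.
have -> : retr X X = - \sum_i \sum_j (complex.Re (X i j) ^+ 2
  + complex.Im (X i j) ^+ 2).
  rewrite -[X in retr _ X]opprK -hX /retr mulmxN raddfN /= Re_N; congr (- _).
  rewrite /mxtrace Re_sum; apply: eq_bigr => i _.
  rewrite mxE Re_sum; apply: eq_bigr => j _.
  by rewrite !mxE; case: (X i j) => a b /=; ring.
rewrite oppr_lt0 lt_neqAle; have ge0 i j : 0 <= complex.Re (X i j) ^+ 2
  + complex.Im (X i j) ^+ 2.
  by rewrite addr_ge0 ?sqr_ge0.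
rewrite sumr_ge0 ?andbT => [|i _]; last by rewrite sumr_ge0.
apply: contra X0; rewrite eq_sym psumr_eq0 => [/allP h|i _];
  last by rewrite sumr_ge0.
apply/eqP/matrixP => i j; have := h i (mem_index_enum _);
  rewrite psumr_eq0 // => /allP.
move=> /(_ j (mem_index_enum _)); rewrite paddr_eq0 ?sqr_ge0 // !sqrf_eq0 mxE.
by case: (X i j) => a b /= /andP[/eqP -> /eqP ->].
Qed.

Definition rtr (F : cmx R n -> cmx R n) : R := vtrace fullv F.

Lemma rtrE F : linear F -> rtr F = \sum_j \sum_k
  (complex.Re (F (delta_mx j k) j k) + complex.Im (F ('i%C *: delta_mx j k) j
    k)).
Proof.
move=> FL.
pose v (i : ('I_n * 'I_n) * bool) : cmx R n :=
  (if i.2 then 1 else 'i%C) *: (delta_mx i.1.1 i.1.2 : 'M[R[i]]_n).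
pose p (i : ('I_n * 'I_n) * bool) (X : cmx R n) : R^o :=
  if i.2 then complex.Re (X i.1.1 i.1.2) else complex.Im (X i.1.1 i.1.2).
rewrite /rtr (@vtrace_frame _ _ _ _ v p).
- rewrite pair_big /= -(pair_bigA _ (fun jk b => p (jk, b) (F (v (jk, b))))) /=.
  apply: eq_bigr => jk _; rewrite big_bool /= /p /v /= scale1r.
  by [].
- move=> i a X Y _ _; rewrite /p !mxE; case: ifP => _;
  first by rewrite Re_D Re_rM.
  by rewrite Im_D Im_rM.
- by move=> i; apply: memvf.
- move=> X _; apply/matrixP => j k.
  rewrite summxE (bigD1 ((j, k), true)) //=; rewrite (bigD1 ((j, k), false)) /=;
    last by rewrite xpair_eqE andbF.
  rewrite big1 => [|i].
    rewrite !mxE !eqxx /p /=; case: (X j k) => a b.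
    by apply/eqP; rewrite eq_complex /=; apply/andP; split; apply/eqP; ring.
  case: i => [[j' k'] c]; rewrite !mxE /= => /andP[h1 h2].
  have -> : (j == j') && (k == k') = false.
    apply/negP => /andP[/eqP e1 /eqP e2]; move: h1 h2; rewrite e1 e2 {e1 e2}.
    by case: c; rewrite eqxx.
  by rewrite !mulr0.
- exact: lin_on_linear.
- by move=> *; apply: memvf.
Qed.

(** For a complex linear map the two real traces coming from a matrix unit and
    from its multiple by i agree; for an antilinear map they cancel. *)
Lemma rtr_clinear (F : cmx R n -> cmx R n) : linear F ->
    (forall X, F ('i%C *: (X : 'M_n)) = 'i%C *: (F X : 'M_n)) ->
  rtr F = 2 * complex.Re (\sum_j \sum_k F (delta_mx j k) j k).
Proof.
move=> FL Fi; rewrite (rtrE FL) Re_sum mulr_sumr.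
apply: eq_bigr => j _ /=; rewrite Re_sum mulr_sumr.
apply: eq_bigr => k _; rewrite Fi mxE; case: (F _ _ _) => a b /=; ring.
Qed.

Lemma rtr_antilinear (F : cmx R n -> cmx R n) : linear F ->
    (forall X, F ('i%C *: (X : 'M_n)) = - ('i%C *: (F X : 'M_n))) ->
  rtr F = 0.
Proof.
move=> FL Fi; rewrite (rtrE FL) big1 // => j _; rewrite big1 // => k _.
by rewrite Fi !mxE; case: (F _ _ _) => a b /=; ring.
Qed.

Lemma mulmx_delta (A B : 'M[R[i]]_n) a b c d : (A *m delta_mx a b *m B) c d =
  A c a * B b d.
Proof.
rewrite -(mul_delta_mx (0 : 'I_1)) mulmxA -colE -mulmxA -rowE mxE big_ord1.
by rewrite !mxE.
Qed.

Lemma sum_mulmx_delta (A B : 'M[R[i]]_n) :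
  \sum_j \sum_k (A *m delta_mx j k *m B) j k = \tr A * \tr B.
Proof.
rewrite /mxtrace mulr_suml; apply: eq_bigr => j _; rewrite mulr_sumr.
by apply: eq_bigr => k _; rewrite mulmx_delta.
Qed.

Lemma sum_mulmx_tdelta (A B : 'M[R[i]]_n) :
  \sum_j \sum_k (A *m (delta_mx j k)^T *m B) j k = \tr (A *m B^T).
Proof.
rewrite /mxtrace; apply: eq_bigr => j _; rewrite mxE.
by apply: eq_bigr => k _; rewrite trmx_delta mulmx_delta mxE.
Qed.

Definition ad2 X Y Z := lie X (lie Y Z).

Lemma ad2E X Y Z : ad2 X Y Z =
  ((X *m Y) *m Z *m 1%:M - X *m Z *m Y - Y *m Z *m X + 1%:M *m Z *m (Y *m X))%R.
Proof.
rewrite /ad2 /lie mulmxBl mulmxBr mulmx1 mul1mx !mulmxA.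
by rewrite opprB addrA addrAC.
Qed.

Lemma ad2_linear X Y : linear (ad2 X Y).
Proof. by move=> a U W; rewrite /ad2 lie_linear_r lie_linear_r. Qed.

Lemma lie_Ci X Y : lie X ('i%C *: (Y : 'M_n) : cmx R n) =
  'i%C *: (lie X Y : 'M_n).
Proof. by rewrite /lie -scalemxAl -scalemxAr -scalerBr. Qed.

Lemma conjtr_Ci X : conjtr ('i%C *: (X : 'M_n) : cmx R n) =
  - ('i%C *: (conjtr X : 'M_n)).
Proof.
apply/matrixP => i j; rewrite !mxE; case: (X j i) => a b /=.
by apply/eqP; rewrite eq_complex /=; apply/andP; split; apply/eqP; ring.
Qed.

Lemma rtrZ a F : rtr (fun X => a *: F X) = a * rtr F.
Proof. exact: vtraceZ. Qed.
Lemma rtrD F G : rtr (fun X => F X + G X) = rtr F + rtr G.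
Proof. exact: vtraceD. Qed.
Lemma rtrB F G : rtr (fun X => F X - G X) = rtr F - rtr G.
Proof. exact: vtraceB. Qed.

(** The trace on U is the trace on all matrices after projecting onto U. *)
Lemma vtrace_proj (U : {vspace cmx R n}) (P f : cmx R n -> cmx R n) :
  linear P -> (forall X, P X \in U) -> {in U, forall X, P X = X} ->
  linear f -> {in U, forall X, f X \in U} ->
  vtrace U f = rtr (fun X => f (P X)).
Proof.
move=> PL PU PK fL fU.
rewrite (eq_vtrace (g := fun X => P (f X))) => [|X XU]; last by rewrite PK ?fU.
apply: vtrace_cycle; [exact: lin_on_linear|exact: lin_on_linear|move=> *|move=>
  *].
  exact: memvf.
exact: PU.
Qed.

Definition skew X : cmx R n := 2^-1 *: (X - conjtr X).

Lemma skew_linear : linear skew.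
Proof.
move=> a X Y; rewrite /skew conjtr_linear opprD addrACA -scalerBr scalerDr
  !scalerA.
by rewrite [a * _]mulrC.
Qed.

Lemma conjtrK X : conjtr (conjtr X) = X.
Proof.
by apply/matrixP => i j; rewrite !mxE; case: (X i j) => a b /=;
  rewrite /conjc opprK.
Qed.

Lemma conjtrD X Y : conjtr (X + Y) = conjtr X + conjtr Y.
Proof. by rewrite -[X]scale1r conjtr_linear !scale1r. Qed.

Lemma conjtr0 : conjtr (0 : cmx R n) = 0.
Proof. by apply: (addIr (conjtr 0)); rewrite -conjtrD !add0r. Qed.

Lemma conjtrZ a X : conjtr (a *: X) = a *: conjtr X.
Proof. by rewrite -[a *: X]addr0 conjtr_linear conjtr0 addr0. Qed.

Lemma conjtrN X : conjtr (- X) = - conjtr X.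
Proof. by rewrite -scaleN1r conjtrZ scaleN1r. Qed.

Lemma conjtr_skew X : conjtr (skew X) = - skew X.
Proof. by rewrite /skew conjtrZ conjtrD conjtrN conjtrK -scalerN opprB. Qed.

Lemma skew_id X : conjtr X = - X -> skew X = X.
Proof.
move=> h; by rewrite /skew h opprK scale_half.
Qed.

Lemma conjtr_scalar (c : R[i]) : conjtr (c%:M : cmx R n) = (conjc c)%:M.
Proof. by rewrite /conjtr map_scalar_mx tr_scalar_mx. Qed.

Lemma tr_conjtr X : \tr (conjtr X) = conjc (\tr X).
Proof. by rewrite mxtrace_tr trace_map_mx. Qed.

Lemma lie_scalar X (c : R[i]) : lie X (c%:M : cmx R n) = 0.
Proof. by rewrite /lie scalar_mxC subrr. Qed.

(** The projection of gl(n, C) onto su(n): skew-Hermitian part, then the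
    traceless part. *)
Definition su_proj X : cmx R n :=
  skew X - ((n%:R)^-1 * \tr (skew X))%:M.

(** The projection onto su(n) is half the identity, minus half the conjugate
    transpose, plus a scalar matrix.  A complex linear f sees only the first
    term: the second is antilinear, and f kills the third. *)
Lemma vtrace_su f : (0 < n)%N -> linear f -> {in su R n, forall X,
  f X \in su R n} ->
  (forall X, f ('i%C *: (X : 'M_n)) = 'i%C *: (f X : 'M_n)) ->
  (forall c : R[i], f (c%:M : cmx R n) = 0) ->
  vtrace (su R n) f = complex.Re (\sum_j \sum_k f (delta_mx j k) j k).
Proof.
move=> n0 fL fU fi f1.
have n0' : n%:R != 0 :> R[i] by rewrite pnatr_eq0 -lt0n.
have fD X Y : f (X + Y) = f X + f Y by rewrite -[X]scale1r fL !scale1r.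
have f0 : f 0 = 0 by apply: (addIr (f 0)); rewrite -fD !add0r.
have fZ a X : f (a *: X) = a *: f X by rewrite -[a *: X]addr0 fL f0 addr0.
have fN X : f (- X) = - f X by rewrite -scaleN1r fZ scaleN1r.
rewrite (@vtrace_proj _ su_proj) //.
- have e X : f (su_proj X) = 2^-1 *: (f X - f (conjtr X)).
    by rewrite /su_proj /skew fD fN f1 subr0 fZ fD fN.
  rewrite /rtr (eq_vtrace (fun X _ => e X)) -/(rtr _) rtrZ rtrB.
  rewrite [X in _ - X]rtr_antilinear; first by rewrite subr0 rtr_clinear //
    mulrA mulVf ?mul1r ?pnatr_eq0.
    by move=> a X Y; rewrite conjtr_linear fL.
  by move=> X; rewrite conjtr_Ci fN fi.
- move=> a X Y; rewrite /su_proj skew_linear mxtraceD cmx_scaleE mxtraceZ.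
  rewrite mulrDr mulrCA raddfD /= opprD addrACA; congr (_ + _).
  by rewrite cmx_scaleE scalerBr scale_scalar_mx.
- move=> X; rewrite mem_su /su_proj conjtrD conjtrN conjtr_skew conjtr_scalar.
  set t := \tr (skew X); have tE : conjc (n%:R^-1 * t) = - (n%:R^-1 * t).
    rewrite /t rmorphM fmorphV rmorph_nat /= -tr_conjtr conjtr_skew.
    by rewrite [\tr (- _)]raddfN mulrN.
  apply/andP; split; apply/eqP.
    by rewrite tE opprB raddfN /= opprK addrC.
  rewrite [LHS]raddfB /= mxtrace_scalar -[X in _ - X]mulr_natl.
  by rewrite mulrA mulfV // mul1r subrr.
- move=> X; rewrite mem_su => /andP[/eqP h /eqP t0].
  by rewrite /su_proj skew_id // t0 mulr0 raddf0 subr0.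
Qed.

Lemma addmxE (A B : 'M[R[i]]_n) j k : (A + B) j k = A j k + B j k.
Proof. by rewrite mxE. Qed.
Lemma oppmxE (A : 'M[R[i]]_n) j k : (- A) j k = - A j k.
Proof. by rewrite mxE. Qed.
Lemma submxE (A B : 'M[R[i]]_n) j k : (A - B) j k = A j k - B j k.
Proof. by rewrite !mxE. Qed.

Lemma sum_ad2 X Y : \sum_j \sum_k ad2 X Y (delta_mx j k) j k =
  \tr (X *m Y) *+ (2 * n) - \tr X * \tr Y *+ 2.
Proof.
under eq_bigr do under eq_bigr do rewrite ad2E addmxE !submxE.
under eq_bigr do rewrite big_split /= !sumrB.
rewrite big_split /= !sumrB !sum_mulmx_delta mxtrace1 [\tr (Y *m
  X)]mxtrace_mulC.
rewrite -[_ *+ (2 * n)]mulr_natr natrM; ring.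
Qed.

Lemma vtrace_su_ad2 X Y : (0 < n)%N -> X \in su R n -> Y \in su R n ->
  vtrace (su R n) (ad2 X Y) = (2 * n)%:R * retr X Y.
Proof.
move=> n0 Xsu Ysu; rewrite vtrace_su //.
- rewrite sum_ad2; move: Xsu Ysu; rewrite !mem_su => /andP[_ /eqP ->] _.
  rewrite mul0r mul0rn subr0 /retr; elim: (2 * n)%N => [|k IH];
    first by rewrite mul0r.
  by rewrite mulrS Re_D IH [in RHS]mulrS mulrDl mul1r.
- exact: ad2_linear.
- by move=> Z Zsu; rewrite /ad2 !lie_su.
- by move=> Z; rewrite /ad2 !lie_Ci.
- by move=> c; rewrite /ad2 lie_scalar /lie mulmx0 mul0mx subrr.
Qed.

Lemma sum_lie X : \sum_j \sum_k lie X (delta_mx j k : cmx R n) j k = 0.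
Proof.
rewrite (eq_bigr (fun j => \sum_k ((X *m delta_mx j k *m 1%:M)%R j k - (1%:M *m
  delta_mx j k *m X)%R j k))).
  under eq_bigr do rewrite sumrB.
  by rewrite sumrB !sum_mulmx_delta mulrC subrr.
by move=> j _; apply: eq_bigr => k _; rewrite /lie mulmx1 mul1mx submxE.
Qed.

Lemma vtrace_su_lie X : (0 < n)%N -> X \in su R n -> vtrace (su R n) (lie X) =
  0.
Proof.
move=> n0 Xsu; rewrite vtrace_su ?sum_lie //.
- exact: lie_linear_r.
- by move=> Z Zsu; rewrite lie_su.
- by move=> Z; rewrite lie_Ci.
- by move=> c; rewrite lie_scalar.
Qed.

End Lie.

(** * The symmetric pair (su(2m), sp(m)) *)

Section Sp.
Variables (R : realType) (m : nat).
Local Notation N := (m + m)%N.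
Implicit Types X Y Z : cmx R N.
Local Notation J := (Jmx R m : 'M[R[i]]_N).

Lemma JJ : J *m J = - 1%:M.
Proof.
rewrite /Jmx mulmx_block !(mul0mx, mulmx0, mulmx1, mul1mx, mulNmx, add0r,
  addr0).
by rewrite scalar_mx_block opp_block_mx !oppr0.
Qed.

Lemma trJ : J^T = - J.
Proof. by rewrite /Jmx tr_block_mx !trmx0 linearN /= trmx1 opp_block_mx !oppr0
  opprK. Qed.

Lemma conjJ : map_mx conjc J = J.
Proof. by rewrite /Jmx map_block_mx map_mxN !map_mx0 map_mx1. Qed.

(** A complex linear involution: on su(2m) its fixed space is sp(m) and its
    (-1)-eigenspace is the complement q. *)
Definition symp X : cmx R N := J *m X^T *m J.

Lemma symp_linear : linear symp.
Proof.
move=> a X Y; rewrite /symp !cmx_scaleE linearP /= mulmxDr mulmxDl.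
by rewrite -scalemxAr -scalemxAl.
Qed.

Lemma sympK X : symp (symp X) = X.
Proof.
rewrite /symp !trmx_mul trmxK trJ !(mulNmx, mulmxN) opprK !mulmxA JJ !mulNmx
  mul1mx.
by rewrite -mulmxA JJ mulmxN mulmx1 opprK.
Qed.

Lemma symp_conjtr X : symp (conjtr X) = conjtr (symp X).
Proof.
by rewrite /symp /conjtr trmxK !map_mxM /= conjJ -map_trmx !trmx_mul trmxK trJ
  !(mulNmx, mulmxN) opprK mulmxA.
Qed.

Lemma tr_symp X : \tr (symp X) = - \tr X.
Proof.
by rewrite /symp mxtrace_mulC mulmxA JJ mulNmx mul1mx raddfN /= mxtrace_tr.
Qed.

Lemma sp_symp X : (X^T *m J == - (J *m X)) = (symp X == X).
Proof.
rewrite /symp; apply/eqP/eqP => [h|h].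
  by rewrite -mulmxA h mulmxN mulmxA JJ mulNmx mul1mx opprK.
by rewrite -[in RHS]h !mulmxA JJ !mulNmx mul1mx opprK.
Qed.

Lemma sp_perp_symp X : (X^T *m J == J *m X) = (symp X == - X).
Proof.
rewrite /symp; apply/eqP/eqP => [h|h].
  by rewrite -mulmxA h mulmxA JJ mulNmx mul1mx.
apply: oppr_inj; rewrite -[in RHS]mulmxN -[in RHS]h !mulmxA JJ !mulNmx mul1mx
  //.
Qed.

Lemma mem_sp_symp X : (X \in sp R m) = (X \in su R N) && (symp X == X).
Proof. by rewrite mem_sp sp_symp. Qed.

Lemma mem_sp_perp_symp X : (X \in sp_perp R m) =
  (X \in su R N) && (symp X == - X).
Proof. by rewrite mem_sp_perp sp_perp_symp. Qed.

Lemma sympD X Y : symp (X + Y) = symp X + symp Y.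
Proof. by rewrite -[X]scale1r symp_linear !scale1r. Qed.

Lemma symp0 : symp 0 = 0.
Proof. by apply: (addIr (symp 0)); rewrite -sympD !add0r. Qed.

Lemma sympZ a X : symp (a *: X) = a *: symp X.
Proof. by rewrite -[a *: X]addr0 symp_linear symp0 addr0. Qed.

Lemma sympN X : symp (- X) = - symp X.
Proof. by rewrite -scaleN1r sympZ scaleN1r. Qed.

Lemma symp_lie X Y : symp (lie X Y) = lie (symp X) (symp Y).
Proof.
have sM (A B : 'M[R[i]]_N) : J *m (A *m B)^T *m J =
  - (J *m B^T *m J *m (J *m A^T *m J)).
  by rewrite trmx_mul !mulmxA -[_ *m J *m J]mulmxA JJ mulmxN mulmx1 !mulNmx
    opprK.
by rewrite /symp /lie linearB /= mulmxBr mulmxBl !sM opprK addrC.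
Qed.

Lemma symp_Ci X : symp ('i%C *: (X : 'M_N)) = 'i%C *: (symp X : 'M_N).
Proof. by rewrite /symp linearZ /= -scalemxAr -scalemxAl. Qed.

(** The trace of the complex linear map X |-> A (symp X) B. *)
Lemma sum_symp (A B : 'M[R[i]]_N) :
  \sum_j \sum_k (A *m symp (delta_mx j k) *m B) j k = - \tr (A *m symp B).
Proof.
under eq_bigr do under eq_bigr do rewrite /symp !mulmxA -[_ *m J *m B]mulmxA.
rewrite sum_mulmx_tdelta trmx_mul trJ !mulmxN raddfN /= /symp !mulmxA;
  reflexivity.
Qed.

Definition sp_proj X : cmx R N := 2^-1 *: (skew X + symp (skew X)).

Lemma sp_proj_linear : linear sp_proj.
Proof.
move=> a X Y; rewrite /sp_proj skew_linear symp_linear addrACA -scalerDr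
  [LHS]scalerDr !scalerA.
by rewrite [a * _]mulrC.
Qed.

Lemma sp_proj_sp X : sp_proj X \in sp R m.
Proof.
rewrite /sp_proj; move: (skew X) (conjtr_skew X) => S hS.
rewrite mem_sp_symp mem_su sympZ sympD sympK [symp S + S]addrC eqxx andbT.
rewrite conjtrZ conjtrD -symp_conjtr hS sympN -opprD scalerN eqxx /=.
by rewrite cmx_scaleE mxtraceZ mxtraceD tr_symp subrr mulr0.
Qed.

Lemma sp_proj_id X : X \in sp R m -> sp_proj X = X.
Proof.
rewrite mem_sp_symp mem_su => /andP[/andP[/eqP h _] /eqP s].
by rewrite /sp_proj skew_id // s scale_half.
Qed.

(** As for su(2m), but the projection onto sp(m) also averages over [symp], so
    the complex linear part of f composed with it is (f + f o symp) / 4. *)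
Lemma vtrace_sp f t u : linear f -> {in sp R m, forall X, f X \in sp R m} ->
  (forall X, f ('i%C *: (X : 'M_N)) = 'i%C *: (f X : 'M_N)) ->
  \sum_j \sum_k f (delta_mx j k) j k = t ->
  \sum_j \sum_k f (symp (delta_mx j k)) j k = u ->
  vtrace (sp R m) f = 2^-1 * (complex.Re t + complex.Re u).
Proof.
move=> fL fU fi <- <-.
have fD X Y : f (X + Y) = f X + f Y by rewrite -[X]scale1r fL !scale1r.
have f0 : f 0 = 0 by apply: (addIr (f 0)); rewrite -fD !add0r.
have fZ a X : f (a *: X) = a *: f X by rewrite -[a *: X]addr0 fL f0 addr0.
have fN X : f (- X) = - f X by rewrite -scaleN1r fZ scaleN1r.
rewrite (vtrace_proj sp_proj_linear sp_proj_sp) //; last by move=> X;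
  apply: sp_proj_id.
have e X : f (sp_proj X) = 4^-1 *: ((f X + f (symp X)) - (f (conjtr X)
  + f (symp (conjtr X)))).
  rewrite /sp_proj /skew sympZ sympD sympN -scalerDr scalerA fZ -invfM -natrM.
  by rewrite addrACA -opprD !fD fN fD.
rewrite /rtr (eq_vtrace (fun X _ => e X)) -/(rtr _) rtrZ rtrB rtrD.
rewrite [X in _ - X]rtr_antilinear ?subr0.
- rewrite !rtr_clinear // -?mulrDr; first by rewrite mulrA; congr (_ * _);
  field.
    by move=> a X Y; rewrite symp_linear fL.
  by move=> X; rewrite symp_Ci fi.
- move=> a X Y; rewrite conjtr_linear symp_linear !fL.
  by rewrite addrACA -scalerDr.
- by move=> X; rewrite conjtr_Ci sympN symp_Ci !fN !fi -opprD scalerDr.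
Qed.

Lemma symp1 : symp (1%:M : 'M_N) = - 1%:M.
Proof. by rewrite /symp trmx1 mulmx1 JJ. Qed.

Lemma lie_sp X Y : X \in sp R m -> Y \in sp R m -> lie X Y \in sp R m.
Proof.
rewrite !mem_sp_symp => /andP[hX /eqP sX] /andP[hY /eqP sY].
by rewrite lie_su // symp_lie sX sY /=.
Qed.

Lemma lie_sp_perp X Y : X \in sp R m -> Y \in sp_perp R m ->
  lie X Y \in sp_perp R m.
Proof.
rewrite mem_sp_symp !mem_sp_perp_symp => /andP[hX /eqP sX] /andP[hY /eqP sY].
by rewrite lie_su // symp_lie sX sY /lie mulmxN mulNmx opprK opprB addrC eqxx.
Qed.

Lemma lie_perp_sp X Y : X \in sp_perp R m -> Y \in sp R m ->
  lie X Y \in sp_perp R m.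
Proof. by move=> hX hY; rewrite lieC rpredN lie_sp_perp. Qed.

Lemma lie_perp_perp X Y : X \in sp_perp R m -> Y \in sp_perp R m ->
  lie X Y \in sp R m.
Proof.
rewrite mem_sp_symp !mem_sp_perp_symp => /andP[hX /eqP sX] /andP[hY /eqP sY].
by rewrite lie_su // symp_lie sX sY /lie !(mulmxN, mulNmx, opprK) eqxx.
Qed.

Lemma sp_su X : X \in sp R m -> X \in su R N.
Proof. by rewrite mem_sp_symp => /andP[]. Qed.
Lemma sp_perp_su X : X \in sp_perp R m -> X \in su R N.
Proof. by rewrite mem_sp_perp_symp => /andP[]. Qed.

Lemma tr_su X : X \in su R N -> \tr X = 0.
Proof. by rewrite mem_su => /andP[_ /eqP]. Qed.

Lemma Re_mulrn (x : R[i]) k : complex.Re (x *+ k) = complex.Re x *+ k.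
Proof. by elim: k => [|k IH]; rewrite ?mulr0n // !mulrS Re_D IH. Qed.

Lemma sum_ad2_symp X Y : X \in sp R m -> Y \in sp R m ->
  \sum_j \sum_k ad2 X Y (symp (delta_mx j k)) j k = \tr (X *m Y) *+ 4.
Proof.
move=> Xsp Ysp.
have sX : symp X = X by move: Xsp; rewrite mem_sp_symp => /andP[_ /eqP].
have sY : symp Y = Y by move: Ysp; rewrite mem_sp_symp => /andP[_ /eqP].
under eq_bigr do under eq_bigr do rewrite ad2E addmxE !submxE.
under eq_bigr do rewrite big_split /= !sumrB.
rewrite big_split /= !sumrB !sum_symp symp1 sX sY mulmxN mulmx1 mul1mx tr_symp.
rewrite raddfN /= !opprK [\tr (Y *m X)]mxtrace_mulC.
by rewrite !mulrS mulr0n addr0 !addrA.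
Qed.

(** Up to the factor 2m + 2 in place of 4m, the Killing form of sp(m) is that of
    su(2m). *)
Lemma vtrace_sp_ad2 X Y : X \in sp R m -> Y \in sp R m ->
  vtrace (sp R m) (ad2 X Y) = (2 * m.+1)%:R * retr X Y.
Proof.
move=> Xsp Ysp.
rewrite (vtrace_sp (ad2_linear X Y) _ _ (sum_ad2 X Y) (sum_ad2_symp Xsp Ysp)).
- rewrite (tr_su (sp_su Xsp)) mul0r mul0rn subr0.
  rewrite /retr; move: (\tr _) => t; rewrite (Re_mulrn t (2 * N)) (Re_mulrn t
    4).
  by rewrite -[_ *+ (2 * N)]mulr_natl -[_ *+ 4]mulr_natl !natrM natrD -natr1;
    field.
- by move=> Z Zsp; rewrite /ad2 !lie_sp.
- by move=> Z; rewrite /ad2 !lie_Ci.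
Qed.

Lemma vtrace_sp_lie X : X \in sp R m -> vtrace (sp R m) (lie X) = 0.
Proof.
move=> Xsp; rewrite (@vtrace_sp _ 0 0); first by rewrite addr0 mulr0.
- exact: lie_linear_r.
- by move=> Z Zsp; rewrite lie_sp.
- by move=> Z; rewrite lie_Ci.
- exact: sum_lie.
rewrite (eq_bigr (fun j => \sum_k ((X *m symp (delta_mx j k) *m 1%:M)%R j k -
  (1%:M *m symp (delta_mx j k) *m X)%R j k))).
  under eq_bigr do rewrite sumrB.
  rewrite sumrB !sum_symp symp1 mulmxN mulmx1 mul1mx tr_symp raddfN /= opprK.
  by rewrite (tr_su (sp_su Xsp)) subrr.
by move=> j _; apply: eq_bigr => k _; rewrite /lie mulmx1 mul1mx submxE.
Qed.

Lemma sp_cap_perp : (sp R m :&: sp_perp R m = 0)%VS.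
Proof.
apply/eqP; rewrite -subv0; apply/subvP => X; rewrite memv_cap memv0.
rewrite mem_sp_symp mem_sp_perp_symp => /andP[/andP[_ /eqP ->] /andP[_ h]].
by rewrite -[X]scale_half; move: h; rewrite -addr_eq0 => /eqP ->;
  rewrite scaler0.
Qed.

Definition half_symp (b : bool) X : cmx R N := 2^-1 *: (X
  + (-1) ^+ b *: symp X).

Lemma half_symp_sp X : X \in su R N -> half_symp false X \in sp R m.
Proof.
move=> Xsu; rewrite /half_symp expr0 scale1r memvZ // mem_sp_symp sympD sympK
  addrC eqxx andbT.
rewrite memvD //; move: Xsu; rewrite !mem_su => /andP[/eqP h /eqP t].
by rewrite -symp_conjtr h sympN eqxx tr_symp t oppr0 eqxx.
Qed.

Lemma half_symp_perp X : X \in su R N -> half_symp true X \in sp_perp R m.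
Proof.
move=> Xsu; rewrite /half_symp expr1 scaleN1r memvZ // mem_sp_perp_symp sympD
  sympN sympK opprD opprK.
rewrite [symp X - X]addrC eqxx andbT memvB //; move: Xsu;
  rewrite !mem_su => /andP[/eqP h /eqP t].
by rewrite -symp_conjtr h sympN eqxx tr_symp t oppr0 eqxx.
Qed.

Lemma half_symp_split X : X = half_symp false X + half_symp true X.
Proof.
rewrite /half_symp expr0 expr1 scale1r scaleN1r -scalerDr addrACA subrr addr0.
by rewrite scale_half.
Qed.

Lemma su_split : (sp R m + sp_perp R m = su R N)%VS.
Proof.
apply/eqP; rewrite eqEsubv; apply/andP; split; apply/subvP => X.
  by case/memv_addP => A Asp [B Bp ->]; apply: memvD;
    [apply: sp_su|apply: sp_perp_su].
by move=> Xsu; have := memv_add (half_symp_sp Xsu) (half_symp_perp Xsu);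
  rewrite -half_symp_split.
Qed.

Lemma vtrace_su_split f : linear f -> {in sp R m, forall X, f X \in sp R m} ->
  {in sp_perp R m, forall X, f X \in sp_perp R m} ->
  vtrace (su R N) f = vtrace (sp R m) f + vtrace (sp_perp R m) f.
Proof.
move=> fL fk fq.
have fD X Y : f (X + Y) = f X + f Y by rewrite -[X]scale1r fL !scale1r.
rewrite (@vtrace_decomp _ _ _ _ bool (fun b => if b then sp R m else sp_perp R
  m)
   (fun b X => if b then pr_sp R m X else pr_sp_perp R m X) (fun b X => X)).
- rewrite big_bool /=; congr (_ + _); apply: eq_vtrace => X hX.
    by rewrite /pr_sp daddv_pi_id ?sp_cap_perp ?fk.
  by rewrite /pr_sp_perp daddv_pi_id 1?capvC ?sp_cap_perp ?fq.
- by case=> a X Y _ _; rewrite linearP.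
- by case=> a X Y.
- by case=> X _; apply: memv_pi.
- by case=> X; [apply: sp_su|apply: sp_perp_su].
- move=> X Xsu; rewrite big_bool /= /pr_sp /pr_sp_perp daddv_pi_add ?sp_cap_perp
  //.
  by rewrite su_split.
- exact: lin_on_linear.
- move=> X; rewrite -su_split => /memv_addP[A Ak [C Cq ->]].
  by rewrite fD memv_add ?fk ?fq.
Qed.

Hypothesis m0 : (0 < m)%N.
Let N0 : (0 < N)%N. Proof. by rewrite addn_gt0 m0. Qed.

Lemma vtrace_perp_lie X : X \in sp R m -> vtrace (sp_perp R m) (lie X) = 0.
Proof.
move=> Xsp; have := vtrace_su_split (lie_linear_r X) _ _.
rewrite vtrace_su_lie ?sp_su // vtrace_sp_lie // add0r => -> // Y Ys.
  exact: lie_sp.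
exact: lie_sp_perp.
Qed.

Lemma vtrace_perp_ad2 X Y : X \in sp R m -> Y \in sp R m ->
  vtrace (sp_perp R m) (ad2 X Y) = (2 * m)%:R * retr X Y - 2 * retr X Y.
Proof.
move=> Xsp Ysp; have := vtrace_su_split (ad2_linear X Y) _ _.
rewrite vtrace_su_ad2 ?sp_su // vtrace_sp_ad2 // => h.
apply: (addrI ((2 * m.+1)%:R * retr X Y)); rewrite -h.
- by rewrite !natrM -[m.+1]addn1 !natrD; ring.
- by move=> Z Zs; rewrite /ad2 !lie_sp.
- by move=> Z Zs; rewrite /ad2 !lie_sp_perp.
Qed.

Lemma lie_jacobi X Y Z : lie (lie X Y) Z = ad2 X Y Z - ad2 Y X Z.
Proof.
rewrite !ad2E /lie !mulmxBl !mulmxBr !mulmx1 !mul1mx !mulmxA.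
by apply/matrixP => i j; rewrite !(addmxE, oppmxE); ring.
Qed.

(** For X, Y in q, ad X and ad Y exchange k and q.  So the traces of ad X ad Y
    on k and of ad Y ad X on q agree by cyclicity; the latter is also the trace
    of ad X ad Y on q, since ad [X, Y] has trace 0 there.  Each is thus half of
    the trace on su(2m). *)
Lemma vtrace_ad2_perp_perp X Y : X \in sp_perp R m -> Y \in sp_perp R m ->
  vtrace (sp R m) (ad2 X Y) = (2 * m)%:R * retr X Y /\
  vtrace (sp_perp R m) (ad2 X Y) = (2 * m)%:R * retr X Y.
Proof.
move=> Xq Yq; have := vtrace_su_split (ad2_linear X Y) _ _.
rewrite vtrace_su_ad2 ?sp_perp_su // => h.
have hs : vtrace (sp R m) (ad2 X Y) = vtrace (sp_perp R m) (ad2 X Y).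
  transitivity (vtrace (sp_perp R m) (ad2 Y X)).
    apply: (vtrace_cycle (f := lie Y) (g := lie X)).
    - by apply: lin_on_linear; apply: lie_linear_r.
    - by apply: lin_on_linear; apply: lie_linear_r.
    - by move=> Z Zk; rewrite lie_perp_sp.
    - by move=> Z Zq; rewrite lie_perp_perp.
  apply/eqP; rewrite -subr_eq0 -vtraceB.
  rewrite (eq_vtrace (g := lie (lie Y X))) ?vtrace_perp_lie ?lie_perp_perp //.
  by move=> Z _; rewrite lie_jacobi.
rewrite hs -mulr2n in h; have {}h := h _ _.
suff e : vtrace (sp_perp R m) (ad2 X Y) = (2 * m)%:R * retr X Y by rewrite hs e.
apply: (@mulIf _ 2%:R); rewrite ?pnatr_eq0 // mulr_natr -h.
- by rewrite !natrM natrD; ring.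
- by move=> Z Zk; rewrite /ad2 lie_perp_perp ?lie_perp_sp.
- by move=> Z Zq; rewrite /ad2 lie_perp_sp ?lie_perp_perp.
Qed.

Lemma retr_symp X Y : retr (symp X) (symp Y) = retr X Y.
Proof.
have trN (A : 'M[R[i]]_N) : \tr (- A) = - \tr A by rewrite raddfN.
rewrite /retr /symp !mulmxA -[_ *m J *m J]mulmxA JJ mulmxN mulmx1 !mulNmx trN.
rewrite mxtrace_mulC !mulmxA JJ !mulNmx mul1mx trN opprK.
by rewrite -trmx_mul mxtrace_tr mxtrace_mulC.
Qed.

Lemma retr_sp_perp X Y : X \in sp R m -> Y \in sp_perp R m -> retr X Y = 0.
Proof.
rewrite mem_sp_symp mem_sp_perp_symp => /andP[_ /eqP sX] /andP[_ /eqP sY].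
have := retr_symp X Y; rewrite sX sY retrC -scaleN1r -[-1 *: Y]addr0
  retr_linear.
have -> : retr 0 X = 0 by rewrite /retr mul0mx raddf0.
by rewrite addr0 retrC; lra.
Qed.

Lemma Qform_su X Y : X \in su R N -> Y \in su R N ->
  Qform X Y = - (4 * m)%:R * retr X Y.
Proof.
move=> Xsu Ysu; rewrite /Qform /killing -/(ad2 X Y) vtrace_su_ad2 //.
by rewrite !natrM natrD; ring.
Qed.

Lemma sp_neq0 : exists2 X, X \in sp R m & X != 0.
Proof.
pose D : 'M[R[i]]_m := 'i%C%:M.
exists (block_mx D 0 0 (- D) : cmx R N).
  rewrite mem_sp mem_su; apply/andP; split; first (apply/andP; split).
  - rewrite /conjtr map_block_mx !map_mx0 map_mxN tr_block_mx !trmx0 [(-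
    _)^T]linearN /=.
    have D_conj : (map_mx conjc D)^T = - D.
      rewrite map_scalar_mx tr_scalar_mx /D -raddfN /=; congr (_%:M).
      by apply/eqP; rewrite eq_complex /= oppr0 !eqxx.
    rewrite D_conj opprK.
    by apply/eqP; rewrite -[RHS]/(- (block_mx D 0 0 (- D) : 'M_N)) opp_block_mx
      !oppr0 opprK.
  - by rewrite mxtrace_block raddfN /= subrr.
  - have DT : D^T = D by rewrite tr_scalar_mx.
    have NDT : (- D)^T = - D by rewrite linearN /= DT.
    rewrite tr_block_mx DT NDT !trmx0 /Jmx !mulmx_block.
    rewrite !(mul0mx, mulmx0, mulmx1, mul1mx, mulNmx, mulmxN, add0r, addr0,
      opprK, oppr0).
    by rewrite opp_block_mx !(oppr0, opprK).
apply/eqP => /matrixP/(_ (lshift m (Ordinal m0)) (lshift m (Ordinal m0))).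
rewrite block_mxEul !mxE eqxx mulr1n => /eqP;
  rewrite eq_complex /= oner_eq0 andbF //.
Qed.

(** If q were 0, then ad X ad X would have trace 0 on it for every X in k; that
    trace is (2m - 2) Re tr (X X). *)
Lemma sp_perp_neq0 : (1 < m)%N -> exists2 X, X \in sp_perp R m & X != 0.
Proof.
move=> m1; have [X Xsp X0] := sp_neq0.
have := retr_su_lt0 (sp_su Xsp) X0; have := vtrace_perp_ad2 Xsp Xsp => h rlt.
exists (vpick (sp_perp R m)); first exact: memv_pick.
rewrite vpick0; apply/negP => /eqP q0; move: h; rewrite q0 vtrace0.
move/esym/eqP; rewrite -mulrBl mulf_eq0 (lt_eqF rlt) orbF subr_eq0 -[2]/(2%:R)
  eqr_nat.
by rewrite -[X in _ == X]muln1 eqn_pmul2l // => /eqP m1'; rewrite m1' in m1.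
Qed.

End Sp.

(** * The tangent space of SU(2m)^4 / Sp(m) *)

Lemma daddv_piE (R : fieldType) (V : vectType R) (U W : {vspace V}) u w :
  (U :&: W = 0)%VS -> u \in U -> w \in W -> daddv_pi U W (u + w) = u.
Proof.
move=> UW0 uU wW; rewrite linearD /= daddv_pi_id //; apply/eqP.
have := daddv_pi_add UW0 (subvP (addvSr U W) w wW).
rewrite (daddv_pi_id _ wW) 1?capvC // => /eqP;
  rewrite -subr_eq0 addrK => /eqP ->.
by rewrite addr0.
Qed.

Section Uvec.
Variable R : realType.
Local Notation u a i := (uvec R a 0 i).

Let s : R := (Num.sqrt 2)^-1.
Let ss : s * s = 2^-1.
Proof. by rewrite -invfM -expr2 sqr_sqrtr. Qed.

Lemma uvec_sum a : \sum_i u a i = 0.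
Proof. by case_ord3 a; rewrite !big_ord_recl big_ord0 !mxE /= -/s; lra. Qed.

Lemma uvec_ortho a b : \sum_i u a i * u b i = (a == b)%:R.
Proof.
by case_ord3 a; case_ord3 b; rewrite !big_ord_recl big_ord0 !mxE /= -/s;
  move: ss; lra.
Qed.

(** Together with the unit vector (1,1,1,1) / 2, the u_a are an orthonormal
    basis of R^4, and its rows are orthonormal too. *)
Lemma uvec_complete i j : \sum_a u a i * u a j + 4^-1 = (i == j)%:R.
Proof.
by case_ord4 i; case_ord4 j; rewrite !big_ord_recl big_ord0 !mxE /= -/s;
  move: ss; lra.
Qed.

(** The structure constants of the brackets
    [u_b (x) X, u_d (x) Y] = sum_a uvec_triple a b d u_a (x) [X, Y] modulo the
    diagonal. *)
Definition uvec_triple (a b d : 'I_3) : R := \sum_i u a i * u b i * u d i.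

Lemma uvec_tripleE a b d : uvec_triple a b d =
  match val a, val b, val d with
  | 0%N, 0%N, 2%N | 0%N, 2%N, 0%N | 2%N, 0%N, 0%N => 2^-1
  | 1%N, 1%N, 2%N | 1%N, 2%N, 1%N | 2%N, 1%N, 1%N => - 2^-1
  | _, _, _ => 0
  end.
Proof.
rewrite /uvec_triple !big_ord_recl big_ord0 !mxE /=.
by case_ord3 a; case_ord3 b; case_ord3 d => /=; rewrite -?/s; move: ss; lra.
Qed.

End Uvec.

(** The components of an element of su(2m)^4 along q_i and along u_a (x) k.
    They are locked: unfolding them makes the comparison of two vectors run into
    matrix entries. *)
HB.lock Definition qcomp (R : realType) (m : nat) (i : 'I_4)
    (y : {ffun 'I_4 -> cmx R (m + m)}) : cmx R (m + m) := pr_sp_perp R m (y i).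
HB.lock Definition kcomp (R : realType) (m : nat) (a : 'I_3)
    (y : {ffun 'I_4 -> cmx R (m + m)}) : cmx R (m + m) := ucomp a y.

Section Tangent.
Variables (R : realType) (m : nat).
Local Notation N := (m + m)%N.
Local Notation mat := (cmx R N).
Local Notation T := {ffun 'I_4 -> cmx R N}.
Local Notation u a i := (uvec R a 0 i).
Local Notation sp := (sp R m).
Local Notation perp := (sp_perp R m).
Local Notation kk := (diag_sp R m).
Local Notation mm := (tangent R m).
Implicit Types (x y z : T) (xi eta : 'I_4 -> mat) (X Y : 'I_3 -> mat).

(** The k-part in the i-th factor of the sum of the u_a (x) X a. *)
Definition kpart X i : mat := \sum_a u a i *: X a.
Definition tvec xi X : T := [ffun i => xi i + kpart X i].

Lemma pr_sp_add (C A : mat) : C \in perp -> A \in sp -> pr_sp R m (C + A) = A.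
Proof. by move=> hC hA; rewrite addrC /pr_sp daddv_piE // sp_cap_perp. Qed.

Lemma pr_perp_add (C A : mat) : C \in perp -> A \in sp -> pr_sp_perp R m (C + A)
  = C.
Proof. by move=> hC hA; rewrite /pr_sp_perp daddv_piE // capvC sp_cap_perp. Qed.

Lemma pr_sp_sp (C : mat) : pr_sp R m C \in sp. Proof. exact: memv_pi. Qed.
Lemma pr_perp_perp (C : mat) : pr_sp_perp R m C \in perp. Proof. exact: memv_pi.
  Qed.
Lemma qcomp_perp i y : qcomp i y \in perp. Proof. by rewrite qcomp.unlock;
  apply: pr_perp_perp. Qed.

Lemma pr_addK (C : mat) : C \in su R N -> pr_sp_perp R m C + pr_sp R m C = C.
Proof. by rewrite -su_split addvC => h; rewrite daddv_pi_add // capvC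
  sp_cap_perp. Qed.

Lemma kcomp_sp a y : kcomp a y \in sp.
Proof. by rewrite kcomp.unlock; apply: rpred_sum => i _;
  rewrite memvZ ?pr_sp_sp. Qed.

Lemma kpart_sp X i : (forall a, X a \in sp) -> kpart X i \in sp.
Proof. by move=> h; apply: rpred_sum => a _; rewrite memvZ. Qed.

Lemma sum_delta (I : finType) (X : I -> mat) a : \sum_b (a == b)%:R *: X b =
  X a.
Proof.
rewrite (bigD1 a) //= eqxx scale1r big1 ?addr0 // => b /negPf ba.
by rewrite eq_sym ba scale0r.
Qed.

Lemma kpart_ortho X a : \sum_i u a i *: kpart X i = X a.
Proof.
rewrite -[RHS](sum_delta X); under eq_bigr do rewrite scaler_sumr.
rewrite exchange_big; apply: eq_bigr => b _; rewrite -uvec_ortho scaler_suml.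
by apply: eq_bigr => i _; rewrite scalerA.
Qed.

Lemma qcomp_tvec xi X i : (forall i, xi i \in perp) -> (forall a, X a \in sp) ->
  qcomp i (tvec xi X) = xi i.
Proof. by move=> hxi hX; rewrite qcomp.unlock ffunE pr_perp_add ?kpart_sp. Qed.

Lemma kcomp_tvec xi X a : (forall i, xi i \in perp) -> (forall a, X a \in sp) ->
  kcomp a (tvec xi X) = X a.
Proof.
move=> hxi hX; rewrite -[RHS]kpart_ortho kcomp.unlock; apply: eq_bigr => i _.
by rewrite ffunE pr_sp_add ?kpart_sp.
Qed.

Lemma mem_tens (t : 'rV[R]_4) (U : {vspace mat}) (C : mat) : C \in U ->
  tens t C \in tens_space t U.
Proof. by move=> h; rewrite -tensE memv_img. Qed.

Lemma tens_spaceP (t : 'rV[R]_4) (U : {vspace mat}) y :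
  reflect (exists2 C, C \in U & y = tens t C) (y \in tens_space t U).
Proof.
apply: (iffP memv_imgP) => -[C CU ->]; exists C => //; by rewrite tensE.
Qed.

Lemma tvecE xi X : tvec xi X =
  \sum_i tens (delta_mx 0 i) (xi i) + \sum_a tens (uvec R a) (X a).
Proof.
apply/ffunP => i; rewrite !ffunE !sum_ffunE; congr (_ + _).
  rewrite (bigD1 i) //= ffunE mxE !eqxx scale1r big1 ?addr0 // => j ji.
  by rewrite ffunE mxE eq_sym (negPf ji) andbF scale0r.
by apply: eq_bigr => a _; rewrite ffunE.
Qed.

Lemma tvec_tangent xi X : (forall i, xi i \in perp) -> (forall a,
  X a \in sp) -> tvec xi X \in mm.
Proof.
move=> hxi hX; rewrite tvecE memv_add //; apply: memv_sumr => i _;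
  exact: mem_tens.
Qed.

Lemma tangent_tvec y : y \in mm -> y = tvec (fun i => qcomp i y) (fun a
  => kcomp a y).
Proof.
case/memv_addP => y1 /memv_sumP[v1 hv1 ->] [y2 /memv_sumP[v2 hv2 ->] ->].
have h1 i : exists C, C \in perp /\ v1 i = tens (delta_mx 0 i) C.
  by have /tens_spaceP[C] := hv1 i isT; exists C.
have h2 a : exists C, C \in sp /\ v2 a = tens (uvec R a) C.
  by have /tens_spaceP[C] := hv2 a isT; exists C.
have [xi hxi] := fin_all_exists h1; have [X hX] := fin_all_exists h2.
have -> : \sum_i v1 i + \sum_a v2 a = tvec xi X.
  rewrite tvecE; congr (_ + _); apply: eq_bigr => i _; first by case: (hxi i).
  by case: (hX i).
have q1 i : xi i \in perp by case: (hxi i).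
have k1 a : X a \in sp by case: (hX a).
apply/ffunP => i; rewrite [in RHS]ffunE qcomp_tvec // ffunE; congr (_ + _).
by apply: eq_bigr => a _; rewrite kcomp_tvec.
Qed.

Definition const4 (C : mat) : T := [ffun=> C].

Lemma diag_spP y : reflect (exists2 C, C \in sp & y = const4 C) (y \in kk).
Proof.
have e C : tens (const_mx 1) C = const4 C by apply/ffunP => i;
  rewrite !ffunE mxE scale1r.
by apply: (iffP (tens_spaceP _ _ _)) => -[C hC ->]; exists C; rewrite ?e.
Qed.

Definition diag_comp y : mat := 4^-1 *: \sum_i pr_sp R m (y i).

Lemma diag_comp_sp y : diag_comp y \in sp.
Proof. by rewrite memvZ //; apply: rpred_sum => i _; apply: pr_sp_sp. Qed.

(** Reading the decomposition in the i-th factor amounts to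
    [uvec_complete]. *)
Lemma su4_dec y : (forall i, y i \in su R N) -> y = const4 (diag_comp y)
  + tvec (fun i => qcomp i y) (fun a => kcomp a y).
Proof.
move=> hy; apply/ffunP => i; rewrite !ffunE -[LHS](pr_addK (hy i)) addrCA
  qcomp.unlock; congr (_ + _).
rewrite -[LHS](sum_delta (fun j => pr_sp R m (y j))) /diag_comp /kpart
  kcomp.unlock /ucomp scaler_sumr.
under [X in _ = _ + X]eq_bigr do rewrite scaler_sumr.
rewrite exchange_big -big_split /=; apply: eq_bigr => j _.
rewrite -uvec_complete addrC scalerDl scaler_suml; congr (_ + _).
by apply: eq_bigr => a _; rewrite scalerA.
Qed.

Lemma diag_cap_tangent : (kk :&: mm = 0)%VS.
Proof.
apply/eqP; rewrite -subv0; apply/subvP => y; rewrite memv_cap memv0 => /andP[].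
case/diag_spP => C hC -> /tangent_tvec e; rewrite e; apply/eqP.
have q0 i : qcomp i (const4 C) = 0.
  by rewrite qcomp.unlock ffunE -[C]add0r pr_perp_add ?mem0v.
have k0 a : kcomp a (const4 C) = 0.
  rewrite kcomp.unlock /ucomp (eq_bigr (fun i => u a i *: C)) => [|i _].
    by rewrite -scaler_suml uvec_sum scale0r.
  by rewrite ffunE -{1}[C]add0r pr_sp_add ?mem0v.
apply/ffunP => i; rewrite !ffunE /= q0 add0r /kpart big1 // => a _.
by rewrite k0 scaler0.
Qed.

Lemma daddv_tangent y : (forall i, y i \in su R N) ->
  daddv_pi mm kk y = tvec (fun i => qcomp i y) (fun a
    => kcomp a y) /\ daddv_pi kk mm y = const4 (diag_comp y).
Proof.
move=> hy; have mT : tvec (fun i => qcomp i y) (fun a => kcomp a y) \in mm.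
  by apply: tvec_tangent => *; [apply: qcomp_perp|apply: kcomp_sp].
have kT : const4 (diag_comp y) \in kk by apply/diag_spP; exists (diag_comp y);
  rewrite ?diag_comp_sp.
split; last by rewrite {1}(su4_dec hy) daddv_piE // diag_cap_tangent.
by rewrite {1}(su4_dec hy) addrC daddv_piE // capvC diag_cap_tangent.
Qed.

Lemma tangent_su y i : y \in mm -> y i \in su R N.
Proof.
move=> /tangent_tvec ->; rewrite ffunE; apply: memvD.
  exact/sp_perp_su/qcomp_perp.
by apply/sp_su/kpart_sp => a; apply: kcomp_sp.
Qed.

Lemma lie4_l y : linear ((@lie4 R N)^~ y).
Proof. by move=> a x z; apply/ffunP => i; rewrite !ffunE lie_linear_l. Qed.
Lemma lie4_r x : linear (@lie4 R N x).
Proof. by move=> a y z; apply/ffunP => i; rewrite !ffunE lie_linear_r. Qed.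
Lemma lie4C x y : lie4 x y = - lie4 y x.
Proof. by apply/ffunP => i; rewrite !ffunE lieC. Qed.

Lemma lie4_su x y i : x \in mm -> y \in mm -> lie4 x y i \in su R N.
Proof. by move=> hx hy; rewrite ffunE lie_su ?tangent_su. Qed.

Lemma lie_kpart (C : mat) X i : lie C (kpart X i) = kpart (fun a
  => lie C (X a)) i.
Proof.
apply: (lin_on_sum (fun a => u a i) (lin_on_linear (U := fullv) (lie_linear_r
  C))) => a.
exact: memvf.
Qed.

Lemma lie4_const C xi X : lie4 (const4 C) (tvec xi X) = tvec (fun i
  => lie C (xi i)) (fun a => lie C (X a)).
Proof.
apply/ffunP => i; rewrite !ffunE -lie_kpart -[lie C (xi i)]scale1r
  -lie_linear_r.
by rewrite scale1r.
Qed.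

Lemma reductive_tangent : reductive (@lie4 R N) kk mm.
Proof.
split.
- exact: diag_cap_tangent.
- move=> _ _ /diag_spP[C hC ->] /diag_spP[D hD ->]; apply/diag_spP;
  exists (lie C D).
    exact: lie_sp.
  by apply/ffunP => i; rewrite !ffunE.
- move=> _ y /diag_spP[C hC ->] /tangent_tvec ->; rewrite lie4_const.
  apply: tvec_tangent => *; first by rewrite lie_sp_perp ?qcomp_perp.
  by rewrite lie_sp ?kcomp_sp.
- move=> x y hx hy; rewrite (su4_dec (fun i => lie4_su i hx hy)) memv_add //.
    by apply/diag_spP; exists (diag_comp (lie4 x y)); rewrite ?diag_comp_sp.
  by apply: tvec_tangent => *; [apply: qcomp_perp|apply: kcomp_sp].
Qed.

End Tangent.

(** * Diagonal metrics on the tangent space *)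

Section LieLin.
Variables (R : realType) (n : nat).
Implicit Types C D : cmx R n.
Lemma lieDl C C' D : lie (C + C') D = lie C D + lie C' D.
Proof. by rewrite -[C]scale1r lie_linear_l !scale1r. Qed.
Lemma lieDr C D D' : lie C (D + D') = lie C D + lie C D'.
Proof. by rewrite -[D]scale1r lie_linear_r !scale1r. Qed.
Lemma lie0l D : lie 0 D = 0.
Proof. by rewrite /lie mul0mx mulmx0 subrr. Qed.
Lemma lie0r D : lie D 0 = 0.
Proof. by rewrite /lie mul0mx mulmx0 subrr. Qed.
Lemma lieZl a C D : lie (a *: C) D = a *: lie C D.
Proof. by rewrite -[a *: C]addr0 lie_linear_l lie0l addr0. Qed.
Lemma lieZr a C D : lie C (a *: D) = a *: lie C D.
Proof. by rewrite -[a *: D]addr0 lie_linear_r lie0r addr0. Qed.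
Lemma lie_suml (I : finType) (F : I -> cmx R n) D : lie (\sum_i F i) D =
  \sum_i lie (F i) D.
Proof. by apply: (big_morph (fun C => lie C D)) => [? ?|];
  rewrite ?lieDl ?lie0l. Qed.
Lemma lie_sumr (I : finType) (F : I -> cmx R n) D : lie D (\sum_i F i) =
  \sum_i lie D (F i).
Proof. by apply: (big_morph (lie D)) => [? ?|]; rewrite ?lieDr ?lie0r. Qed.
End LieLin.

(** The operator Lam of the metric with scales s on the q_i and c on the
    u_a (x) k. *)
HB.lock Definition lam (R : realType) (m : nat) (s : 'I_4 -> R) (c : 'I_3 -> R)
    (x : {ffun 'I_4 -> cmx R (m + m)}) : {ffun 'I_4 -> cmx R (m + m)} :=
  tvec (fun i => s i *: qcomp i x) (fun a => c a *: kcomp a x).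

Section Metric.
Variables (R : realType) (m : nat).
Hypothesis m0 : (0 < m)%N.
Local Notation N := (m + m)%N.
Local Notation mat := (cmx R N).
Local Notation T := {ffun 'I_4 -> cmx R N}.
Local Notation u a i := (uvec R a 0 i).
Local Notation sp := (sp R m).
Local Notation perp := (sp_perp R m).
Local Notation kk := (diag_sp R m).
Local Notation mm := (tangent R m).
Implicit Types (x y z : T) (xi eta : 'I_4 -> mat) (X Y : 'I_3 -> mat).

(** The Killing form of su(2m) up to sign, written as a multiple of the trace
    form: unlike [Qform] it is bilinear and invariant on all matrices. *)
Definition qf (C D : mat) : R := - (4 * m)%:R * retr C D.

Lemma qf_linear a C D E : qf (a *: C + D) E = a * qf C E + qf D E.
Proof. by rewrite /qf retr_linear; ring. Qed.
Lemma qfC C D : qf C D = qf D C. Proof. by rewrite /qf retrC. Qed.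
Lemma qf0 D : qf 0 D = 0.
Proof. by rewrite /qf /retr mul0mx raddf0 mulr0. Qed.
Lemma qfZl a C D : qf (a *: C) D = a * qf C D.
Proof. by rewrite -[a *: C]addr0 qf_linear qf0 addr0. Qed.
Lemma qfDl C C' D : qf (C + C') D = qf C D + qf C' D.
Proof. by rewrite -[C]scale1r qf_linear !scale1r mul1r. Qed.
Lemma qf_inv C D E : qf (lie C D) E = qf C (lie D E).
Proof. by rewrite /qf retr_inv. Qed.
Lemma qf_perp C D : C \in sp -> D \in perp -> qf C D = 0.
Proof. by move=> hC hD; rewrite /qf retr_sp_perp ?mulr0. Qed.
Lemma qf_gt0 C : C \in su R N -> C != 0 -> 0 < qf C C.
Proof.
move=> hC C0; rewrite /qf mulNr -mulrN mulr_gt0 ?oppr_gt0 ?retr_su_lt0 //.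
by rewrite ltr0n muln_gt0.
Qed.
Lemma QformE C D : C \in su R N -> D \in su R N -> Qform C D = qf C D.
Proof. exact: Qform_su. Qed.
Lemma qf_ge0 C : C \in su R N -> 0 <= qf C C.
Proof. by have [->|C0] := eqVneq C 0; rewrite ?qf0 // => h; apply/ltW/qf_gt0.
  Qed.
Lemma qf_suml (I : finType) (F : I -> mat) D : qf (\sum_i F i) D =
  \sum_i qf (F i) D.
Proof. by apply: (big_morph (fun C => qf C D)) => [? ?|]; rewrite ?qfDl ?qf0.
  Qed.

Definition form4 x y : R := \sum_i qf (x i) (y i).

Lemma form4_linear a x y z : form4 (a *: x + y) z = a * form4 x z + form4 y z.
Proof.
rewrite /form4 mulr_sumr -big_split /=; apply: eq_bigr => i _.
by rewrite !ffunE qf_linear.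
Qed.
Lemma form4C x y : form4 x y = form4 y x.
Proof. by apply: eq_bigr => i _; rewrite qfC. Qed.
Lemma form4_inv x y z : form4 (lie4 x y) z = form4 x (lie4 y z).
Proof. by apply: eq_bigr => i _; rewrite !ffunE qf_inv. Qed.

Lemma form4_tvec xi X eta Y : (forall i, xi i \in perp) -> (forall a,
  X a \in sp) ->
  (forall i, eta i \in perp) -> (forall a, Y a \in sp) ->
  form4 (tvec xi X) (tvec eta Y) = \sum_i qf (xi i) (eta i)
    + \sum_a qf (X a) (Y a).
Proof.
move=> hxi hX heta hY; rewrite /form4.
have -> : \sum_a qf (X a) (Y a) = \sum_i qf (kpart X i) (kpart Y i).
  under [RHS]eq_bigr do rewrite qfC.
  under [RHS]eq_bigr do rewrite /kpart qf_suml.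
  rewrite exchange_big; apply: eq_bigr => a _.
  rewrite -{1}(kpart_ortho X a) qfC qfC qf_suml; apply: eq_bigr => i _.
  by rewrite qfZl qfZl [qf (Y a) _]qfC.
rewrite -big_split; apply: eq_bigr => i _; rewrite !ffunE /= qfDl.
rewrite [qf (xi i) _]qfC [qf (kpart X i) _]qfC !qfDl.
rewrite [qf (kpart Y i) (xi i)]qf_perp ?kpart_sp // [qf (eta i) (kpart X i)]qfC.
by rewrite [qf (kpart X i) (eta i)]qf_perp ?kpart_sp // addr0 add0r qfC [qf
  (kpart Y i) _]qfC.
Qed.

Lemma form4_diag_tangent x y : x \in kk -> y \in mm -> form4 x y = 0.
Proof.
case/diag_spP => C hC -> /tangent_tvec ->; rewrite /form4.
under eq_bigr do rewrite !ffunE qfC qfDl [qf (qcomp _ _) _]qfC qf_perp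
  ?qcomp_perp // add0r qfC.
under eq_bigr do rewrite qfC /kpart qf_suml.
rewrite exchange_big big1 // => a _; under eq_bigr do rewrite qfZl.
by rewrite -mulr_suml uvec_sum mul0r.
Qed.

Lemma tvec_linear (a : R) xi X eta Y :
  tvec (fun i => a *: xi i + eta i) (fun b => a *: X b + Y b) = a *: tvec xi X
    + tvec eta Y.
Proof.
apply/ffunP => i; rewrite !ffunE scalerDr addrACA; congr (_ + _).
rewrite /kpart scaler_sumr -big_split; apply: eq_bigr => b _ /=.
by rewrite scalerDr !scalerA mulrC.
Qed.

Lemma eq_tvec xi X eta Y : xi =1 eta -> X =1 Y -> tvec xi X = tvec eta Y.
Proof.
move=> h1 h2; apply/ffunP => i; rewrite !ffunE h1; congr (_ + _).
by apply: eq_bigr => a _; rewrite h2.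
Qed.

Lemma qcomp_linear i : linear (qcomp (R := R) (m := m) i).
Proof. by move=> a x y; rewrite qcomp.unlock !ffunE linearP. Qed.
Lemma kcomp_linear b : linear (kcomp (R := R) (m := m) b).
Proof.
move=> a x y; rewrite kcomp.unlock /ucomp scaler_sumr -big_split;
  apply: eq_bigr => i _ /=.
by rewrite !ffunE linearP /= scalerDr !scalerA mulrC.
Qed.

Lemma lam_linear s c : linear (lam (R := R) (m := m) s c).
Proof.
move=> a x y; rewrite lam.unlock -tvec_linear; apply: eq_tvec => i.
  by rewrite qcomp_linear scalerDr !scalerA mulrC.
by rewrite kcomp_linear scalerDr !scalerA mulrC.
Qed.

Lemma lam_tangent s c x : lam s c x \in mm.
Proof. by rewrite lam.unlock; apply: tvec_tangent => *;
  rewrite memvZ ?qcomp_perp ?kcomp_sp. Qed.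

Lemma qcomp_lam s c x i : qcomp i (lam s c x) = s i *: qcomp i x.
Proof. by rewrite lam.unlock qcomp_tvec // => j;
  rewrite memvZ ?qcomp_perp ?kcomp_sp. Qed.

Lemma kcomp_lam s c x a : kcomp a (lam s c x) = c a *: kcomp a x.
Proof. by rewrite lam.unlock kcomp_tvec // => j;
  rewrite memvZ ?qcomp_perp ?kcomp_sp. Qed.

Lemma lamK s c : (forall i, s i != 0) -> (forall a, c a != 0) ->
  {in mm, cancel (lam (fun i => (s i)^-1) (fun a => (c a)^-1)) (lam s c)}.
Proof.
move=> s0 c0 x xm; rewrite [RHS](tangent_tvec xm) {1}lam.unlock;
  apply: eq_tvec => i.
  by rewrite qcomp_lam scalerA mulfV ?scale1r.
by rewrite kcomp_lam scalerA mulfV ?scale1r.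
Qed.

Lemma form4_lam s c x y : y \in mm -> form4 (lam s c x) y =
  \sum_i s i * qf (qcomp i x) (qcomp i y) + \sum_a c a * qf (kcomp a x) (kcomp a
    y).
Proof.
move=> /tangent_tvec e; rewrite {1}e lam.unlock form4_tvec; last 1 first.
- by move=> a; apply: kcomp_sp.
- by congr (_ + _); apply: eq_bigr => i _; rewrite qfZl.
all: by move=> *; rewrite ?memvZ ?qcomp_perp ?kcomp_sp.
Qed.

Lemma lam_sym s c : {in mm &, forall x y, form4 (lam s c x) y =
  form4 x (lam s c y)}.
Proof.
move=> x y xm ym; rewrite [RHS]form4C (form4_lam s c x ym) (form4_lam s c y xm).
by apply: (congr2 +%R); apply: eq_bigr => i _; rewrite qfC.
Qed.

Lemma metricE (s c : seq R) x y : y \in mm ->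
  metric s c x y = form4 (lam (fun i => s`_i) (fun a => c`_a) x) y.
Proof.
move=> ym; rewrite form4_lam // /metric; congr (_ + _); apply: eq_bigr => i _.
  by rewrite qcomp.unlock QformE //; apply/sp_perp_su/pr_perp_perp.
have e z : ucomp i z = kcomp i z by rewrite kcomp.unlock.
by rewrite !e QformE //; apply/sp_su/kcomp_sp.
Qed.

End Metric.

(** * The Levi-Civita operator of a diagonal metric *)

Section Conn.
Variables (R : realType) (m : nat).
Local Notation N := (m + m)%N.
Local Notation mat := (cmx R N).
Local Notation T := {ffun 'I_4 -> cmx R N}.
Local Notation u a i := (uvec R a 0 i).
Local Notation sp := (sp R m).
Local Notation perp := (sp_perp R m).
Local Notation kk := (diag_sp R m).
Local Notation mm := (tangent R m).
Implicit Types (x y z : T) (xi eta : 'I_4 -> mat) (X Y : 'I_3 -> mat).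

Variables (s : 'I_4 -> R) (c : 'I_3 -> R).
Hypothesis s0 : forall i, s i != 0.
Hypothesis c0 : forall a, c a != 0.

Definition conn : T -> T -> T := lc_conn (@lie4 R N) kk mm (lam s c)
  (lam (fun i => (s i)^-1) (fun a => (c a)^-1)).
Local Notation L := conn.

Lemma qcomp_pm y i : (forall i, y i \in su R N) -> qcomp i (daddv_pi mm kk y) =
  qcomp i y.
Proof.
move=> hy; have [-> _] := daddv_tangent hy.
by rewrite qcomp_tvec // => *; rewrite ?qcomp_perp ?kcomp_sp.
Qed.

Lemma kcomp_pm y a : (forall i, y i \in su R N) -> kcomp a (daddv_pi mm kk y) =
  kcomp a y.
Proof.
move=> hy; have [-> _] := daddv_tangent hy.
by rewrite kcomp_tvec // => *; rewrite ?qcomp_perp ?kcomp_sp.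
Qed.

Lemma pr_lie (C A D B : mat) : C \in perp -> A \in sp -> D \in perp ->
  B \in sp ->
  pr_sp_perp R m (lie (C + A) (D + B)) = lie C B + lie A D /\
  pr_sp R m (lie (C + A) (D + B)) = lie C D + lie A B.
Proof.
move=> hC hA hD hB.
have -> : lie (C + A) (D + B) = (lie C B + lie A D) + (lie C D + lie A B).
  by rewrite lieDl !lieDr [lie C D + _]addrC addrACA.
have hp : lie C B + lie A D \in perp by apply: memvD;
  [apply: lie_perp_sp|apply: lie_sp_perp].
have hs : lie C D + lie A B \in sp by apply: memvD;
  [apply: lie_perp_perp|apply: lie_sp].
by split; [apply: pr_perp_add|apply: pr_sp_add].
Qed.

Let kpart_kcomp y i : kpart (fun b => kcomp b y) i \in sp.
Proof. by apply: kpart_sp => a; apply: kcomp_sp. Qed.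

Lemma qcomp_lie4 x y i : x \in mm -> y \in mm ->
  qcomp i (lie4 x y) = lie (qcomp i x) (kpart (fun b => kcomp b y) i)
    + lie (kpart (fun b => kcomp b x) i) (qcomp i y).
Proof.
move=> xm ym; rewrite {1}qcomp.unlock ffunE {1}(tangent_tvec xm)
  {1}(tangent_tvec ym) !ffunE.
by have [-> _] := pr_lie (qcomp_perp i x) (kpart_kcomp x i) (qcomp_perp i y)
  (kpart_kcomp y i).
Qed.

Lemma kcomp_lie4 x y a : x \in mm -> y \in mm ->
  kcomp a (lie4 x y) = \sum_i u a i *: (lie (qcomp i x) (qcomp i y)
                     + lie (kpart (fun b => kcomp b x) i) (kpart (fun b
                       => kcomp b y) i)).
Proof.
move=> xm ym; rewrite {1}kcomp.unlock; apply: eq_bigr => i _; congr (_ *: _).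
rewrite ffunE {1}(tangent_tvec xm) {1}(tangent_tvec ym) !ffunE.
by have [_ ->] := pr_lie (qcomp_perp i x) (kpart_kcomp x i) (qcomp_perp i y)
  (kpart_kcomp y i).
Qed.

Lemma lie_kpart_kpart X Y a : \sum_i u a i *: lie (kpart X i) (kpart Y i) =
  \sum_b \sum_d uvec_triple R a b d *: lie (X b) (Y d).
Proof.
transitivity (\sum_i \sum_b \sum_d (u a i * u b i * u d i) *: lie (X b) (Y d)).
  apply: eq_bigr => i _; rewrite lie_suml scaler_sumr; apply: eq_bigr => b _.
  rewrite lie_sumr scaler_sumr; apply: eq_bigr => d _.
  by rewrite lieZl lieZr !scalerA mulrA.
rewrite exchange_big; apply: eq_bigr => b _; rewrite exchange_big;
  apply: eq_bigr => d _.
by rewrite scaler_suml.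
Qed.

(** The (a, b) block of Z |-> L Z y, on u_b (x) k with values in u_a (x) k, is
    C |-> [C, theta a b y]. *)
Definition theta (a b : 'I_3) y : mat :=
  \sum_d (2^-1 * uvec_triple R a b d * (1 + (c d - c b) / c a)) *: kcomp d y.

Lemma theta_sp a b y : theta a b y \in sp.
Proof. by apply: rpred_sum => d _; rewrite memvZ ?kcomp_sp. Qed.

(** The scales at work in the q_i component of the Levi-Civita operator: t is
    the scale of q_i and S, W come from the scales of the u_a (x) k. *)
Let koszul_mix (V : lmodType R) (t : R) (P Q S W : V) : t != 0 ->
  2^-1 *: (P + Q + t^-1 *: (S + t *: Q - (t *: P + W))) = (Q - (2 * t)^-1 *: W)
    + (2 * t)^-1 *: S.
Proof.
move=> t0.
rewrite opprD [- (t *: P) - W]addrC addrACA -scalerBr [t^-1 *: (_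
  + _)]scalerDr [t^-1 *: (t *: _)]scalerA.
rewrite mulVf // scale1r [P + Q + _]addrC -[_ + (Q - P) + _]addrA [Q - P
  + _]addrA subrK scalerDr scalerA -invfM.
rewrite scale_half scalerBr addrC.
by rewrite [_ - (2 * t)^-1 *: W]addrC addrA.
Qed.

Let koszul_cancel (V : lmodType R) (t : R) (A1 A2 A3 G1 G2 K1 K2 K3 : V) :
  A1 = G1 + K1 -> A2 = G2 + K2 -> A3 = G2 + K3 ->
  A1 + t *: (A2 - A3) = G1 + (K1 + t *: (K2 - K3)).
Proof. by move=> -> -> ->; rewrite opprD addrACA subrr add0r addrA. Qed.

Let koszul_sum (V : lmodType R) (I : finType) (t t' : R) (F G H : I -> V) :
  t *: (\sum_i F i + t' *: (\sum_i G i - \sum_i H i)) =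
  \sum_i t *: (F i + t' *: (G i - H i)).
Proof. by rewrite -scaler_sumr big_split -scaler_sumr sumrB. Qed.

Let subE x y i : (x - y) i = x i - y i.
Proof. by rewrite !ffunE. Qed.

Lemma qcomp_conn x y i : x \in mm -> y \in mm ->
  qcomp i (L x y) = \sum_b (u b i * (1 - c b / (2 * s i))) *: lie (kcomp b x)
    (qcomp i y)
    + (2 * s i)^-1 *: lie (qcomp i x) (kpart (fun a => c a *: kcomp a y) i).
Proof.
move=> xm ym; rewrite /L /lc_conn.
have lx := lam_tangent s c x; have ly := lam_tangent s c y.
have su1 j : lie4 x y j \in su R N by apply: lie4_su.
have su2 j : (lie4 x (lam s c y) - lie4 (lam s c x) y) j \in su R N.
  by rewrite subE; apply: rpredB; apply: lie4_su.
have qcompD v w : qcomp i (v + w) = qcomp i v + qcomp i w.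
  by rewrite -[v]scale1r qcomp_linear !scale1r.
have qcompZ a v : qcomp i (a *: v) = a *: qcomp i v.
  by rewrite -[a *: v]addr0 qcomp_linear qcomp.unlock ffunE linear0 addr0.
have qcompN v : qcomp i (- v) = - qcomp i v by rewrite -scaleN1r qcompZ
  scaleN1r.
have kl (v : T) : kpart (fun b => kcomp b (lam s c v)) i = kpart (fun a
  => c a *: kcomp a v) i.
  by apply: eq_bigr => a _; rewrite kcomp_lam.
have e1 : qcomp i (lie4 x (lam s c y)) =
    lie (qcomp i x) (kpart (fun a => c a *: kcomp a y) i)
      + s i *: lie (kpart (fun b => kcomp b x) i) (qcomp i y).
  apply: (etrans (qcomp_lie4 i xm ly)); apply: (congr2 +%R (congr1 (lie _) (kl
    y))).
  by rewrite (qcomp_lam s c y) lieZr.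
have e2 : qcomp i (lie4 (lam s c x) y) =
    s i *: lie (qcomp i x) (kpart (fun b => kcomp b y) i) + lie (kpart (fun a
      => c a *: kcomp a x) i) (qcomp i y).
  apply: (etrans (qcomp_lie4 i lx ym)).
  apply: (congr2 +%R _ (congr1 (fun C => lie C (qcomp i y)) (kl x))).
  by rewrite (qcomp_lam s c x) lieZl.
have e0 := qcomp_lie4 i xm ym.
transitivity (2^-1 *: (qcomp i (lie4 x y) + (s i)^-1 *:
    (qcomp i (lie4 x (lam s c y)) - qcomp i (lie4 (lam s c x) y)))).
  by rewrite qcompZ qcompD qcomp_pm // qcomp_lam qcomp_pm // qcompD qcompN.
rewrite e1 e2 e0 (koszul_mix _ _ _ _ (s0 i)).
apply: (congr2 +%R _ erefl).
have -> : \sum_b (u b i * (1 - c b / (2 * s i))) *: lie (kcomp b x) (qcomp i y)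
    = \sum_b (u b i *: lie (kcomp b x) (qcomp i y) - ((2 * s i)^-1 * (u b i * c
      b)) *: lie (kcomp b x) (qcomp i y)).
  by apply: eq_bigr => b _; rewrite -scalerBl; congr (_ *: _); ring.
rewrite sumrB /kpart lie_suml; congr (_ - _).
  by apply: eq_bigr => b _; rewrite lieZl.
rewrite lie_suml scaler_sumr; apply: eq_bigr => b _.
by rewrite !lieZl !scalerA.
Qed.

Lemma kcomp_conn x y a : x \in mm -> y \in mm ->
  kcomp a (L x y) = \sum_i (u a i / 2) *: lie (qcomp i x) (qcomp i y)
    + \sum_b lie (kcomp b x) (theta a b y).
Proof.
move=> xm ym; rewrite /L /lc_conn.
have lx := lam_tangent s c x; have ly := lam_tangent s c y.
have su1 j : lie4 x y j \in su R N by apply: lie4_su.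
have su2 j : (lie4 x (lam s c y) - lie4 (lam s c x) y) j \in su R N.
  by rewrite subE; apply: rpredB; apply: lie4_su.
have kcompD v w : kcomp a (v + w) = kcomp a v + kcomp a w.
  by rewrite -[v]scale1r kcomp_linear !scale1r.
have kcompZ t v : kcomp a (t *: v) = t *: kcomp a v.
  by apply: (addIr (kcomp a 0)); rewrite -kcompD -kcomp_linear.
have kcompN v : kcomp a (- v) = - kcomp a v by rewrite -scaleN1r kcompZ
  scaleN1r.
pose G (F F' : 'I_4 -> mat) := \sum_i u a i *: lie (F i) (F' i).
have kcomp_lie v w : v \in mm -> w \in mm -> kcomp a (lie4 v w) = G (fun i
  => qcomp i v) (fun i => qcomp i w)
    + \sum_b \sum_d uvec_triple R a b d *: lie (kcomp b v) (kcomp d w).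
  move=> vm wm; apply: (etrans (kcomp_lie4 a vm wm));
    rewrite -lie_kpart_kpart -big_split.
  by apply: eq_bigr => i _; apply: scalerDr.
pose K v w : mat := \sum_b \sum_d uvec_triple R a b d *: lie (kcomp b v) (kcomp
  d w).
have GE : G (fun i => qcomp i x) (fun i => qcomp i (lam s c y)) = G (fun i
  => qcomp i (lam s c x)) (fun i => qcomp i y).
  by apply: eq_bigr => i _; rewrite (qcomp_lam s c y) (qcomp_lam s c x) lieZl
    lieZr.
transitivity (2^-1 *: (kcomp a (lie4 x y) + (c a)^-1 *:
    (kcomp a (lie4 x (lam s c y)) - kcomp a (lie4 (lam s c x) y)))).
  rewrite kcompZ kcompD (kcomp_pm a su1) kcomp_lam (kcomp_pm a su2).
  by rewrite kcompD kcompN.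
transitivity (2^-1 *: (G (fun i => qcomp i x) (fun i => qcomp i y) + (K x y +
    (c a)^-1 *: (K x (lam s c y) - K (lam s c x) y)))).
  congr (_ *: _); apply: koszul_cancel; [exact: kcomp_lie|exact:
    kcomp_lie|rewrite GE; exact: kcomp_lie].
rewrite scalerDr; apply: (congr2 +%R).
  by rewrite scaler_sumr; apply: eq_bigr => i _; rewrite scalerA mulrC.
rewrite koszul_sum; apply: eq_bigr => b _; rewrite koszul_sum /theta lie_sumr.
apply: eq_bigr => d _.
rewrite (kcomp_lam s c y) (kcomp_lam s c x) lieZl !lieZr !scalerA -scalerBl /=
  !scalerA -scalerDl scalerA.
by congr (_ *: _); field; apply: c0.
Qed.

Definition qvec (i : 'I_4) (C : mat) : T := tvec (fun j
  => (j == i)%:R *: C) (fun=> 0).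
Definition kvec (a : 'I_3) (C : mat) : T := tvec (fun=> 0) (fun b
  => (b == a)%:R *: C).

Lemma qvecE i C k : qvec i C k = (k == i)%:R *: C.
Proof. by rewrite ffunE /kpart big1 ?addr0 // => a _; rewrite scaler0. Qed.

Lemma kvecE a C k : kvec a C k = u a k *: C.
Proof.
rewrite ffunE add0r -[RHS](sum_delta (fun b => u b k *: C));
  apply: eq_bigr => b _.
by rewrite scalerA mulrC -scalerA eq_sym.
Qed.

Lemma vtrace_tangent f : linear f -> {in mm, forall x, f x \in mm} ->
  vtrace mm f = \sum_i vtrace perp (fun C => qcomp i (f (qvec i C)))
              + \sum_a vtrace sp (fun C => kcomp a (f (kvec a C))).
Proof.
move=> fL fm.
pose W (o : 'I_4 + 'I_3) := match o with inl _ => perp | inr _ => sp end.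
pose p (o : 'I_4 + 'I_3) x := match o with inl i => qcomp i x | inr a
  => kcomp a x end.
pose j (o : 'I_4 + 'I_3) C := match o with inl i => qvec i C | inr a
  => kvec a C end.
rewrite (@vtrace_decomp _ _ _ _ _ W p j) ?big_sumType //=.
- by case=> i; apply: lin_on_linear; [apply: qcomp_linear|apply: kcomp_linear].
- case=> i a C D _ _; rewrite /j -tvec_linear; apply: eq_tvec => k;
    by rewrite ?scaler0 ?addr0 // scalerDr !scalerA mulrC.
- by case=> i x _; [apply: qcomp_perp|apply: kcomp_sp].
- by case=> i C hC; apply: tvec_tangent => *; rewrite ?mem0v ?memvZ.
- move=> x /tangent_tvec e; rewrite big_sumType /= [LHS]e.
  apply/ffunP => k; rewrite !ffunE !sum_ffunE; apply: (congr2 +%R).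
    rewrite -[LHS](sum_delta (fun i => qcomp i x)); apply: eq_bigr => i _.
    by rewrite qvecE.
  by apply: eq_bigr => a _; rewrite kvecE.
- exact: lin_on_linear.
Qed.

Lemma qvec_tangent i C : C \in perp -> qvec i C \in mm.
Proof. by move=> hC; apply: tvec_tangent => *; rewrite ?mem0v ?memvZ. Qed.
Lemma kvec_tangent a C : C \in sp -> kvec a C \in mm.
Proof. by move=> hC; apply: tvec_tangent => *; rewrite ?mem0v ?memvZ. Qed.
Lemma qcomp_qvec i C j : C \in perp -> qcomp j (qvec i C) = (j == i)%:R *: C.
Proof. by move=> hC; rewrite qcomp_tvec // => *; rewrite ?mem0v ?memvZ. Qed.
Lemma kcomp_qvec i C a : C \in perp -> kcomp a (qvec i C) = 0.
Proof. by move=> hC; rewrite kcomp_tvec // => *; rewrite ?mem0v ?memvZ. Qed.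
Lemma qcomp_kvec a C j : C \in sp -> qcomp j (kvec a C) = 0.
Proof. by move=> hC; rewrite qcomp_tvec // => *; rewrite ?mem0v ?memvZ. Qed.
Lemma kcomp_kvec a C b : C \in sp -> kcomp b (kvec a C) = (b == a)%:R *: C.
Proof. by move=> hC; rewrite kcomp_tvec // => *; rewrite ?mem0v ?memvZ. Qed.

End Conn.

(** * The three traces in the Ricci tensor *)

Section Ricci.
Variables (R : realType) (m : nat).
Hypothesis m0 : (0 < m)%N.
Local Notation N := (m + m)%N.
Local Notation mat := (cmx R N).
Local Notation T := {ffun 'I_4 -> cmx R N}.
Local Notation u a i := (uvec R a 0 i).
Local Notation sp := (sp R m).
Local Notation perp := (sp_perp R m).
Local Notation kk := (diag_sp R m).
Local Notation mm := (tangent R m).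
Implicit Types (x y z : T) (xi eta : 'I_4 -> mat) (X Y : 'I_3 -> mat).

Variables (s : 'I_4 -> R) (c : 'I_3 -> R).
Hypothesis s0 : forall i, s i != 0.
Hypothesis c0 : forall a, c a != 0.

Local Notation L := (@conn R m s c).
Local Notation theta := (@theta R m c).
(** The k-part of Lam y in the i-th factor. *)
Definition kpart_c y i : mat := kpart (fun a => c a *: kcomp a y) i.

Lemma kpart_c_sp y i : kpart_c y i \in sp.
Proof. by apply: kpart_sp => a; rewrite memvZ ?kcomp_sp. Qed.

Lemma conn_mem x y : L x y \in mm.
Proof. by apply: lc_conn_mem => v _; apply: lam_tangent. Qed.

Lemma conn_linear_l y : linear (L^~ y).
Proof. by apply: lc_conn_linear_l; [apply: lie4_l|apply: lam_linear|apply: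
  lam_linear]. Qed.

Lemma lie_lieE (A B C : mat) : lie (lie C A) B = ad2 B A C.
Proof. by rewrite /ad2 lieC [lie C A]lieC -[- lie A C]scaleN1r lieZr scaleN1r
  opprK. Qed.

Lemma qcomp_conn_qvec i C x j : C \in perp -> x \in mm ->
  qcomp j (L (qvec i C) x) = (j == i)%:R *: ((2 * s i)^-1 *: lie C (kpart_c x
    i)).
Proof.
move=> hC xm; rewrite (qcomp_conn c s0 j (qvec_tangent i hC) xm) big1 => [|b _].
  rewrite add0r (qcomp_qvec i j hC); have [->|_] := eqVneq j i;
    first by rewrite !scale1r.
  by rewrite !scale0r lie0l scaler0.
by rewrite (kcomp_qvec i b hC) lie0l scaler0.
Qed.

Lemma kcomp_conn_qvec i C x a : C \in perp -> x \in mm ->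
  kcomp a (L (qvec i C) x) = (u a i / 2) *: lie C (qcomp i x).
Proof.
move=> hC xm; rewrite (kcomp_conn s c0 a (qvec_tangent i hC) xm) addrC big1
  => [|b _]; last first.
  by rewrite (kcomp_qvec i b hC) lie0l.
rewrite add0r (bigD1 i) //= big1 => [|j /negPf ji].
  by rewrite (qcomp_qvec i i hC) eqxx scale1r addr0.
by rewrite (qcomp_qvec i j hC) ji scale0r lie0l scaler0.
Qed.

Lemma qcomp_conn_kvec a C x j : C \in sp -> x \in mm ->
  qcomp j (L (kvec a C) x) = (u a j * (1 - c a / (2 * s j))) *: lie C (qcomp j
    x).
Proof.
move=> hC xm; rewrite (qcomp_conn c s0 j (kvec_tangent a hC) xm) (qcomp_kvec a j
  hC) lie0l scaler0 addr0.
rewrite (bigD1 a) //= big1 => [|b /negPf ba];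
  first by rewrite (kcomp_kvec a a hC) eqxx scale1r addr0.
by rewrite (kcomp_kvec a b hC) ba scale0r lie0l scaler0.
Qed.

Lemma kcomp_conn_kvec a C x b : C \in sp -> x \in mm ->
  kcomp b (L (kvec a C) x) = lie C (theta b a x).
Proof.
move=> hC xm; rewrite (kcomp_conn s c0 b (kvec_tangent a hC) xm) big1 => [|j _];
  last first.
  by rewrite (qcomp_kvec a j hC) lie0l scaler0.
rewrite add0r (bigD1 a) //= big1 => [|d /negPf da].
  by rewrite (kcomp_kvec a a hC) eqxx scale1r addr0.
by rewrite (kcomp_kvec a d hC) da scale0r lie0l.
Qed.

Lemma qcomp_conn2 i C x y : C \in perp -> x \in mm -> y \in mm ->
  qcomp i (L (L (qvec i C) x) y) =
    (\sum_b u b i ^+ 2 / 2 * (1 - c b / (2 * s i))) *: ad2 (qcomp i y) (qcomp i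
      x) C
    + (2 * s i) ^- 2 *: ad2 (kpart_c y i) (kpart_c x i) C.
Proof.
move=> hC xm ym; rewrite (qcomp_conn c s0 i (conn_mem _ _) ym) scaler_suml.
apply: (congr2 +%R).
  apply: eq_bigr => b _; rewrite (kcomp_conn_qvec i b hC xm) lieZl scalerA
    lie_lieE.
  by congr (_ *: _); ring.
rewrite (qcomp_conn_qvec i i hC xm) eqxx scale1r lieZl scalerA lie_lieE.
by congr (_ *: _); rewrite -expr2 exprVn.
Qed.

Lemma kcomp_conn2 a C x y : C \in sp -> x \in mm -> y \in mm ->
  kcomp a (L (L (kvec a C) x) y) =
    \sum_i (u a i ^+ 2 / 2 * (1 - c a / (2 * s i))) *: ad2 (qcomp i y) (qcomp i
      x) C
    + \sum_b ad2 (theta a b y) (theta b a x) C.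
Proof.
move=> hC xm ym; rewrite (kcomp_conn s c0 a (conn_mem _ _) ym);
  apply: (congr2 +%R).
  apply: eq_bigr => i _; rewrite (qcomp_conn_kvec a i hC xm) lieZl scalerA
    lie_lieE.
  by congr (_ *: _); ring.
by apply: eq_bigr => b _; rewrite (kcomp_conn_kvec a b hC xm) lie_lieE.
Qed.

(** The blocks of Z |-> L (L Z x) y: the coefficient of Re tr (q_i-parts)
    collects a path from q_i to u_b (x) k and back, traced at either end. *)
Lemma vtrace_conn2 x y : x \in mm -> y \in mm ->
  vtrace mm (fun z => L (L z x) y) =
    \sum_i (\sum_b u b i ^+ 2 * (1 - c b / (2 * s i))) * ((2 * m)%:R * retr
      (qcomp i y) (qcomp i x))
    + \sum_i (2 * s i) ^- 2 * ((2 * m)%:R * retr (kpart_c y i) (kpart_c x i) - 2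
      * retr (kpart_c y i) (kpart_c x i))
    + \sum_a \sum_b (2 * m.+1)%:R * retr (theta a b y) (theta b a x).
Proof.
move=> xm ym; rewrite vtrace_tangent; last 2 first.
- by move=> a z w; rewrite conn_linear_l conn_linear_l.
- by move=> *; apply: conn_mem.
have q1 i : {in perp, (fun C => qcomp i (L (L (qvec i C) x) y)) =1 fun C =>
    (\sum_b u b i ^+ 2 / 2 * (1 - c b / (2 * s i))) *: ad2 (qcomp i y) (qcomp i
      x) C
    + (2 * s i) ^- 2 *: ad2 (kpart_c y i) (kpart_c x i) C}.
  by move=> C hC; apply: qcomp_conn2.
have k1 a : {in sp, (fun C => kcomp a (L (L (kvec a C) x) y)) =1 fun C =>
    \sum_i (u a i ^+ 2 / 2 * (1 - c a / (2 * s i))) *: ad2 (qcomp i y) (qcomp i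
      x) C
    + \sum_b ad2 (theta a b y) (theta b a x) C}.
  by move=> C hC; apply: kcomp_conn2.
under eq_bigr => i _.
  rewrite (eq_vtrace (q1 i)) vtraceD !vtraceZ (vtrace_perp_ad2 m0 (kpart_c_sp y
    i) (kpart_c_sp x i)).
  have [_ ->] := vtrace_ad2_perp_perp m0 (qcomp_perp i y) (qcomp_perp i x).
  over.
under [X in _ + X]eq_bigr => a _.
  rewrite (eq_vtrace (k1 a)) vtraceD !vtrace_sum.
  under eq_bigr => i _.
    rewrite vtraceZ; have [-> _] := vtrace_ad2_perp_perp m0 (qcomp_perp i y)
      (qcomp_perp i x).
    over.
  under [X in _ + X]eq_bigr => b _ do rewrite vtrace_sp_ad2 ?theta_sp //.
  over.
rewrite /= !big_split /= addrACA [RHS]addrAC -[RHS]addrA [X in _ = _ + X]addrC.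
apply: (congr2 +%R _ erefl); rewrite exchange_big -big_split;
  apply: eq_bigr => i _ /=.
rewrite -[X in _ + X]mulr_suml -mulrDl; congr (_ * _).
by rewrite -big_split; apply: eq_bigr => b _ /=; field; rewrite s0.
Qed.

(** The diagonal blocks are multiples of ad C with C in k, and ad C has trace 0
    on k and on q. *)
Lemma vtrace_conn0 w : w \in mm -> vtrace mm (fun z => L z w) = 0.
Proof.
move=> wm; rewrite vtrace_tangent; last 2 first.
- exact: conn_linear_l.
- by move=> *; apply: conn_mem.
have trN (U : {vspace mat}) (D : mat) : vtrace U (fun C => lie C D) =
  - vtrace U (lie D).
  by rewrite -vtraceN; apply: eq_vtrace => C _; rewrite lieC.
rewrite big1 => [|i _].
  rewrite add0r big1 // => a _.
  rewrite (eq_vtrace (g := fun C => lie C (theta a a w))) => [|C hC];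
    last exact: kcomp_conn_kvec.
  by rewrite trN vtrace_sp_lie ?theta_sp ?oppr0.
rewrite (eq_vtrace (g := fun C => (2 * s i)^-1 *: lie C (kpart_c w i)))
  => [|C hC].
  by rewrite vtraceZ trN vtrace_perp_lie ?kpart_c_sp // oppr0 mulr0.
by rewrite (qcomp_conn_qvec i i hC wm) eqxx scale1r.
Qed.

Lemma kpart_lie X Y : \sum_i lie (kpart X i) (kpart Y i) =
  \sum_a lie (X a) (Y a).
Proof.
under eq_bigr do rewrite lie_suml.
rewrite exchange_big; apply: eq_bigr => a _; rewrite -[in RHS](kpart_ortho Y a)
  lie_sumr.
by apply: eq_bigr => i _; rewrite lieZl lieZr.
Qed.

Lemma diag_comp_lie4 z x : z \in mm -> x \in mm ->
  diag_comp (lie4 z x) = 4^-1 *: (\sum_i lie (qcomp i z) (qcomp i x)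
    + \sum_a lie (kcomp a z) (kcomp a x)).
Proof.
move=> zm xm; rewrite -(kpart_lie (fun a => kcomp a z)) -big_split /diag_comp;
  congr (_ *: _).
apply: eq_bigr => i _; rewrite ffunE {1}(tangent_tvec zm) {1}(tangent_tvec xm)
  !ffunE.
have kk' y j : kpart (fun b => kcomp b y) j \in sp by apply: kpart_sp => a;
  apply: kcomp_sp.
by have [_ ->] := pr_lie (qcomp_perp i z) (kk' z i) (qcomp_perp i x) (kk' x i).
Qed.

Lemma lie4_const_mem C y : C \in sp -> y \in mm ->
  [/\ lie4 (const4 C) y \in mm, forall i, qcomp i (lie4 (const4 C) y) =
    lie C (qcomp i y) &
     forall a, kcomp a (lie4 (const4 C) y) = lie C (kcomp a y)].
Proof.
move=> hC ym; rewrite [in lie4 _ y](tangent_tvec ym) lie4_const.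
have h1 i : lie C (qcomp i y) \in perp by rewrite lie_sp_perp ?qcomp_perp.
have h2 a : lie C (kcomp a y) \in sp by rewrite lie_sp ?kcomp_sp.
by split; [apply: tvec_tangent|move=> i; apply: qcomp_tvec|move=> a;
  apply: kcomp_tvec].
Qed.

Lemma vtrace_isotropy x y : x \in mm -> y \in mm ->
  vtrace mm (fun z => lie4 (daddv_pi kk mm (lie4 z x)) y) =
   4^-1 * (\sum_i (2 * m)%:R * retr (qcomp i y) (qcomp i x)
          + \sum_a (2 * m.+1)%:R * retr (kcomp a y) (kcomp a x)).
Proof.
move=> xm ym.
have pE z : z \in mm -> daddv_pi kk mm (lie4 z x) =
  const4 (diag_comp (lie4 z x)).
  by move=> zm; have [_ ->] := daddv_tangent (fun i => lie4_su i zm xm).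
rewrite vtrace_tangent; last 2 first.
- by move=> a z w; rewrite lie4_l linearP lie4_l.
- by move=> z zm; rewrite pE //; have [] := lie4_const_mem (diag_comp_sp (lie4 z
  x)) ym.
rewrite mulrDr !mulr_sumr; apply: (congr2 +%R); apply: eq_bigr => i _.
  rewrite (eq_vtrace (g := fun C => 4^-1 *: ad2 (qcomp i y) (qcomp i x) C))
    => [|C hC].
    by rewrite vtraceZ; have [_ ->] := vtrace_ad2_perp_perp m0 (qcomp_perp i y)
      (qcomp_perp i x).
  have em := qvec_tangent i hC; rewrite pE //.
  have [_ -> _] := lie4_const_mem (diag_comp_sp (lie4 (qvec i C) x)) ym.
  rewrite (diag_comp_lie4 em xm) [X in _ + X]big1 => [|a _];
    last by rewrite (kcomp_qvec i a hC) lie0l.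
  rewrite addr0 (bigD1 i) //= big1 => [|j /negPf ji].
    by rewrite (qcomp_qvec i i hC) eqxx scale1r addr0 lieZl lie_lieE.
  by rewrite (qcomp_qvec i j hC) ji scale0r lie0l.
rewrite (eq_vtrace (g := fun C => 4^-1 *: ad2 (kcomp i y) (kcomp i x) C))
  => [|C hC].
  by rewrite vtraceZ vtrace_sp_ad2 ?kcomp_sp.
have em := kvec_tangent i hC; rewrite pE //.
have [_ _ ->] := lie4_const_mem (diag_comp_sp (lie4 (kvec i C) x)) ym.
rewrite (diag_comp_lie4 em xm) [X in X + _]big1 => [|a _];
  last by rewrite (qcomp_kvec i a hC) lie0l.
rewrite add0r (bigD1 i) //= big1 => [|j /negPf ji].
  by rewrite (kcomp_kvec i i hC) eqxx scale1r addr0 lieZl lie_lieE.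
by rewrite (kcomp_kvec i j hC) ji scale0r lie0l.
Qed.

End Ricci.

(** * The Ricci tensor of a diagonal metric *)

Section Einstein.
Variables (R : realType) (m : nat).
Hypothesis m0 : (0 < m)%N.
Variables s c : seq R.
Hypothesis s_gt0 : forall i : 'I_4, 0 < s`_i.
Hypothesis c_gt0 : forall a : 'I_3, 0 < c`_a.
Local Notation N := (m + m)%N.
Local Notation mat := (cmx R N).
Local Notation T := {ffun 'I_4 -> cmx R N}.
Local Notation u a i := (uvec R a 0 i).
Local Notation sp := (sp R m).
Local Notation perp := (sp_perp R m).
Local Notation kk := (diag_sp R m).
Local Notation mm := (tangent R m).
Implicit Types (x y z : T).
Let S (i : 'I_4) := s`_i.
Let C (a : 'I_3) := c`_a.
Local Notation L := (@conn R m S C).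
Local Notation g := (@metric R m s c).
Local Notation qf := (@qf R m).

Let S0 i : S i != 0. Proof. by rewrite /S gt_eqF. Qed.
Let C0 a : C a != 0. Proof. by rewrite /C gt_eqF. Qed.

Lemma metric_qf x y : y \in mm -> g x y =
  \sum_(i < 4) s`_i * qf (qcomp i x) (qcomp i y)
    + \sum_(a < 3) c`_a * qf (kcomp a x) (kcomp a y).
Proof. by move=> ym; rewrite metricE // form4_lam. Qed.

Lemma tvec0 : tvec (fun=> 0 : mat) (fun=> 0) = 0.
Proof. by apply/ffunP => i; rewrite !ffunE /kpart big1 ?addr0 // => a _;
  rewrite scaler0. Qed.

Lemma metric_gt0 x : x \in mm -> x != 0 -> 0 < g x x.
Proof.
move=> xm x0; rewrite metric_qf //.
have q_ge0 (i : 'I_4) : 0 <= s`_i * qf (qcomp i x) (qcomp i x).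
  by rewrite mulr_ge0 ?(ltW (s_gt0 i)) // qf_ge0 // sp_perp_su // qcomp_perp.
have k_ge0 (a : 'I_3) : 0 <= c`_a * qf (kcomp a x) (kcomp a x).
  by rewrite mulr_ge0 ?(ltW (c_gt0 a)) // qf_ge0 // sp_su // kcomp_sp.
rewrite lt_neqAle addr_ge0 ?sumr_ge0 // andbT eq_sym.
apply: contra x0; rewrite paddr_eq0 ?sumr_ge0 // => /andP[h1 h2].
rewrite (tangent_tvec xm) -tvec0; apply/eqP; apply: eq_tvec => [i|a].
  move: h1; rewrite psumr_eq0 // => /allP/(_ i (mem_index_enum _)) /=.
  rewrite mulf_eq0 (gt_eqF (s_gt0 i)) /=; apply: contraTeq => q0.
  by rewrite gt_eqF // qf_gt0 // sp_perp_su // qcomp_perp.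
move: h2; rewrite psumr_eq0 // => /allP/(_ a (mem_index_enum _)) /=.
rewrite mulf_eq0 (gt_eqF (c_gt0 a)) /=; apply: contraTeq => q0.
by rewrite gt_eqF // qf_gt0 // sp_su // kcomp_sp.
Qed.

Lemma invariant_metric_tangent : invariant_metric (@lie4 R N) kk mm g.
Proof.
split.
- move=> a x y z _ _ zm; rewrite !metricE // lam_linear form4_linear //.
- by move=> x y xm ym; rewrite !metricE // lam_sym // form4C.
- exact: metric_gt0.
- move=> w x y /diag_spP[D hD ->] xm ym.
  have [h1 h2 h3] := lie4_const_mem hD xm; have [h4 h5 h6] := lie4_const_mem hD
    ym.
  rewrite !metric_qf // addrACA -!big_split !big1 ?addr0 // => [a|i] _ /=.
    by rewrite h3 h6 -mulrDr lieC -scaleN1r qfZl qf_inv mulN1r addNr mulr0.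
  by rewrite h2 h5 -mulrDr lieC -scaleN1r qfZl qf_inv mulN1r addNr mulr0.
Qed.

Let gE : {in mm &, forall x y, g x y = form4 (lam S C x) y}.
Proof. by move=> x y _ ym; rewrite metricE. Qed.

Lemma conn_lc : levi_civita (@lie4 R N) kk mm g L.
Proof.
move=> x y xm ym.
apply: (lc_connP (@reductive_tangent R m) (@form4_linear R m) (@form4C R m)
  (@form4_inv R m)
  (@form4_diag_tangent R m) (@lam_linear R m S C) (fun x _ => lam_tangent S C x)
  (fun x _ => lam_tangent _ _ x) (lamK S0 C0) (@lam_sym R m S C) gE) => //.
Qed.

Lemma ricci_conn L' x y : levi_civita (@lie4 R N) kk mm g L' -> x \in mm ->
  y \in mm ->
  ricci (@lie4 R N) kk mm L' x y =
  - (\sum_i (\sum_b u b i ^+ 2 * (1 - C b / (2 * S i))) * ((2 * m)%:R * retr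
    (qcomp i y) (qcomp i x))
    + \sum_i (2 * S i) ^- 2 * ((2 * m)%:R * retr (kpart_c C y i) (kpart_c C x i)
                             - 2 * retr (kpart_c C y i) (kpart_c C x i))
    + \sum_a \sum_b (2 * m.+1)%:R * retr (theta C a b y) (theta C b a x))
  - 4^-1 * (\sum_i (2 * m)%:R * retr (qcomp i y) (qcomp i x)
          + \sum_a (2 * m.+1)%:R * retr (kcomp a y) (kcomp a x)).
Proof.
move=> lc xm ym.
have e0 := (ricci_lc (@lie4_l R m) (@lie4_r R m) (@lie4C R m)
  (@reductive_tangent R m) (@form4_linear R m) (@form4C R m) (@form4_inv R m)
  (@form4_diag_tangent R m) (@lam_linear R m S C)
  (@lam_linear R m (fun i => (S i)^-1) (fun a => (C a)^-1)) (fun x _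
    => lam_tangent S C x)
  (fun x _ => lam_tangent _ _ x) (lamK S0 C0) (@lam_sym R m S C) gE metric_gt0
    lc xm ym).
have e1 := vtrace_conn0 m0 S0 C0 (conn_mem S C x y).
have e2 := vtrace_conn2 m0 S0 C0 xm ym.
have e3 := vtrace_isotropy m0 xm ym.
have aux (t1 t2 t3 t2' t3' : R) : t1 = 0 -> t2 = t2' -> t3 = t3' -> t1 - t2 - t3
  = - t2' - t3'.
  by move=> -> -> ->; rewrite sub0r.
exact: (etrans e0 (aux _ _ _ _ _ e1 e2 e3)).
Qed.

End Einstein.

(** * The balanced family *)

Section Eval.
Variable R : realType.
Local Notation u a i := (uvec R a 0 i).

Let s2 : R := (Num.sqrt 2)^-1.
Let ss : s2 * s2 = 2^-1.
Proof. by rewrite -invfM -expr2 sqr_sqrtr. Qed.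

(** Weights that are constant on the two pairs of factors, as those of the
    scales (p,p,q,q) are, keep the u_a orthogonal. *)
Lemma uvec2_block (w1 w2 : R) a b :
  \sum_(i < 4) [:: w1; w1; w2; w2]`_i * (u a i * u b i) =
  match val a, val b with
  | 0%N, 0%N => w1 | 1%N, 1%N => w2 | 2%N, 2%N => (w1 + w2) / 2 | _, _ => 0
  end.
Proof.
have e (w : R) : w * (s2 * s2) = w / 2 by rewrite ss.
have := (e w1, e w2) => -[e1 e2].
case_ord3 a; case_ord3 b; rewrite !big_ord_recl big_ord0 !mxE /= -/s2; lra.
Qed.

Lemma uvec_sq a i : u a i ^+ 2 =
  match val a, val i with
  | 0%N, 0%N | 0%N, 1%N | 1%N, 2%N | 1%N, 3%N => 2^-1
  | 2%N, _ => 4^-1 | _, _ => 0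
  end.
Proof.
case_ord3 a; case_ord4 i; rewrite !mxE /= -/s2 ?sqrrN expr2 -/s2 ?ss ?mul0r //;
  lra.
Qed.
End Eval.

Section RetrLin.
Variables (R : realType) (n : nat).
Implicit Types X Y Z : cmx R n.
Lemma retr0l Z : retr 0 Z = 0. Proof. by rewrite /retr mul0mx raddf0. Qed.
Lemma retrZl a X Z : retr (a *: X) Z = a * retr X Z.
Proof. by rewrite -[a *: X]addr0 retr_linear retr0l addr0. Qed.
Lemma retrDl X Y Z : retr (X + Y) Z = retr X Z + retr Y Z.
Proof. by rewrite -[X]scale1r retr_linear !scale1r mul1r. Qed.
Lemma retr_suml (I : finType) (F : I -> cmx R n) Z : retr (\sum_i F i) Z =
  \sum_i retr (F i) Z.
Proof. by apply: (big_morph (fun C => retr C Z)) => [? ?|];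
  rewrite ?retrDl ?retr0l. Qed.
Lemma retr_comb (I J : finType) (f : I -> R) (h : J -> R) (F : I ->
  cmx R n) (G : J -> cmx R n) :
  retr (\sum_i f i *: F i) (\sum_j h j *: G j) =
    \sum_i \sum_j f i * h j * retr (F i) (G j).
Proof.
rewrite retr_suml; apply: eq_bigr => i _; rewrite retrZl retrC retr_suml
  mulr_sumr.
by apply: eq_bigr => j _; rewrite retrZl retrC mulrA.
Qed.
End RetrLin.

Section Balanced.
Variable R : realType.
Variables p q A B : R.
Hypotheses (p0 : 0 < p) (q0 : 0 < q) (A0 : 0 < A) (B0 : 0 < B).
Local Notation N := (9 + 9)%N.
Local Notation T := {ffun 'I_4 -> cmx R N}.
Local Notation u a i := (uvec R a 0 i).
Local Notation sp := (sp R 9).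
Local Notation perp := (sp_perp R 9).
Local Notation kk := (diag_sp R 9).
Local Notation mm := (tangent R 9).
Implicit Types (x y z : T).
Let s := [:: p; p; q; q].
Let c := [:: A; B; 1].
Local Notation g := (@metric R 9 s c).

Lemma s_gt0 (i : 'I_4) : 0 < s`_i. Proof. by case_ord4 i. Qed.
Lemma c_gt0 (a : 'I_3) : 0 < c`_a. Proof. by case_ord3 a. Qed.

(** The eigenvalues on the q_i and on the u_a (x) k. *)
Definition ricq (i : 'I_4) : R := [:: ric_q p A; ric_q p A; ric_q q B;
  ric_q q B]`_i.
Definition rick (a : 'I_3) : R := [:: ric_k p A; ric_k q B; ric_C p q A B]`_a.

Let C (a : 'I_3) : R := c`_a.
Let S (i : 'I_4) : R := s`_i.

(** In the three lemmas below, 18 = 2m, 16 = 2m - 2 and 20 = 2m + 2 are the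
    trace constants for m = 9, and qf = - 36 retr. *)
Lemma q_block i : - ((\sum_b u b i ^+ 2 * (1 - C b / (2 * S i))) * 18) - 4^-1 *
  18
  = - 36 * (ricq i * S i).
Proof.
rewrite !big_ord_recl big_ord0 !uvec_sq /= /ricq /ric_q /C /S /c /s.
by case_ord4 i; rewrite /=; field; rewrite !gt_eqF.
Qed.

Lemma kpart_c_block x y : \sum_i (2 * S i) ^- 2 * (18 * retr (kpart_c C y i)
  (kpart_c C x i)
     - 2 * retr (kpart_c C y i) (kpart_c C x i)) =
  \sum_(a < 3) (4 * C a ^+ 2 * [:: p ^- 2; q ^- 2;
    (p ^- 2 + q ^- 2) / 2]`_a) * retr (kcomp a y) (kcomp a x).
Proof.
pose w := [:: p ^- 2; p ^- 2; q ^- 2; q ^- 2].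
have wE i : (2 * S i) ^- 2 = w`_i / 4.
  by rewrite /S /w; case_ord4 i; rewrite /=; field; rewrite gt_eqF.
transitivity (\sum_a \sum_b (4 * C a * C b * \sum_(i < 4) w`_i * (u a i * u b
  i)) * retr (kcomp a y) (kcomp b x)).
  transitivity (\sum_(i < 4) \sum_a \sum_b (4 * C a * C b * (w`_i * (u a i * u b
    i))) * retr (kcomp a y) (kcomp b x)).
    apply: eq_bigr => i _; rewrite -mulrBl wE.
    have -> : retr (kpart_c C y i) (kpart_c C x i) =
      \sum_a \sum_b (u a i * C a) * (u b i * C b) * retr (kcomp a y) (kcomp b
      x).
      rewrite -retr_comb; congr (retr _ _); apply: eq_bigr => a _;
        exact: scalerA.
    rewrite mulrA mulr_sumr; apply: eq_bigr => a _; rewrite mulr_sumr;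
      apply: eq_bigr => b _.
    by field.
  rewrite exchange_big; apply: eq_bigr => a _; rewrite exchange_big;
    apply: eq_bigr => b _.
  by rewrite mulr_sumr mulr_suml.
apply: eq_bigr => a _; rewrite (bigD1 a) //= [X in _ + X]big1 ?addr0
  => [|b /negPf ba].
  by rewrite /w uvec2_block; congr (_ * _); case_ord3 a => /=; rewrite expr2;
    ring.
rewrite /w uvec2_block; move: ba; case_ord3 a; case_ord3 b => //= _;
  rewrite ?mulr0 ?mul0r //.
Qed.

Definition tcoef (a b d : 'I_3) : R := 2^-1 * uvec_triple R a b d * (1
  + (C d - C b) / C a).

Lemma theta_block x y : \sum_a \sum_b 20 * retr (theta C a b y) (theta C b a x)
  =
  \sum_(d < 3) (20 * [:: 8^-1 * (2 - A^-1); 8^-1 * (2 - B^-1);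
    16^-1 * (A ^- 2 + B ^- 2)]`_d) * retr (kcomp d y) (kcomp d x).
Proof.
transitivity (\sum_d \sum_e (20 * \sum_a \sum_b tcoef a b d * tcoef b a e) *
  retr (kcomp d y) (kcomp e x)).
  transitivity (\sum_a \sum_b \sum_d \sum_e 20 * (tcoef a b d * tcoef b a e) *
    retr (kcomp d y) (kcomp e x)).
    apply: eq_bigr => a _; apply: eq_bigr => b _.
    rewrite /theta retr_comb mulr_sumr; apply: eq_bigr => d _;
      rewrite mulr_sumr.
    by apply: eq_bigr => e _; rewrite !mulrA.
  rewrite (eq_bigr (fun a => \sum_d \sum_b \sum_e 20 * (tcoef a b d * tcoef b a
    e) * retr (kcomp d y) (kcomp e x))).
    rewrite exchange_big; apply: eq_bigr => d _.
    rewrite (eq_bigr (fun a => \sum_e \sum_b 20 * (tcoef a b d * tcoef b a e) *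
      retr (kcomp d y) (kcomp e x))).
      rewrite exchange_big; apply: eq_bigr => e _; rewrite mulr_sumr mulr_suml.
      by apply: eq_bigr => a _; rewrite mulr_sumr mulr_suml.
    by move=> a _; rewrite exchange_big.
  by move=> a _; rewrite exchange_big.
have tcoefE (d e : 'I_3) : \sum_a \sum_b tcoef a b d * tcoef b a e =
    (d == e)%:R * [:: 8^-1 * (2 - A^-1); 8^-1 * (2 - B^-1);
      16^-1 * (A ^- 2 + B ^- 2)]`_d.
  rewrite !big_ord_recl !big_ord0 /tcoef !uvec_tripleE /= /C /c.
  by case_ord3 d; case_ord3 e; rewrite /= ?(mulr0, mul0r, add0r, addr0) //;
    field; rewrite ?gt_eqF.
apply: eq_bigr => d _; rewrite (bigD1 d) //= [X in _ + X]big1 ?addr0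
  => [|e /negPf de].
  by rewrite tcoefE eqxx mul1r.
by rewrite tcoefE eq_sym de mul0r mulr0 mul0r.
Qed.

Lemma k_block (a : 'I_3) : - (4 * C a ^+ 2 * [:: p ^- 2; q ^- 2;
  (p ^- 2 + q ^- 2) / 2]`_a
     + 20 * [:: 8^-1 * (2 - A^-1); 8^-1 * (2 - B^-1);
       16^-1 * (A ^- 2 + B ^- 2)]`_a) - 4^-1 * 20
  = - 36 * (rick a * C a).
Proof.
rewrite /rick /ric_k /ric_C /rho /C /c.
by case_ord3 a; rewrite /=; field; rewrite ?gt_eqF.
Qed.

Lemma ricci_balanced L' x y : levi_civita (@lie4 R N) kk mm g L' -> x \in mm ->
  y \in mm ->
  ricci (@lie4 R N) kk mm L' x y =
   \sum_(i < 4) ricq i * (s`_i * qf (qcomp i x) (qcomp i y))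
     + \sum_(a < 3) rick a * (c`_a * qf (kcomp a x) (kcomp a y)).
Proof.
move=> lc xm ym.
transitivity (- (\sum_i (\sum_b u b i ^+ 2 * (1 - C b / (2 * S i))) * (18 * retr
  (qcomp i y) (qcomp i x))
    + \sum_i (2 * S i) ^- 2 * (18 * retr (kpart_c C y i) (kpart_c C x i)
                             - 2 * retr (kpart_c C y i) (kpart_c C x i))
    + \sum_a \sum_b 20 * retr (theta C a b y) (theta C b a x))
  - 4^-1 * (\sum_i 18 * retr (qcomp i y) (qcomp i x)
    + \sum_a 20 * retr (kcomp a y) (kcomp a x))).
  exact: (ricci_conn (isT : (0 < 9)%N) s_gt0 c_gt0 lc xm ym).
rewrite (kpart_c_block x y) (theta_block x y).
have E1 : \sum_(i < 4) ricq i * (s`_i * qf (qcomp i x) (qcomp i y)) =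
    - (\sum_i (\sum_b u b i ^+ 2 * (1 - C b / (2 * S i))) * (18 * retr (qcomp i
      y) (qcomp i x)))
    - 4^-1 * \sum_i 18 * retr (qcomp i y) (qcomp i x).
  rewrite mulr_sumr -sumrN -sumrB; apply: eq_bigr => i _.
  transitivity (- 36 * (ricq i * S i) * retr (qcomp i y) (qcomp i x)).
    by rewrite /qf retrC /S; ring.
  by rewrite -q_block; ring.
have E2 : \sum_(a < 3) rick a * (c`_a * qf (kcomp a x) (kcomp a y)) =
    - (\sum_(a < 3) (4 * C a ^+ 2 * [:: p ^- 2; q ^- 2;
      (p ^- 2 + q ^- 2) / 2]`_a) * retr (kcomp a y) (kcomp a x))
    - \sum_(a < 3) (20 * [:: 8^-1 * (2 - A^-1); 8^-1 * (2 - B^-1);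
      16^-1 * (A ^- 2 + B ^- 2)]`_a)
        * retr (kcomp a y) (kcomp a x)
    - 4^-1 * \sum_a 20 * retr (kcomp a y) (kcomp a x).
  rewrite mulr_sumr -sumrN -!sumrB; apply: eq_bigr => a _.
  transitivity (- 36 * (rick a * C a) * retr (kcomp a y) (kcomp a x)).
    by rewrite /qf retrC /C; ring.
  by rewrite -k_block; ring.
by rewrite E1 E2; ring.
Qed.

(** Conversely to the computation of the eigenvalues, testing the Einstein
    equation on one vector of each summand recovers them; this uses that k and q
    contain nonzero vectors. *)
Lemma balanced_einsteinP : balanced_einstein 9 p q A B <->
  [/\ ric_q q B = ric_q p A, ric_k p A = ric_q p A,
    ric_k q B = ric_q p A & ric_C p q A B = ric_q p A].
Proof.
have n9 : (0 < 9)%N by [].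
split=> [[_ _ [L [lc [lambda hl]]]]|[hq hA hB hC]].
  have [X Xsp X0] := sp_neq0 R n9.
  have [Y Yq Y0] := @sp_perp_neq0 R 9 n9 isT.
  have QX : 0 < qf X X by rewrite qf_gt0 ?sp_su.
  have QY : 0 < qf Y Y by rewrite qf_gt0 ?sp_perp_su.
  have hi (i : 'I_4) : ricq i = lambda.
    have em := qvec_tangent i Yq; have := hl _ _ em em.
    rewrite (ricci_balanced lc em em) (metric_qf n9 s c _ em).
    rewrite (bigD1 i) //= [X in _ + X + _]big1 => [|j /negPf ji]; last first.
      by rewrite (qcomp_qvec i j Yq) ji scale0r qf0 !mulr0.
    rewrite [X in _ + X = _]big1 => [|a _]; last by rewrite (kcomp_qvec i a Yq)
      qf0 !mulr0.
    rewrite [in RHS](bigD1 i) //= [X in _ = _ * (_ + X + _)]big1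
      => [|j /negPf ji]; last first.
      by rewrite (qcomp_qvec i j Yq) ji scale0r qf0 !mulr0.
    rewrite [X in _ = _ * (_ + X)]big1 => [|a _];
      last by rewrite (kcomp_qvec i a Yq) qf0 !mulr0.
    rewrite !addr0 (qcomp_qvec i i Yq) eqxx scale1r => /mulIf; apply.
    by rewrite mulf_neq0 ?gt_eqF ?s_gt0.
  have ha (a : 'I_3) : rick a = lambda.
    have em := kvec_tangent a Xsp; have := hl _ _ em em.
    rewrite (ricci_balanced lc em em) (metric_qf n9 s c _ em).
    rewrite [X in X + _ = _]big1 => [|i _]; last by rewrite (qcomp_kvec a i Xsp)
      qf0 !mulr0.
    rewrite (bigD1 a) //= [X in _ + (_ + X) = _]big1 => [|b /negPf ba];
      last first.
      by rewrite (kcomp_kvec a b Xsp) ba scale0r qf0 !mulr0.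
    rewrite [X in _ = _ * (X + _)]big1 => [|i _];
      last by rewrite (qcomp_kvec a i Xsp) qf0 !mulr0.
    rewrite [in RHS](bigD1 a) //= [X in _ = _ * (_ + (_ + X))]big1
      => [|b /negPf ba]; last first.
      by rewrite (kcomp_kvec a b Xsp) ba scale0r qf0 !mulr0.
    rewrite !addr0 !add0r (kcomp_kvec a a Xsp) eqxx scale1r => /mulIf; apply.
    by rewrite mulf_neq0 ?gt_eqF ?c_gt0.
  have := (hi (@Ordinal 4 0 isT), hi (@Ordinal 4 2 isT));
    rewrite /ricq /= => -[-> ->].
  have := (ha (@Ordinal 3 0 isT), ha (@Ordinal 3 1 isT), ha (@Ordinal 3 2 isT)).
  by rewrite /rick /= => -[[-> ->] ->].
have lc := conn_lc n9 s_gt0 c_gt0.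
split.
- exact: reductive_tangent.
- refine (invariant_metric_tangent _ _ _); [exact: n9|exact: s_gt0|exact:
  c_gt0].
- exists (@conn R 9 (fun i => s`_i) (fun a => c`_a)); split; first exact: lc.
  exists (ric_q p A) => x y xm ym; rewrite (ricci_balanced lc xm ym) (metric_qf
    n9 s c _ ym).
  rewrite mulrDr !mulr_sumr; congr (_ + _); apply: eq_bigr => i _;
    congr (_ * _).
    by rewrite /ricq; case_ord4 i => /=.
  by rewrite /rick; case_ord3 i => /=.
Qed.

Lemma balanced_map_zeroP : balanced_map p q A B = (0, 0, 0, 0) <->
  [/\ ric_q q B = ric_q p A, ric_k p A = ric_q p A,
    ric_k q B = ric_q p A & ric_C p q A B = ric_q p A].
Proof.
rewrite /balanced_map; move: (ric_q p A) (ric_q q B) (ric_k p A) (ric_k q B)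
  (ric_C p q A B).
move=> rp rq rA rB rC.
have z (t v : R) : t != 0 -> (t * v = 0) <-> (v = 0).
  by move=> t0; split=> [/eqP|->]; rewrite ?mulr0 // mulf_eq0 (negPf t0)
    => /eqP.
have rho0 : 0 < rho R by rewrite /rho; lra.
move: (rho R) rho0 => rh rho0.
have d1 : 16 * p ^+ 2 * q ^+ 2 != 0 by rewrite gt_eqF // !mulr_gt0 ?exprn_gt0.
have d2 : 16 * rh * p ^+ 2 * q ^+ 2 * A ^+ 2 * B ^+ 2 != 0.
  by rewrite gt_eqF // !mulr_gt0 ?exprn_gt0.
have d3 : 32 * rh * p ^+ 2 * q ^+ 2 * A ^+ 2 * B ^+ 2 != 0.
  by rewrite gt_eqF // !mulr_gt0 ?exprn_gt0.
split=> [[/(z _ _ d1) e1 /(z _ _ d2) e2 /(z _ _ d3) e3 /(z _ _ d3) e4]|[-> -> ->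
  ->]].
  by split; lra.
by congr (_, _, _, _); field.
Qed.

Lemma einstein_zero : balanced_einstein 9 p q A B <-> balanced_map p q A B = (0,
  0, 0, 0).
Proof. by rewrite balanced_einsteinP balanced_map_zeroP. Qed.
End Balanced.

HB.instance Definition _ (R : realType) (n : nat) := Complete.on 'rV[R]_n.

(** * Ball arithmetic and slopes of integer polynomials *)

Lemma rV_norm_le (R : realType) n (x : 'rV[R]_n) (r : R) : 0 <= r ->
  (`|x| <= r) = [forall i, `|x 0 i| <= r].
Proof.
move=> r0; rewrite [leLHS]mx_normrE; apply/bigmax_leP/forallP => /=.
  by case=> _ h i; apply: (h (0, i)).
by move=> h; split=> // -[i j] _ /=; rewrite ord1.
Qed.

Lemma box_fixed_point (R : realType) (X : completeNormedModType R) (c : X)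
    (r : R) (f : X -> X) : 0 <= r ->
  (forall x, `|x - c| <= r -> `|f x - c| <= r) ->
  (forall x y, `|x - c| <= r -> `|y - c| <= r ->
    `|f x - f y| <= 2^-1 * `|x - y|) ->
  exists2 x, `|x - c| <= r & f x = x.
Proof.
move=> r0 fS fL.
pose U := [set x : X | `|x - c| <= r]%classic.
have fU : set_fun U U f by move=> x; apply: fS.
pose F : {fun U >-> U} := HB.pack f (isFun.Build _ _ U U f fU).
have cF : is_contraction F.
  exists (2^-1)%:nng; split; first by rewrite /= invf_lt1 ?ltr1n.
  by case=> x y [/= Ux Uy]; apply: fL.
have clU : closed U.
  apply: (@closed_comp _ _ (fun x => `|x - c|) [set y | y <= r]%classic);
    last exact: closed_le.
  by move=> x _; apply: cvg_norm; apply: cvgB; [exact: cvg_id|exact: cvg_cst].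
have [|x Ux e] := banach_fixed_point cF clU.
  by exists c; rewrite /U /= subrr normr0.
by exists x.
Qed.

Inductive pexpr (n : nat) : Type :=
| PVar of 'I_n
| PInt of Z
| PAdd of pexpr n & pexpr n
| PMul of pexpr n & pexpr n.
Arguments PInt {n}.

(** Locked, since unification would otherwise count out large integers in
    unary. *)
HB.lock Definition realZ (R : realType) (z : Z) : R := (int_of_Z z)%:~R.

Section RealZ.
Variable R : realType.
Local Notation zr := (@realZ R).

Lemma realZD a b : zr (a + b)%Z = zr a + zr b.
Proof. by rewrite realZ.unlock -intrD; congr (_%:~R);
  apply: (can_inj Z_of_intK); lia. Qed.
Lemma realZM a b : zr (a * b)%Z = zr a * zr b.
Proof. by rewrite realZ.unlock -intrM; congr (_%:~R);
  apply: (can_inj Z_of_intK); lia. Qed.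
Lemma realZN a : zr (- a)%Z = - zr a.
Proof. by rewrite realZ.unlock -rmorphN; congr (_%:~R);
  apply: (can_inj Z_of_intK); lia. Qed.
Lemma realZ_abs a : zr (Z.abs a) = `|zr a|.
Proof. by rewrite realZ.unlock -intr_norm; congr (_%:~R); lia. Qed.
Lemma realZ_le a b : (zr a <= zr b) = (a <=? b)%Z.
Proof. by rewrite realZ.unlock ler_int; lia. Qed.
Lemma realZ0 : zr 0 = 0. Proof. by rewrite realZ.unlock. Qed.
Lemma realZ1 : zr 1 = 1. Proof. by rewrite realZ.unlock. Qed.
Lemma realZ2 : zr 2 = 2. Proof. by rewrite realZ.unlock. Qed.
Lemma realZ_gt0 a : (0 <? a)%Z -> 0 < zr a.
Proof. by move=> a0; rewrite -realZ0 ltNge realZ_le; lia. Qed.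
Lemma realZ_xO u : zr (Zpos (xO u)) = 2 * zr (Zpos u).
Proof. by rewrite -[Zpos (xO u)]/(2 * Zpos u)%Z realZM realZ2. Qed.
Lemma realZ_xI u : zr (Zpos (xI u)) = 2 * zr (Zpos u) + 1.
Proof. by rewrite -[Zpos (xI u)]/(2 * Zpos u + 1)%Z realZD realZM realZ2 realZ1.
  Qed.
Lemma realZ_neg u : zr (Zneg u) = - zr (Zpos u).
Proof. by rewrite -[Zneg u]/(Z.opp (Zpos u)) realZN. Qed.
Lemma realZ_of_nat k : zr (Z.of_nat k) = k%:R.
Proof. by rewrite realZ.unlock -[RHS]/((Posz k)%:~R); congr (_%:~R); lia. Qed.

Fixpoint peval n (x : 'rV[R]_n) (e : pexpr n) : R :=
  match e with
  | PVar i => x 0 i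
  | PInt z => zr z
  | PAdd e1 e2 => peval x e1 + peval x e2
  | PMul e1 e2 => peval x e1 * peval x e2
  end.

(** Forward differentiation with divided differences: the slopes at (x, y)
    write e(x) - e(y) as a linear form in x - y ([pslopeP]), so that bounds for
    them on a box are Lipschitz bounds for e. *)
Fixpoint pslope n (x y : 'rV[R]_n) (k : nat) (e : pexpr n) : R :=
  match e with
  | PVar i => if (i == k :> nat) then 1 else 0
  | PInt _ => 0
  | PAdd e1 e2 => pslope x y k e1 + pslope x y k e2
  | PMul e1 e2 => peval x e1 * pslope x y k e2 + pslope x y k e1 * peval y e2
  end.

Lemma pslopeP n (x y : 'rV[R]_n) e :
  peval x e - peval y e = \sum_(k < n) pslope x y k e * (x 0 k - y 0 k).
Proof.
elim: e => [i|z|e1 IH1 e2 IH2|e1 IH1 e2 IH2] /=.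
- rewrite (bigD1 i) //= eqxx mul1r big1 ?addr0 // => k /negPf ki.
  by rewrite eq_sym val_eqE ki mul0r.
- by rewrite subrr big1 // => k _; rewrite mul0r.
- rewrite opprD addrACA IH1 IH2 -big_split /=.
  by apply: eq_bigr => k _; rewrite mulrDl.
- transitivity (peval x e1 * (peval x e2 - peval y e2)
                + (peval x e1 - peval y e1) * peval y e2); first by ring.
  rewrite IH1 IH2 mulr_sumr mulr_suml -big_split /=.
  by apply: eq_bigr => k _; ring.
Qed.

Lemma realZ_pow a k : zr (Z.pow a (Z.of_nat k)) = zr a ^+ k.
Proof.
elim: k => [|k IH]; first by rewrite expr0 -realZ1.
by rewrite Nat2Z.inj_succ Z.pow_succ_r ?realZM ?IH ?exprS //; lia.
Qed.
End RealZ.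
Definition realZE := (realZ_neg, realZ_xO, realZ_xI, realZ1, realZ0).

(** [Ball c r e] stands for the reals v with |v D^e - c| <= r.  Letting the
    power of the denominator D grow with the degree makes all operations exact:
    there is no rounding to account for. *)
Record ball := Ball { mid : Z; rad : Z; prec : nat }.

Section BallArithmetic.
Variable D : Z.

Definition bscale b k :=
  let s := Z.pow D (Z.of_nat k) in
  Ball (mid b * s) (rad b * s) (prec b + k).

Definition badd b1 b2 :=
  let b1' := bscale b1 (prec b2 - prec b1) in
  let b2' := bscale b2 (prec b1 - prec b2) in
  Ball (mid b1' + mid b2') (rad b1' + rad b2') (prec b1').

Definition bmul b1 b2 :=
  Ball (mid b1 * mid b2)
    (Z.abs (mid b1) * rad b2 + Z.abs (mid b2) * rad b1 + rad b1 * rad b2)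
    (prec b1 + prec b2).

Fixpoint beval n (X : 'I_n -> ball) (e : pexpr n) : ball :=
  match e with
  | PVar i => X i
  | PInt z => Ball z 0 0
  | PAdd e1 e2 => badd (beval X e1) (beval X e2)
  | PMul e1 e2 => bmul (beval X e1) (beval X e2)
  end.

Fixpoint bslope n (X : 'I_n -> ball) (k : nat) (e : pexpr n) : ball :=
  match e with
  | PVar i => Ball (if i == k :> nat then 1 else 0) 0 0
  | PInt _ => Ball 0 0 0
  | PAdd e1 e2 => badd (bslope X k e1) (bslope X k e2)
  | PMul e1 e2 =>
      badd (bmul (beval X e1) (bslope X k e2)) (bmul (bslope X k e1) (beval X
        e2))
  end.

(** A test for m |v| <= d at every v of the ball. *)
Definition bsmall (m d : Z) b :=
  (m * (Z.abs (mid b) + rad b) <=? d * Z.pow D (Z.of_nat (prec b)))%Z.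

Variable R : realType.
Hypothesis D_gt0 : (0 <? D)%Z.
Local Notation zr := (@realZ R).

Definition inball (v : R) b := `|v * zr D ^+ prec b - zr (mid b)| <= zr (rad b).

Lemma inball_scale v b k : inball v b -> inball v (bscale b k).
Proof.
rewrite /inball /= !realZM realZ_pow exprD mulrA -mulrBl normrM => h.
by rewrite [`|_ ^+ _|]ger0_norm ?ler_wpM2r // exprn_ge0 // ltW // (realZ_gt0 R
  D_gt0).
Qed.

Lemma inball_add v w b1 b2 : inball v b1 -> inball w b2 -> inball (v
  + w) (badd b1 b2).
Proof.
move=> /(@inball_scale _ _ (prec b2 - prec b1)) h1.
move=> /(@inball_scale _ _ (prec b1 - prec b2)) h2.
rewrite /inball /= !(realZD, realZM) !realZ_pow.
move: h1 h2; rewrite /inball /= !realZM !realZ_pow -!maxnE maxnC => h1 h2.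
by rewrite mulrDl opprD addrACA (le_trans (ler_normD _ _)) // lerD.
Qed.

Lemma inball_mul v w b1 b2 : inball v b1 -> inball w b2 ->
  inball (v * w) (bmul b1 b2).
Proof.
rewrite /inball /= !(realZD, realZM) !realZ_abs exprD.
set a := v * _; set b := w * _ => h1 h2.
have -> : v * w * (zr D ^+ prec b1 * zr D ^+ prec b2) - zr (mid b1) * zr (mid
  b2)
  = zr (mid b1) * (b - zr (mid b2)) + zr (mid b2) * (a - zr (mid b1))
    + (a - zr (mid b1)) * (b - zr (mid b2)) by rewrite /a /b; ring.
apply: (le_trans (ler_normD _ _)); apply: lerD; last by rewrite normrM ler_pM.
by apply: (le_trans (ler_normD _ _)); apply: lerD; rewrite normrM ler_wpM2l.
Qed.

Lemma inball_eval n (x : 'rV[R]_n) X e :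
  (forall i, inball (x 0 i) (X i)) -> inball (peval x e) (beval X e).
Proof.
move=> h; elim: e => [i|z|e1 IH1 e2 IH2|e1 IH1 e2 IH2] /=.
- exact: h.
- by rewrite /inball /= mulr1 subrr normr0 realZ0.
- exact: inball_add.
- exact: inball_mul.
Qed.

Lemma inball_slope n (x y : 'rV[R]_n) X k e :
  (forall i, inball (x 0 i) (X i)) -> (forall i, inball (y 0 i) (X i)) ->
  inball (pslope x y k e) (bslope X k e).
Proof.
move=> hx hy; elim: e => [i|z|e1 IH1 e2 IH2|e1 IH1 e2 IH2] /=.
- by rewrite /inball /=; case: ifP => _; rewrite mulr1 ?realZ1 ?realZ0 subrr
  normr0.
- by rewrite /inball /= mulr1 realZ0 subrr normr0.
- exact: inball_add.
- by apply: inball_add; apply: inball_mul => //; apply: inball_eval.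
Qed.

Lemma inball_small v b m d : inball v b -> bsmall m d b -> (0 <=? m)%Z ->
  zr m * `|v| <= zr d.
Proof.
move=> h; rewrite /bsmall -(realZ_le R) !(realZD,
  realZM) realZ_abs realZ_pow => hs.
rewrite -(realZ_le R) realZ0 => m0.
rewrite -(ler_pM2r (exprn_gt0 (prec b) (realZ_gt0 R D_gt0)));
  apply: le_trans hs.
rewrite -mulrA ler_wpM2l //.
rewrite -[X in _ * X]ger0_norm ?exprn_ge0 ?(ltW (realZ_gt0 R D_gt0)) // -normrM.
apply: (@le_trans _ _ (`|v * zr D ^+ prec b - zr (mid b)| + `|zr (mid b)|)).
  by rewrite -[X in `|X| <= _](subrK (zr (mid b))) ler_normD.
by rewrite addrC lerD2l.
Qed.

End BallArithmetic.

(** * Krawczyk's test *)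

Section Krawczyk.
Variables (n : nat) (s : Z) (E : 'I_n -> pexpr n).

Definition box (c : 'I_n -> Z) (r : Z) (i : 'I_n) := Ball (c i) r 1.

(** The n slopes of each component of s (x - E(x) / s) are at most s / (2n) in
    absolute value on the box; the map is then a contraction of ratio 1/2. *)
Definition small_slopes (D : Z) (c : 'I_n -> Z) (r : Z) :=
  forall i k : 'I_n,
    bsmall D (2 * Z.of_nat n) s
      (bslope D (box c r) k (PAdd (PMul (PInt s) (PVar i)) (PMul (PInt (-1)) (E
        i)))).

(** At the center of the box the step E / s is at most half of the radius
    r / D. *)
Definition small_residual (D : Z) (c : 'I_n -> Z) (r : Z) :=
  forall i : 'I_n, bsmall D (2 * D) (s * r) (beval D (box c 0) (E i)).

Variable R : realType.
Local Notation zr := (@realZ R).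
Hypothesis s_gt0 : (0 <? s)%Z.
Let zs_gt0 : 0 < zr s := realZ_gt0 R s_gt0.

Definition newton (x : 'rV[R]_n) : 'rV[R]_n := \row_i (x 0 i - peval x (E i) /
  zr s).

Definition inbox (D : Z) (c : 'I_n -> Z) (r : Z) (x : 'rV[R]_n) :=
  forall i, `|x 0 i - zr (c i) / zr D| <= zr r / zr D.

Lemma inball_box D c r x : (0 <? D)%Z -> inbox D c r x ->
  forall i, inball D (x 0 i) (box c r i).
Proof.
move=> /(realZ_gt0 R) zD_gt0 h i; rewrite /inball /= expr1.
have -> : `|x 0 i * zr D - zr (c i)| = `|x 0 i - zr (c i) / zr D| * zr D.
  rewrite -[X in _ = _ * X]ger0_norm ?(ltW zD_gt0) // -normrM mulrBl divfK //.
  by rewrite gt_eqF.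
by rewrite -ler_pdivlMr.
Qed.

Lemma newton_contract D c r (x y : 'rV[R]_n) : (0 <? D)%Z ->
  small_slopes D c r ->
  inbox D c r x -> inbox D c r y -> `|newton x - newton y| <= 2^-1 * `|x - y|.
Proof.
move=> D_gt0 hs hx hy; rewrite rV_norm_le ?mulr_ge0 // ?invr_ge0 //.
apply/forallP => i; rewrite !mxE.
set e := PAdd (PMul (PInt s) (PVar i)) (PMul (PInt (-1)) (E i)).
have -> : x 0 i - peval x (E i) / zr s - (y 0 i - peval y (E i) / zr s)
   = (peval x e - peval y e) / zr s.
  rewrite /= -[Zneg 1]/(Z.opp 1) realZN realZ1; field; exact: lt0r_neq0.
rewrite normrM normfV [`|zr s|]ger0_norm ?(ltW zs_gt0) // ler_pdivrMr //.
rewrite pslopeP (le_trans (ler_norm_sum _ _ _)) //.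
have n0 : 0 < n%:R :> R by rewrite ltr0n; apply: leq_trans (ltn_ord i).
apply: (@le_trans _ _ (\sum_(k < n) (zr s / (2 * n%:R)) * `|x - y|)).
  apply: ler_sum => k _; rewrite normrM ler_pM //; last first.
    have := lexx `|x - y|; rewrite rV_norm_le // => /forallP/(_ k);
      by rewrite !mxE.
  rewrite ler_pdivlMr ?mulr_gt0 // mulrC.
  have -> : 2 * n%:R = zr (2 * Z.of_nat n) by rewrite realZM realZ_of_nat
    realZ2.
  apply: inball_small (hs i k) _ => //; last by lia.
  by apply: inball_slope => //; apply: inball_box.
rewrite sumr_const card_ord -mulr_natr le_eqVlt; apply/orP; left; apply/eqP.
by field; rewrite gt_eqF.
Qed.

Lemma newton_zero (x : 'rV[R]_n) : newton x = x <-> forall i, peval x (E i) = 0.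
Proof.
split=> [/rowP h i|h].
  have /eqP := h i; rewrite mxE -subr_eq0 addrAC subrr add0r oppr_eq0.
  by rewrite mulf_eq0 invr_eq0 (gt_eqF zs_gt0) orbF => /eqP.
by apply/rowP => i; rewrite mxE h mul0r subr0.
Qed.

Lemma krawczyk_unique D c r (x y : 'rV[R]_n) : (0 <? D)%Z ->
  small_slopes D c r ->
  inbox D c r x -> inbox D c r y ->
  (forall i, peval x (E i) = 0) -> (forall i, peval y (E i) = 0) -> x = y.
Proof.
move=> D_gt0 hs hx hy /newton_zero ex /newton_zero ey.
have := newton_contract D_gt0 hs hx hy; rewrite ex ey => h.
apply/eqP; rewrite -subr_eq0 -normr_le0.
by lra.
Qed.

(** The slopes are tested on a wide box [D0, c0, r0], the residual on a small box
    inside it: the slopes do not need the precision of the root. *)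
Lemma krawczyk_exists D0 c0 r0 D c r :
  (0 <? D0)%Z -> (0 <? D)%Z -> (0 <=? r)%Z -> small_slopes D0 c0 r0 ->
  (forall x, inbox D c r x -> inbox D0 c0 r0 x) -> small_residual D c r ->
  exists2 x : 'rV[R]_n, inbox D c r x & forall i, peval x (E i) = 0.
Proof.
rewrite -(realZ_le R) realZ0 => D0_gt0 D_gt0 r_ge0 hs sub hr.
have zD_gt0 := realZ_gt0 R D_gt0.
have rD0 : 0 <= zr r / zr D by rewrite divr_ge0 // ltW.
pose m : 'rV[R]_n := \row_i (zr (c i) / zr D).
have inboxE x : (`|x - m| <= zr r / zr D) <-> inbox D c r x.
  rewrite rV_norm_le //; split=> [/forallP h i|h]; last apply/forallP => i.
    by have := h i; rewrite !mxE.
  by rewrite !mxE; apply: h.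
have mm : `|m - m| <= zr r / zr D by rewrite subrr normr0.
have ctr : `|newton m - m| <= 2^-1 * (zr r / zr D).
  rewrite rV_norm_le; last by rewrite mulr_ge0 // invr_ge0.
  apply/forallP => i; rewrite !mxE.
  rewrite addrAC subrr add0r normrN normrM normfV [`|zr s|]ger0_norm ?(ltW
    zs_gt0) //.
  have /inball_small : inball D (peval m (E i)) (beval D (box c 0) (E i)).
    apply: (inball_eval D_gt0) => j; apply: (@inball_box D c 0 m) => // k.
    by rewrite mxE subrr normr0 realZ0 mul0r.
  move=> /(_ D_gt0 _ _ (hr i)); rewrite !realZM realZ2 => h.
  rewrite ler_pdivrMr // -(ler_pM2l zD_gt0) -(ler_pM2l (ltr0Sn R 1)) mulrA.
  apply: le_trans (h _) _; first by lia.
  by rewrite le_eqVlt; apply/orP; left; apply/eqP; field; rewrite gt_eqF.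
have ctrct x y : `|x - m| <= zr r / zr D -> `|y - m| <= zr r / zr D ->
    `|newton x - newton y| <= 2^-1 * `|x - y|.
  by move=> /inboxE/sub hx /inboxE/sub hy; apply: newton_contract hs hx hy.
have [x hx|//|x /inboxE hx /newton_zero] :=
    @box_fixed_point R 'rV[R]_n m _ newton rD0; last by exists x.
rewrite -(subrK (newton m) (newton x)) -addrA.
apply: (le_trans (ler_normD _ _)).
have := ctrct _ _ hx mm; lra.
Qed.

End Krawczyk.

Declare Scope pexpr_scope.
Delimit Scope pexpr_scope with P.
Bind Scope pexpr_scope with pexpr.
Notation "a + b" := (PAdd a b) : pexpr_scope.
Notation "a * b" := (PMul a b) : pexpr_scope.

(** * The zero of the balanced Einstein map *)

Section System.
Local Open Scope pexpr_scope.
Let var (i : nat) (lt_i4 : (i < 4)%N) : pexpr 4 := PVar (Ordinal lt_i4).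
Let p := @var 0 isT.
Let q := @var 1 isT.
Let A := @var 2 isT.
Let B := @var 3 isT.

(** 16 p^2 ric_q and 72 A^2 p^2 ric_k. *)
Definition num_q (p A : pexpr 4) := PInt 8 * p + PInt (-2) * A + PInt (-1).
Definition num_k (p A : pexpr 4) :=
  PInt 8 * (A * (A * A)) + PInt 20 * (A * (p * p)) + PInt (-5) * (p * p).
Definition num_C :=
  PInt 40 * ((p * p) * (q * q) * ((A * A) * (B * B)))
  + PInt 16 * ((p * p + q * q) * ((A * A) * (B * B)))
  + PInt 10 * ((p * p) * (q * q) * (A * A + B * B)).

(** The components of balanced_map multiplied by 1, 4, 8 and 8. *)
Definition bal_poly (j : nat) : pexpr 4 :=
  nth (PInt 0)
    [:: num_q p A * (q * q) + PInt (-1) * (num_q q B * (p * p));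
        num_k p A * ((q * q) * (B * B)) + PInt (-1) * (num_k q B * ((p * p) * (A
          * A)));
        PInt 9 * (((A * A) * (B * B)) * (num_q p A * (q * q)
          + num_q q B * (p * p)))
          + PInt (-1) * num_C;
        PInt 2 * (num_k p A * ((q * q) * (B * B))
          + num_k q B * ((p * p) * (A * A)))
          + PInt (-1) * num_C] j.
End System.

(** 1000 times the inverse of the Jacobian matrix at the root, rounded to
    integers. *)
Definition precond (i : nat) : seq Z :=
  nth [::] [:: [:: 1052; -283; 33; -8]; [:: 437; -97; -45; 46];
      [:: -664; 151; -68; 66]; [:: 570; -132; 58; -21]]%Z i.

Definition newton_poly (i : 'I_4) : pexpr 4 :=
  foldr (fun j e => PMul (PInt (nth 0%Z (precond i) j)) (bal_poly j) + e)%P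
     (PInt 0) (iota 0 4).

(** The root to four decimals: with radius 1/10000 this box contains the cube
    around the rational center of the statement. *)
Definition wide_mid (i : nat) : Z := nth 0%Z [:: 12373; 12845; 10397; 9632]%Z i.

(** The root to twenty decimals. *)
Definition root_mid (i : nat) : Z :=
  nth 0%Z [:: 123725279482231502999; 128454747084464857181;
             103968393607037102437; 96323409553439393492]%Z i.

Lemma wide_slopes : small_slopes 1000 newton_poly (10 ^ 4) (fun i
  => wide_mid i) 1.
Proof. by move=> i k; case_ord4 i; case_ord4 k; vm_compute. Qed.

Lemma root_residual : small_residual 1000 newton_poly (10 ^ 20) (fun i
  => root_mid i) (10 ^ 2).
Proof. by move=> i; case_ord4 i; vm_compute. Qed.

Section BalancedRoot.
Variable R : realType.
Definition row4 (p q A B : R) : 'rV[R]_4 := \row_i [:: p; q; A; B]`_i.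

Lemma row4_surj (x : 'rV[R]_4) : exists p q A B, x = row4 p q A B.
Proof.
exists (x 0 (inord 0)), (x 0 (inord 1)), (x 0 (inord 2)), (x 0 (inord 3)).
apply/rowP => i; rewrite mxE.
by case_ord4 i; congr (x 0 _); apply: val_inj; rewrite /= inordK.
Qed.

(** The preconditioning matrix is invertible. *)
Lemma newton_poly_zero (x : 'rV[R]_4) :
  (forall i, peval x (newton_poly i) = 0) <->
  [/\ peval x (bal_poly 0) = 0, peval x (bal_poly 1) = 0,
      peval x (bal_poly 2) = 0 & peval x (bal_poly 3) = 0].
Proof.
pose m i j := realZ R (nth 0%Z (precond i) j).
have E i : peval x (newton_poly i) =
    m i 0%N * peval x (bal_poly 0) + (m i 1%N * peval x (bal_poly 1) +
    (m i 2%N * peval x (bal_poly 2) + (m i 3%N * peval x (bal_poly 3) + 0))).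
  by rewrite -(realZ0 R).
split=> [h|[h0 h1 h2 h3] i]; last by rewrite E h0 h1 h2 h3 !mulr0 !addr0.
have := (h (inord 0), h (inord 1), h (inord 2), h (inord 3)).
rewrite !E !inordK //; move: (bal_poly 0) (bal_poly 1) (bal_poly 2) (bal_poly
  3).
move=> F0 F1 F2 F3; rewrite /m /= !realZE => -[[[h0 h1] h2] h3].
by split; lra.
Qed.

Lemma newton_poly_zeroP p q A B : p != 0 -> q != 0 -> A != 0 -> B != 0 ->
  balanced_map p q A B = (0, 0, 0, 0) <->
  (forall i, peval (row4 p q A B) (newton_poly i) = 0).
Proof.
move=> p0 q0 A0 B0; rewrite newton_poly_zero.
pose x := row4 p q A B.
have -> : balanced_map p q A B = (peval x (bal_poly 0),
  peval x (bal_poly 1) / 4,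
   peval x (bal_poly 2) / 8, peval x (bal_poly 3) / 8).
  rewrite /balanced_map /ric_q /ric_k /ric_C /rho /= !mxE /= !realZE.
  congr (_, _, _, _); field; by rewrite ?p0 ?q0 ?A0 ?B0.
rewrite -/x; move: (peval x _) (peval x _) (peval x _) (peval x _)
  => F0 F1 F2 F3.
by split=> [[e0 e1 e2 e3]|[-> -> -> ->]]; [split; lra|rewrite !mul0r].
Qed.

Lemma realZ_pow10 k : realZ R (Z.pow 10 (Z.of_nat k)) = 10 ^+ k.
Proof. by rewrite realZ_pow !realZE; congr (_ ^+ _); ring. Qed.

Lemma inbox_row4 D (c : nat -> Z) r p q A B :
  inbox D (fun i => c i) r (row4 p q A B) <->
  [/\ `|p - realZ R (c 0%N) / realZ R D| <= realZ R r / realZ R D,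
      `|q - realZ R (c 1%N) / realZ R D| <= realZ R r / realZ R D,
      `|A - realZ R (c 2%N) / realZ R D| <= realZ R r / realZ R D &
      `|B - realZ R (c 3%N) / realZ R D| <= realZ R r / realZ R D].
Proof.
split=> [h|[h0 h1 h2 h3] i]; last by rewrite mxE; case_ord4 i.
have := (h (inord 0), h (inord 1), h (inord 2), h (inord 3)).
by rewrite !mxE !inordK // => -[[[h0 h1] h2] h3].
Qed.

Definition in_wide (p q A B : R) := inbox (10 ^ 4) (fun i
  => wide_mid i) 1 (row4 p q A B).

Lemma in_wideE p q A B : in_wide p q A B <->
  [/\ `|p - decimal R [:: 1; 2; 3; 7; 3]%N| <= 10 ^- 4,
      `|q - decimal R [:: 1; 2; 8; 4; 5]%N| <= 10 ^- 4,
      `|A - decimal R [:: 1; 0; 3; 9; 7]%N| <= 10 ^- 4 &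
      `|B - decimal R [:: 0; 9; 6; 3; 2]%N| <= 10 ^- 4].
Proof.
rewrite /in_wide inbox_row4 (realZ_pow10 4) realZ1 div1r.
rewrite -[wide_mid 0]/12373%Z -[wide_mid 1]/12845%Z.
rewrite -[wide_mid 2]/10397%Z -[wide_mid 3]/9632%Z.
rewrite !realZE /decimal /= !ler_distl.
by split=> -[h0 h1 h2 h3]; split; lra.
Qed.

Lemma cube_wide p q A B : cube9 p q A B -> in_wide p q A B.
Proof.
case=> h0 h1 h2 h3; apply/in_wideE.
move: h0 h1 h2 h3; rewrite /decimal /= !ler_distl => h0 h1 h2 h3; split; lra.
Qed.

Lemma wide_pos p q A B : in_wide p q A B ->
  [/\ [/\ 0 < p, 0 < q, 0 < A & 0 < B], p < q & A != 1].
Proof.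
move=> /in_wideE[]; rewrite /decimal /= !ler_distl => h0 h1 h2 h3.
by split; [split| |]; lra.
Qed.

Lemma balanced_root : exists p q A B : R,
  [/\ in_wide p q A B, balanced_map p q A B = (0, 0, 0, 0) &
    [/\ `|p - decimal R [:: 1; 2;3;7;2;5;2;7;9;4;8;2;2;3;1;5;0;2;9;9;9]%N| <= 10
      ^- 18,
        `|q - decimal R [:: 1; 2;8;4;5;4;7;4;7;0;8;4;4;6;4;8;5;7;1;8;1]%N| <= 10
          ^- 18,
        `|A - decimal R [:: 1; 0;3;9;6;8;3;9;3;6;0;7;0;3;7;1;0;2;4;3;7]%N| <= 10
          ^- 18 &
        `|B - decimal R [:: 0; 9;6;3;2;3;4;0;9;5;5;3;4;3;9;3;9;3;4;9;2]%N| <= 10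
          ^- 18]].
Proof.
have key p q A B : inbox (10 ^ 20) (fun i => root_mid i) (10 ^ 2) (row4 p q A B)
  ->
    [/\ `|p - decimal R [:: 1; 2;3;7;2;5;2;7;9;4;8;2;2;3;1;5;0;2;9;9;9]%N| <= 10
      ^- 18,
        `|q - decimal R [:: 1; 2;8;4;5;4;7;4;7;0;8;4;4;6;4;8;5;7;1;8;1]%N| <= 10
          ^- 18,
        `|A - decimal R [:: 1; 0;3;9;6;8;3;9;3;6;0;7;0;3;7;1;0;2;4;3;7]%N| <= 10
          ^- 18 &
        `|B - decimal R [:: 0; 9;6;3;2;3;4;0;9;5;5;3;4;3;9;3;9;3;4;9;2]%N| <= 10
          ^- 18].
  rewrite inbox_row4 (realZ_pow10 20) (realZ_pow10 2).
  rewrite -[root_mid 0]/123725279482231502999%Z -[root_mid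
    1]/128454747084464857181%Z.
  rewrite -[root_mid 2]/103968393607037102437%Z -[root_mid
    3]/96323409553439393492%Z.
  rewrite !realZE /decimal /= !ler_distl => -[h0 h1 h2 h3].
  split; lra.
have sub x : inbox (10 ^ 20) (fun i => root_mid i) (10 ^ 2) x ->
    inbox (10 ^ 4) (fun i => wide_mid i) 1 (x : 'rV[R]_4).
  have [p [q [A [B ->]]]] := row4_surj x => /key[h0 h1 h2 h3].
  apply/in_wideE; move: h0 h1 h2 h3; rewrite /decimal /= !ler_distl
    => h0 h1 h2 h3; split; lra.
have [x hx zx] := krawczyk_exists (s := 1000) (D0 := 10 ^ 4) (D := 10 ^ 20) (r
  := 10 ^ 2) isT isT isT isT wide_slopes sub root_residual.
have := row4_surj x => -[p [q [A [B ex]]]]; rewrite ex in hx zx.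
have w : in_wide p q A B by apply: sub.
exists p, q, A, B; split=> //; last exact: key.
have [[p0 q0 A0 B0] _ _] := wide_pos w.
by apply/newton_poly_zeroP; rewrite ?gt_eqF.
Qed.

Lemma balanced_root_unique p q A B p' q' A' B' :
  in_wide p q A B -> in_wide p' q' A' B' ->
  balanced_map p q A B = (0, 0, 0, 0) -> balanced_map p' q' A' B' = (0, 0, 0,
    0) ->
  (p', q', A', B') = (p, q, A, B).
Proof.
move=> w w'.
have [[p0 q0 A0 B0] _ _] := wide_pos w.
have [[p0' q0' A0' B0'] _ _] := wide_pos w'.
rewrite !newton_poly_zeroP ?gt_eqF // => z z'.
have /rowP e : row4 p' q' A' B' = row4 p q A B.
  by apply: (krawczyk_unique (s := 1000) (D := 10 ^ 4) isT isT) wide_slopes w' w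
    z' z.
have := (e (inord 0), e (inord 1), e (inord 2), e (inord 3)).
by rewrite !mxE !inordK //= => -[[[-> ->] ->] ->].
Qed.
End BalancedRoot.

Section Swap.
Variable R : realType.
Lemma balanced_map_swap (p q A B : R) : 0 < p -> 0 < q -> 0 < A -> 0 < B ->
  balanced_map p q A B = (0, 0, 0, 0) -> balanced_map q p B A = (0, 0, 0, 0).
Proof.
move=> p0 q0 A0 B0 /balanced_map_zeroP-/(_ p0 q0 A0 B0)[e1 e2 e3 e4].
apply/balanced_map_zeroP => //; split; rewrite ?e1 ?e2 ?e3 //.
rewrite -e4 /ric_C [q ^- 2 + _]addrC [B ^- 2 + _]addrC //.
Qed.
End Swap.

Theorem theorem7p24 (R : realType) :
  exists p q A B : R,
    [/\ balanced_einstein 9 p q A B,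
        [/\ `|p - decimal R [:: 1; 2;3;7;2;5;2;7;9;4;8;2;2;3;1;5;0]%N|
              <= 10 ^- 16 / 2,
            `|q - decimal R [:: 1; 2;8;4;5;4;7;4;7;0;8;4;4;6;4;8;6]%N|
              <= 10 ^- 16 / 2,
            `|A - decimal R [:: 1; 0;3;9;6;8;3;9;3;6;0;7;0;3;7;1;0]%N|
              <= 10 ^- 16 / 2 &
            `|B - decimal R [:: 0; 9;6;3;2;3;4;0;9;5;5;3;4;3;9;3;9]%N|
              <= 10 ^- 16 / 2],
        ~ [/\ p = q, A = 1 & B = 1] /\ [/\ 0 < p, 0 < q, 0 < A & 0 < B],
        forall p' q' A' B' : R,
          cube9 p' q' A' B' \/ cube9 q' p' B' A' ->
          (balanced_einstein 9 p' q' A' B' <->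
             (p', q', A', B') = (p, q, A, B) \/
             (p', q', A', B') = (q, p, B, A)) &
        [/\ p < q, cube9 p q A B, balanced_map p q A B = (0, 0, 0, 0) &
            forall p' q' A' B' : R, cube9 p' q' A' B' ->
              balanced_map p' q' A' B' = (0, 0, 0, 0) ->
              (p', q', A', B') = (p, q, A, B)]].
Proof.
have [p [q [A [B [w z [hp hq hA hB]]]]]] := balanced_root R.
have [[p0 q0 A0 B0] pq A1] := wide_pos w.
have cube_pos (p' q' A' B' : R) : cube9 p' q' A' B' -> [/\ 0 < p', 0 < q',
  0 < A' & 0 < B'].
  by move=> /cube_wide/wide_pos[].
have uniq p' q' A' B' : cube9 p' q' A' B' -> balanced_map p' q' A' B' = (0, 0,
  0, 0) ->
    (p', q', A', B') = (p, q, A, B).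
  by move=> /cube_wide w' z'; apply: balanced_root_unique.
exists p, q, A, B; split.
- exact/einstein_zero.
- by move: hp hq hA hB; rewrite /decimal /= !ler_distl => hp hq hA hB; split;
  lra.
- by split=> // -[_ A_1 _]; rewrite A_1 eqxx in A1.
- move=> p' q' A' B' hc; split; last first.
    case=> -[-> -> -> ->]; apply/einstein_zero => //.
    exact: balanced_map_swap.
  case: hc => hc; have [hp' hq' hA' hB'] := cube_pos _ _ _ _ hc.
    by move/(einstein_zero hp' hq' hA' hB') => h; left;
      exact: (uniq _ _ _ _ hc h).
  move/(einstein_zero hq' hp' hB' hA')/(balanced_map_swap hq' hp' hB' hA') => h;
    right.
  by have [-> -> -> ->] := uniq _ _ _ _ hc h.
- split=> //.
  by move: hp hq hA hB; rewrite /cube9 /decimal /= !ler_distl => hp hq hA hB;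
    split; lra.
Qed.
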